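(* Assume conditions (A), (B), (C) spelled out in the context. Let $(\tilde\tau_d,\tilde\gamma_d)\in\arg\min_{(\tau,\gamma)\in\mathcal F_d}\hat R(t,c;\check z)$ (with a deterministic tie-breaking rule if needed), let $(\tilde t_d,\tilde c_d)$ be the induced functionals, and let $\hat\theta_{\mathrm{NOMAD}}=\hat\theta_{\tilde t_d,\tilde c_d}$. Then, as $d\to\infty$, \[ R(\hat\theta_{\mathrm{NOMAD}},\theta)-R^\star(\theta)=o_{\mathbb P}(d), \] where $R^\star(\theta)=\inf_{(\tau,\gamma)\in\mathcal F}R(t,c;\theta)$ and $R(\hat\theta_{\mathrm{NOMAD}},\theta)=R(\tilde t_d,\tilde c_d;\theta)$.
   Context: (A) Model and admissible class. $\check z_i=\theta_i+\varepsilon_i$, $\varepsilon_i$ i.i.d. $N(0,1)$, $i=1,\dots,d$, with deterministic $\theta=\theta^{(d)}\in\mathbb R^d$; $G_d=\frac1d\sum_{i=1}^d\delta_{\theta_i}$. Fix integers $q_t,q_c\ge1$ and $C^2$ functions $\psi_{tm}$ ($m\le q_t$), $\psi_{c\ell}$ ($\ell\le q_c$) on $\mathbb R$, each satisfying $|\psi(x)|+|\psi'(x)|+|\psi''(x)|\le C_\psi(1+|x|^{r_\psi})$ for all $x$, with constants $C_\psi>0,r_\psi\ge0$. Put $s_t(z)=\bigl(\frac1d\sum_i\psi_{tm}(z_i)\bigr)_{m\le q_t}$, $s_c(z)=\bigl(\frac1d\sum_i\psi_{c\ell}(z_i)\bigr)_{\ell\le q_c}$. $\mathcal S_t\subset\mathbb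 R^{q_t}$, $\mathcal S_c\subset\mathbb R^{q_c}$ are compact sets containing the ranges of these summaries with overwhelming probability. $\mathcal F$ is the set of pairs $(\tau,\gamma)$ with $\tau:\mathcal S_t\to[0,t_{\max}]$, $\gamma:\mathcal S_c\to[0,c_{\max}]$, $0\le c_{\max}<1$, $\tau,\gamma\in C^2$, $\sup\|\nabla\tau\|_2+\sup\|D^2\tau\|_{\mathrm{op}}\le L_t$ and $\sup\|\nabla\gamma\|_2+\sup\|D^2\gamma\|_{\mathrm{op}}\le L_c$. The pair $(\tau,\gamma)$ induces functionals $t(z)=\tau(s_t(z))$, $c(z)=\gamma(s_c(z))$. The corresponding GEST estimator $\hat\theta_{t,c}$ has coordinates $\check z_i-t(\check z)\,\mathrm{sgn}(\check z_i)|\check z_i|^{1-c(\check z)}$, and its oracle risk is $R(t,c;\theta)=E_\theta\|\hat\theta_{t,c}-\theta\|_2^2$. (B) Sieve. $\mathcal T_d$ and $\mathcal C_d$ are tensor-product spline sieves of order at least $3$ on $\mathcal S_t$, $\mathcal S_c$, of dimensions $K_{t,d},K_{c,d}\to\infty$, with $m_d=K_{t,d}+K_{c,d}\to\infty$ and $m_d/d\to0$; coefficients are constrained so that elements of $\mathcal T_d$ take values in $[0,t_{\max}]$ with first and second derivatives bounded by $L_t$, and elements of $\mathcal C_d$ take values in $[0,c_{\max}]$ with first and second derivatives bounded by $L_c$. $\mathcal F_d=\mathcal T_d\times\mathcal C_d\subset\mathcal F$. Metric: $d^{(1)}_{\mathcal F}((\tau_1,\gamma_1),(\tau_2,\gamma_2))=\|\tau_1-\tau_2\|_{\infty}+\|\nabla\tau_1-\nabla\tau_2\|_{\infty}+\|\gamma_1-\gamma_2\|_{\infty}+\|\nabla\gamma_1-\nabla\gamma_2\|_{\infty}$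 (sup norms over $\mathcal S_t$, resp. $\mathcal S_c$). For every $(\tau,\gamma)\in\mathcal F$ there is $(\tau_d,\gamma_d)\in\mathcal F_d$ with $d^{(1)}_{\mathcal F}((\tau_d,\gamma_d),(\tau,\gamma))\to0$. (C) Signals and scores. $G_d\to G$ for some probability measure $G$ on $\mathbb R$, and $\sup_d\frac1d\sum_{i=1}^de^{\lambda_0|\theta_i|}<\infty$ for some $\lambda_0>0$. With $\phi$ the standard normal density, $f_d(z)=\int\phi(z-\theta)\,dG_d(\theta)$, $f(z)=\int\phi(z-\theta)\,dG(\theta)$, $l_d'=(\log f_d)'$, $l'=(\log f)'$. $\widehat l_d'$ is a data-based score estimator (obtained from a regular density estimator), and there is a deterministic $a_d\to\infty$ with $\sup_{|z|\le a_d}|\widehat l_d'(z)-l'(z)|\to0$ in probability and $\sup_{|z|\le a_d}|l_d'(z)-l'(z)|\to0$. There is a measurable $M_d$ with $|\widehat l_d'(z)|+|l_d'(z)|\le M_d(z)$ for all $z$ and $M_d(z)^2\le C_M(1+|z|^q)$ uniformly in $d$, for some fixed $q\ge2$. Finally $\frac1d\sum_{i=1}^dE\bigl[(\theta_i-\check z_i-l_d'(\check z_i))^2\bigr]\to0$. Approximate risk. $\hat R(t,c;\check z)=d+\int_{\mathbb R^d}\hat H\,dz$ with \[ \hat H=-\sum_{i=1}^d\frac{1}{|z_i|^{c}}\Bigl(2|z_i|\frac{\partial t}{\partial|z_i|}-2t|z_i|\ln|z_i|\frac{\partial c}{\partial|z_i|}+2t(1-c)-t^2|z_i|^{2-c}\Bigr)\prod_{j=1}^d\phi\bigl(z_j-\check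 z_j-\widehat l_d'(\check z_j)\bigr), \] where $t=t(z)$, $c=c(z)$ and $\partial/\partial|z_i|$ means $\mathrm{sgn}(z_i)\,\partial/\partial z_i$.
   Formalization: Since τ, γ are given only on S_t, S_c but t(z), c(z) are needed for all z, a fixed extension rule is assumed: it agrees with τ, γ on these sets, is C¹ and bounded (by a constant below 1 for γ), with gradient bounded uniformly over the class. *)

(* Defs.v *)
From HB Require Import structures.
From mathcomp Require Import all_boot all_order all_algebra.
From mathcomp Require Import all_classical all_reals all_analysis.

Set Implicit Arguments.
Unset Strict Implicit.
Unset Printing Implicit Defensive.

Import Order.TTheory GRing.Theory Num.Theory.
Import numFieldNormedType.Exports.

Local Open Scope classical_set_scope.
Local Open Scope ring_scope.

(* Vectors of observations z in R^d are tuples, because tuples (unlike row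
   vectors) carry the product sigma-algebra; vectors of summaries are row
   vectors, because row vectors (unlike tuples) form a normed space. *)
Section lebesgue_tuple.
Variable R : realType.
Let rT := measurableTypeR R.

Definition tuple_cons n (p : rT * n.-tuple rT) : n.+1.-tuple rT :=
  [tuple of p.1 :: p.2].

Lemma measurable_tuple_cons n : measurable_fun setT (@tuple_cons n).
Proof. exact: measurable_cons. Qed.

Definition lebesgue_cons n (m : {measure set (n.-tuple rT) -> \bar R}) :=
  pushforward (lebesgue_measure \x^ m)%E (@tuple_cons n).

Section lebesgue_cons.
Variables (n : nat) (m : {measure set (n.-tuple rT) -> \bar R}).

Let lebesgue_cons0 : lebesgue_cons m set0 = 0%E.
Proof. by rewrite /lebesgue_cons /pushforward preimage_set0 measure0. Qed.

Let lebesgue_cons_ge0 A : (0 <= lebesgue_cons m A)%E.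
Proof. by rewrite /lebesgue_cons /pushforward measure_ge0. Qed.

Let lebesgue_cons_sigma_additive : semi_sigma_additive (lebesgue_cons m).
Proof.
move=> F mF tF mUF; rewrite /lebesgue_cons /pushforward preimage_bigcup.
have mtF i : measurable (@tuple_cons n @^-1` F i).
  by rewrite -[X in measurable X]setTI; exact: measurable_tuple_cons.
apply: measure_semi_sigma_additive => //.
- apply/trivIsetP => /= i j _ _ ij; rewrite -preimage_setI.
  by move/trivIsetP : tF => /(_ _ _ _ _ ij) ->//; rewrite preimage_set0.
- exact: bigcupT_measurable.
Qed.

HB.instance Definition _ := isMeasure.Build _ _ _ (lebesgue_cons m)
  lebesgue_cons0 lebesgue_cons_ge0 lebesgue_cons_sigma_additive.

End lebesgue_cons.

(* Lebesgue measure on R^n; see [lebesgue_tuple_box]. *)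
Fixpoint lebesgue_tuple n : {measure set (n.-tuple rT) -> \bar R} :=
  match n with
  | 0 => dirac [tuple]
  | n'.+1 => lebesgue_cons (lebesgue_tuple n')
  end.

Lemma lebesgue_tuple_box n (A : 'I_n -> set rT) :
  (forall i, measurable (A i)) ->
  lebesgue_tuple n [set z | forall i, A i (tnth z i)] =
  (\prod_(i < n) lebesgue_measure (A i))%E.
Proof.
elim: n A => [|n IH] A mA.
  by rewrite big_ord0 /= diracE mem_set// => -[].
have mB : measurable [set z : n.-tuple rT |
    forall i, A (lift ord0 i) (tnth z i)].
  rewrite (_ : [set _ | _] = \bigcap_(i in [set: 'I_n])
      ((fun z : n.-tuple rT => tnth z i) @^-1` A (lift ord0 i))).
    apply: fin_bigcap_measurable => // i _; rewrite -[X in measurable X]setTI.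
    exact: measurable_tnth.
  by apply/seteqP; split => z /= h i; [move=> _|]; apply: h.
rewrite big_ord_recl /= -(IH (fun i => A (lift ord0 i)))//.
rewrite -product_measure2E// /lebesgue_cons /pushforward.
congr ((_ \x^ _)%E _); apply/seteqP; split => -[x z] /=.
  by move=> h; split=> [|i]; [exact: (h ord0)|
    rewrite -(tnthS x); exact: (h (lift ord0 i))].
move=> [h0 h] i; case: (unliftP ord0 i) => [j|] ->; last exact: h0.
by rewrite /tuple_cons tnthS; exact: h.
Qed.

End lebesgue_tuple.

Section calculus.
Variable R : realType.

Definition smooth2 (psi : R -> R) :=
  [/\ forall x, derivable psi x 1, forall x, derivable (derive1 psi) x 1 &
      continuous (derive1n 2 psi)].

Definition poly_growth2 (psi : R -> R) (C r : R) :=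
  forall x,
    `|psi x| + `|derive1 psi x| + `|derive1n 2 psi x| <= C * (1 + `|x| `^ r).

Variable q : nat.
Implicit Types (U S : set 'rV[R]_q) (f tau : 'rV[R]_q -> R) (s : 'rV[R]_q).

Definition partial f (j : 'I_q) s : R := 'D_(delta_mx 0 j) f s.

Definition grad f s : 'rV[R]_q := \row_j partial f j s.

Definition hessian f s : 'M[R]_q := \matrix_(i, j) partial (partial f j) i s.

Definition C1_on U f :=
  (forall s, U s -> differentiable f s) /\
  (forall j s, U s -> {for s, continuous (partial f j)}).

Definition C2_on U f := C1_on U f /\ forall j, C1_on U (partial f j).

Definition norm2 s : R := Num.sqrt (\sum_j s 0 j ^+ 2).

Definition sup_on S (g : 'rV[R]_q -> \bar R) : \bar R := ereal_sup (g @` S).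

Definition opnorm (A : 'M[R]_q) : \bar R :=
  sup_on [set u | norm2 u <= 1] (fun u => (norm2 (u *m A))%:E).

(* Functions S -> [0, ub] of class C^2 with bounded derivatives. A function on
   S is represented by a total function, of which only the values in a
   neighbourhood of S are constrained; C^2 on the compact set S means C^2 on an
   open neighbourhood of S. *)
Definition smooth_class S (ub L : R) : set ('rV[R]_q -> R) :=
  [set tau | [/\ exists2 U, open U /\ S `<=` U & C2_on U tau,
    forall s, S s -> 0 <= tau s <= ub &
    (sup_on S (fun s => (norm2 (grad tau s))%:E) +
     sup_on S (fun s => opnorm (hessian tau s)) <= L%:E)%E]].

Definition dist1 S f1 f2 : \bar R :=
  (sup_on S (fun s => `|f1 s - f2 s|%:E) +
   sup_on S (fun s => (norm2 (grad f1 s - grad f2 s))%:E))%E.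

(* tau(s(z)) has to make sense for every z in R^d, although tau is only given
   on S: [ext tau] is the function used on the whole space. It agrees with tau
   on S, is C^1 with bounded gradient, and takes values in [-b, b] (an
   extension of class C^1 cannot be asked to keep the range [0, ub], e.g. if
   tau reaches 0 or ub on the boundary with a nonzero slope). *)
Definition extension_rule S (ub L b : R)
    (ext : ('rV[R]_q -> R) -> 'rV[R]_q -> R) :=
  exists L' : R, forall tau, smooth_class S ub L tau ->
    [/\ forall s, S s -> ext tau s = tau s,
        C1_on setT (ext tau),
        forall s, `|ext tau s| <= b &
        forall s, norm2 (grad (ext tau) s) <= L'].

(* B-spline of order k.+1 (degree k) with index i for the knots u, by the
   Cox-de Boor recursion (0/0 = 0 in the library). Splines are
   right-continuous, except at the right end point b of the domain, where they
   are left-continuous. *)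
Fixpoint bspline (u : nat -> R) (b : R) (k i : nat) (x : R) : R :=
  match k with
  | 0 => (if x == b then (u i < b) && (u i.+1 == b)
          else (u i <= x < u i.+1))%:R
  | k'.+1 =>
      (x - u i) / (u (i + k)%N - u i) * bspline u b k' i x +
      (u (i + k.+1)%N - x) / (u (i + k.+1)%N - u i.+1) * bspline u b k' i.+1 x
  end.

(* n j basis functions in the j-th coordinate, for the nondecreasing knots
   u j 0, ..., u j (n j + k), with domain [u j k, u j (n j)]. *)
Definition tensor_spline S (k : nat) (n : 'I_q -> nat) (u : 'I_q -> nat -> R) :
    set ('rV[R]_q -> R) :=
  [set f | exists a : {dffun forall j : 'I_q, 'I_(n j)} -> R,
    forall s, S s ->
    f s = \sum_i a i * \prod_j bspline (u j) (u j (n j)) k (i j) (s 0 j)].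

Definition spline_sieve S (order K : nat) (T : set ('rV[R]_q -> R)) :=
  exists n u,
    [/\ K = (\prod_j n j)%N,
        forall j, [/\ (order <= n j)%N,
          {homo u j : i i' / (i <= i')%N >-> i <= i'},
          forall i, (i < n j)%N -> u j i < u j (i + order)%N &
          u j order.-1 < u j (n j)],
        forall s, S s -> forall j, u j order.-1 <= s 0 j <= u j (n j) &
        T `<=` tensor_spline S order.-1 n u].

End calculus.

Definition admissible (R : realType) qt qc (St : set 'rV[R]_qt)
    (Sc : set 'rV[R]_qc) (tmax cmax Lt Lc : R) :
    set (('rV[R]_qt -> R) * ('rV[R]_qc -> R)) :=
  smooth_class St tmax Lt `*` smooth_class Sc cmax Lc.

Section model.
Variable R : realType.

Definition phi (x : R) : R := normal_pdf 0 1 x.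

Definition observation d disp (Omega : measurableType disp)
    (theta : d.-tuple R) (eps : 'I_d -> Omega -> R) (w : Omega) : d.-tuple R :=
  [tuple tnth theta i + eps i w | i < d].

(* Taking A i = setT shows that this is the product rule for every subfamily. *)
Definition independent_family d disp (Omega : measurableType disp)
    (P : probability Omega R) (X : 'I_d -> Omega -> R) :=
  forall A : 'I_d -> set R, (forall i, measurable (A i)) ->
    P [set w | forall i, A i (X i w)] = (\prod_(i < d) P (X i @^-1` A i))%E.

Definition iid_std_normal d disp (Omega : measurableType disp)
    (P : probability Omega R) (eps : 'I_d -> Omega -> R) :=
  [/\ forall i, measurable_fun setT (eps i),
      independent_family P eps &
      forall i (A : set R), measurable A ->
        P (eps i @^-1` A) = normal_prob 0 1 A].

Definition summary d q (psi : 'I_q -> R -> R) (z : d.-tuple R) : 'rV[R]_q :=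
  \row_m (d%:R^-1 * \sum_(i < d) psi m (tnth z i)).

Definition functional d q (psi : 'I_q -> R -> R)
    (ext : ('rV[R]_q -> R) -> 'rV[R]_q -> R) (tau : 'rV[R]_q -> R)
    (z : d.-tuple R) : R :=
  ext tau (summary psi z).

Definition gest d (t c : d.-tuple R -> R) (y : d.-tuple R) : d.-tuple R :=
  [tuple tnth y i - t y * Num.sg (tnth y i) * `|tnth y i| `^ (1 - c y) | i < d].

Definition risk d disp (Omega : measurableType disp) (P : probability Omega R)
    (theta : d.-tuple R) (eps : 'I_d -> Omega -> R) (t c : d.-tuple R -> R) :
    \bar R :=
  'E_P[fun w => \sum_(i < d)
    (tnth (gest t c (observation theta eps w)) i - tnth theta i) ^+ 2].

Definition set_coord d (z : d.-tuple R) (i : 'I_d) (x : R) : d.-tuple R :=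
  [tuple if j == i then x else tnth z j | j < d].

(* dF/d|z_i|, i.e. sgn(z_i) times the i-th partial derivative. *)
Definition dabs d (F : d.-tuple R -> R) (i : 'I_d) (z : d.-tuple R) : R :=
  Num.sg (tnth z i) * derive1 (fun x => F (set_coord z i x)) (tnth z i).

Definition Hhat d (score_est : R -> R) (y : d.-tuple R)
    (t c : d.-tuple R -> R) (z : d.-tuple R) : R :=
  - (\sum_(i < d) (`|tnth z i| `^ c z)^-1 *
      (2 * `|tnth z i| * dabs t i z
       - 2 * t z * `|tnth z i| * ln `|tnth z i| * dabs c i z
       + 2 * t z * (1 - c z)
       - t z ^+ 2 * `|tnth z i| `^ (2 - c z)))
  * \prod_(j < d) phi (tnth z j - tnth y j - score_est (tnth y j)).

Definition Rhat d (score_est : R -> R) (y : d.-tuple R)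
    (t c : d.-tuple R -> R) : \bar R :=
  (d%:R%:E + \int[lebesgue_tuple R d]_z (Hhat score_est y t c z)%:E)%E.

Definition is_argmin (T : Type) (D : set T) (f : T -> \bar R) (a : T) :=
  D a /\ forall a', D a' -> (f a <= f a')%E.

Definition empirical d (theta : d.-tuple R) :
    {measure set (measurableTypeR R) -> \bar R} :=
  mscale (d%:R^-1)%:nng
    (msum (fun i => dirac (nth 0 theta i : measurableTypeR R)) d).

Definition mixture (mu : {measure set (measurableTypeR R) -> \bar R}) (z : R) :
    R :=
  \int[mu]_x phi (z - x).

Definition score (mu : {measure set (measurableTypeR R) -> \bar R}) : R -> R :=
  derive1 (fun z => ln (mixture mu z)).

Definition weak_cvg (mu : nat -> {measure set (measurableTypeR R) -> \bar R})
    (G : probability (measurableTypeR R) R) :=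
  forall h : R -> R, continuous h -> (exists B, forall x, `|h x| <= B) ->
    (\int[mu d]_x h x) @[d --> \oo] --> \int[G]_x h x.

(* Convergence to 0 in probability, with the outer measure of P so that X d
   need not be measurable. *)
Definition cvg0_in_prob disp (Omega : measurableType disp)
    (P : probability Omega R) (X : nat -> Omega -> \bar R) :=
  forall e : R, 0 < e ->
    (P^*)%mu [set w | (e%:E < `|X d w|)%E] @[d --> \oo] --> 0%E.

Definition overwhelming disp (Omega : measurableType disp)
    (P : probability Omega R) (A : nat -> set Omega) :=
  forall k : nat,
    ((d%:R ^+ k)%:E * (P^*)%mu (~` A d))%E @[d --> \oo] --> 0%E.

End model.

(* Main.v *)
(* Fix an observation y and put u_i = y_i + lhat(y_i). By the assumptions on
   the scores, u is close to theta in empirical mean square, with high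
   probability. For constants t, c let A(v; t, c) be the risk at mean v of the
   one-dimensional estimator x - t sgn(x) |x|^(1 - c), and let t0, c0 be the
   values of the functionals at the means of the summaries of independent
   N(u_i, 1). Uniformly over the class, both R / d and Rhat / d are close to the
   average of the A(u_i; t0, c0). For R, this holds since the summaries
   concentrate and the loss is continuous. For Rhat, note that the product of
   densities in Hhat makes the z_i independent N(u_i, 1); the terms with
   derivatives of t and c are O(1) in total, and what remains is, once t and c
   are frozen at t0 and c0, Stein's unbiased estimate of the risk. Since the
   class is totally bounded in the sup norm, the sieve approximates it
   uniformly; so the minimizer of Rhat over the sieve nearly minimizes R over
   the class. Products of a weight and a difference are split by AM-GM
   throughout, so that only small squared differences and bounded moments are
   needed. *)
From HB Require Import structures.
Require Import Defs.
From mathcomp Require Import all_boot all_order all_algebra.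
From mathcomp Require Import all_classical all_reals all_analysis.
From mathcomp Require Import measurable_realfun ring lra.

Set Implicit Arguments.
Unset Strict Implicit.
Unset Printing Implicit Defensive.

Import Order.TTheory GRing.Theory Num.Theory.
Import numFieldNormedType.Exports.

Local Open Scope classical_set_scope.
Local Open Scope ring_scope.

(** * Moduli of continuity of the loss and of its unbiased estimate *)

(** The sieve and the extension rule control a function only on [St] and [Sc], whereas the common
    limit [plug] evaluates it at the mean summaries [emean], which may lie outside these sets. The
    bridge is the observed summary: with high probability it lies in the set and is close to
    [emean], and extended functions are uniformly Lipschitz. The near-minimizer of the risk moves
    with [d], so density of the sieve at each single function is not enough; this is what the finite
    net repairs. The selected pair depends on the data without any measurability, so the argument
    runs pointwise on an event whose complement has small outer measure, and all thresholds are
    fixed before the functions. The map [sgn(x) |x|^(1 - c)] is merely Hoelder at 0 for [c > 0], and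
    its derivative is unbounded there. Hence every modulus has the shape of a small multiple of a
    weight plus a large multiple of squared differences, and the weights only need finite Gaussian
    means. The moment bound [K] is chosen before the accuracy [delta], since the latter depends on
    it. *)

Ltac nneg := repeat first [ done | exact: normr_ge0 | exact: powR_ge0
  | exact: expR_ge0 | exact: ltW | exact: sqr_ge0 | rewrite invr_ge0
  | apply: exprn_ge0 | apply: addr_ge0 | apply: mulr_ge0 | apply: divr_ge0 | lra ].

Section pointwise.
Variable R : realType.
Implicit Types (x y u e t c b B eta : R).

(** Polynomial growth is measured throughout in natural powers of this weight because it is
    submultiplicative: by [wtD], a shift by noise factors out, and the noise factor has finite
    Gaussian moments. *)
Definition wt x : R := 1 + `|x|.

Lemma wt_ge1 x : 1 <= wt x.
Proof. by rewrite /wt lerDl. Qed.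

Lemma wt_gt0 x : 0 < wt x.
Proof. exact: lt_le_trans (wt_ge1 x). Qed.

Lemma wt_ge0 x : 0 <= wt x.
Proof. exact/ltW/wt_gt0. Qed.

Lemma norm_le_wt x : `|x| <= wt x.
Proof. by rewrite /wt lerDr. Qed.

Lemma wtD x y : wt (x + y) <= wt x * wt y.
Proof.
rewrite /wt; have := ler_normD x y; have := normr_ge0 x; have := normr_ge0 y.
by move=> *; nra.
Qed.

Lemma wtX_ge1 x n : 1 <= wt x ^+ n.
Proof. exact/exprn_ege1/wt_ge1. Qed.

Lemma ler_wtX x m n : (m <= n)%N -> wt x ^+ m <= wt x ^+ n.
Proof. exact/ler_weXn2l/wt_ge1. Qed.

Lemma powR_le_wt x r n : 0 <= r <= n%:R -> `|x| `^ r <= wt x ^+ n.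
Proof.
move=> /andP[r0 rn]; rewrite -powR_mulrn ?wt_ge0//.
apply: (@le_trans _ _ (wt x `^ r)).
  by apply: ge0_ler_powR => //; rewrite ?nnegrE ?wt_ge0// norm_le_wt.
exact/ler_powR/rn/wt_ge1.
Qed.

(** The tangent bound [1 + (y - x) <= expR (y - x)], multiplied by [expR x], gives the claim with
    the larger exponential alone; the sum keeps it symmetric. *)
Lemma expRB_le x y : `|expR x - expR y| <= `|x - y| * (expR x + expR y).
Proof.
wlog xy : x y / y <= x => [hw|].
  have [|/ltW] := leP y x; first exact: hw.
  by move/hw; rewrite distrC (distrC y) (addrC (expR y)).
rewrite !ger0_norm ?subr_ge0 ?ler_expR//.
have := expR_ge1Dx (y - x); rewrite expRB => h.
have ex := expR_gt0 x; have ey := expR_gt0 y.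
have : expR x * (1 + (y - x)) <= expR y.
  rewrite (le_trans (ler_wpM2l (ltW ex) h))// mulrCA divff ?mulr1//.
  exact: lt0r_neq0.
by nra.
Qed.

Lemma powRB_le x r s : 0 < x ->
  `|x `^ r - x `^ s| <= `|r - s| * `|ln x| * (x `^ r + x `^ s).
Proof.
move=> x0; rewrite /powR gt_eqF// (le_trans (expRB_le _ _))//.
by rewrite -mulrBl normrM.
Qed.

Lemma ln_le_wt k x : 0 < k <= 1 -> k <= `|x| ->
  `|ln `|x| | <= (1 - ln k) * wt x.
Proof.
move=> /andP[k0 k1] kx; have x0 : 0 < `|x| by exact: lt_le_trans kx.
have lk : ln k <= 0 by exact: ln_le0.
have lkx : ln k <= ln `|x| by rewrite ler_ln.
have lx := ltW (ln_sublinear x0).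
have wx := norm_le_wt x; have w1 := wt_ge1 x.
by rewrite ler_norml; apply/andP; split; nra.
Qed.

Definition shrink c x : R := Num.sg x * `|x| `^ (1 - c).

Lemma shrinkN c x : shrink c (- x) = - shrink c x.
Proof. by rewrite /shrink sgrN normrN mulNr. Qed.

Lemma shrink_pos c x : 0 < x -> shrink c x = x `^ (1 - c).
Proof. by move=> x0; rewrite /shrink gtr0_sg// mul1r gtr0_norm. Qed.

Lemma norm_shrink_le c x : `|shrink c x| <= `|x| `^ (1 - c).
Proof.
rewrite /shrink normrM normr_sg (ger0_norm (powR_ge0 _ _)).
by case: (x != 0); rewrite ?mul1r ?mul0r// powR_ge0.
Qed.

Lemma norm_shrink_wt c x : `|c| <= 1 -> `|shrink c x| <= wt x ^+ 2.
Proof.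
move=> c1; apply: (le_trans (norm_shrink_le _ _)); apply: powR_le_wt.
by move: c1; rewrite ler_norml => /andP[? ?]; apply/andP; split; lra.
Qed.

(** This identifies the quadratic term in the integrand of [Rhat] as a squared shrinkage. *)
Lemma shrinkX2 c x : x != 0 -> shrink c x ^+ 2 = `|x| `^ (2 - c) * (`|x| `^ c)^-1.
Proof.
move=> x0; rewrite /shrink exprMn sqr_sg x0 mul1r expr2 -powRN.
by rewrite -!powRD ?normr_eq0 ?x0 ?implybT//; congr powR; ring.
Qed.

(** Below [k], powers of [|x|] with exponent at least [1 - b] are negligible. The minimum with 1
    keeps [k <= 1], where larger exponents give smaller powers. *)
Lemma small_threshold b eta : b < 1 -> 0 < eta ->
  exists k : R, 0 < k <= 1 /\ k `^ (1 - b) <= eta.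
Proof.
move=> b1 e0; pose m := Num.min 1 eta.
have m0 : 0 < m by rewrite /m lt_min ltr01 e0.
have b0 : 0 < 1 - b by rewrite subr_gt0.
exists (m `^ (1 - b)^-1); split.
  rewrite powR_gt0//= -[leRHS](congr1 (fun f => f (1 - b)^-1) (@powR1 R)).
  rewrite ge0_ler_powR ?invr_ge0 ?nnegrE ?(ltW m0) ?(ltW b0)//.
  by rewrite /m ge_min lexx.
rewrite -powRrM mulVf ?gt_eqF// powRr1 ?(ltW m0)//.
by rewrite /m ge_min lexx orbT.
Qed.

Lemma powR_small b c k x r s : 0 < k <= 1 -> `|x| <= k -> 0 < s -> s <= r ->
  `|x| `^ r <= k `^ s.
Proof.
move=> /andP[k0 k1] xk s0 sr.
apply: (@le_trans _ _ (k `^ r)).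
  by apply: ge0_ler_powR; rewrite ?nnegrE ?(ltW k0)//; lra.
by apply: ger_powR => //; rewrite k0.
Qed.

(** By homogeneity only [r = x / y] matters. For [0 < r <= 1] and [a = 1 - c] in [[0, 2]],
    [1 - r^a <= 1 - r^2 <= 2 (1 - r)]. For negative [x] the ratio [(y - x) / y] exceeds 1, and
    bounding both values by [y^a] is enough. *)
Lemma shrink_diff_large c x y : `|c| <= 1 -> 0 < y -> `|x| <= y ->
  `|shrink c x - shrink c y| <= 2 * y `^ (1 - c) * ((y - x) / y).
Proof.
move=> c1 y0 xy; move: c1; rewrite ler_norml => /andP[c1 c2].
rewrite (shrink_pos c y0); set a := 1 - c.
have Y0 : 0 <= y `^ a by exact: powR_ge0.
have [x0|x0] := leP 0 x; last first.
  have h1 : `|shrink c x| <= y `^ a.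
    apply: (le_trans (norm_shrink_le _ _)).
    by apply: ge0_ler_powR => //; rewrite ?nnegrE ?(ltW y0)// /a; lra.
  have h2 : 1 <= (y - x) / y by rewrite ler_pdivlMr// mul1r; lra.
  apply: (le_trans (ler_normB _ _)); rewrite (ger0_norm Y0); nra.
pose r := x / y.
have r0 : 0 <= r by rewrite divr_ge0// ltW.
have r1 : r <= 1.
  by rewrite ler_pdivrMr// mul1r (le_trans _ xy)// ler_norm.
have xE : x = r * y by rewrite /r divfK// gt_eqF.
have ra : r ^+ 2 <= r `^ a \/ x = 0.
  have [r00|rn] := eqVneq r 0; first by right; rewrite xE r00 mul0r.
  left; rewrite -powR_mulrn//; apply: ger_powR; last by rewrite /a; lra.
  by rewrite r1 lt_def rn r0.
have -> : (y - x) / y = 1 - r by rewrite mulrBl divff ?gt_eqF.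
have [x00|xn0] := eqVneq x 0.
  have -> : r = 0 by rewrite /r x00 mul0r.
  by rewrite x00 /shrink sgr0 mul0r sub0r normrN ger0_norm//; lra.
have xp : 0 < x by rewrite lt_def xn0.
have {}ra : r ^+ 2 <= r `^ a by case: ra => // /eqP; rewrite (negbTE xn0).
have -> : shrink c x = r `^ a * y `^ a.
  by rewrite -powRM// ?(ltW y0)// -xE shrink_pos.
have ra1 : r `^ a <= 1.
  have <- : r `^ 0 = 1 by rewrite powRr0.
  apply: ger_powR; last by rewrite /a; lra.
  by rewrite r1 /r divr_gt0.
rewrite distrC -[X in X - _]mul1r -mulrBl normrM (ger0_norm Y0) ger0_norm ?subr_ge0//.
rewrite (mulrC _ (y `^ a)) -mulrA (mulrCA 2) ler_wpM2l//; nra.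
Qed.

(** No Lipschitz bound holds at 0. If both arguments are below the threshold, each value is at most
    [eta / 2]; otherwise the larger one exceeds [k], and [shrink_diff_large] divides by at least
    [k]. *)
Lemma shrink_modx b eta : 0 <= b < 1 -> 0 < eta ->
  exists2 M : R, 0 <= M & forall c x y, `|c| <= b ->
    `|shrink c x - shrink c y| <= eta + M * `|x - y| * (wt x * wt y) ^+ 2.
Proof.
move=> /andP[b0 b1] e0.
have e2 : 0 < eta / 2 by rewrite divr_gt0.
have [k [/andP[k0 k1] ke]] := small_threshold b1 e2.
exists (2 / k); first by rewrite divr_ge0// ltW.
move=> c x y cb; have c1 : `|c| <= 1 by rewrite (le_trans cb)// ltW.
have W0 z : 0 <= wt z ^+ 2 by rewrite exprn_ge0// wt_ge0.
have P0 : 0 <= 2 / k * `|x - y| * (wt x * wt y) ^+ 2.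
  by nneg; exact: wt_ge0.
wlog xy : x y P0 / `|x| <= `|y| => [hw|].
  have [|/ltW yx] := leP `|x| `|y|; first exact: hw.
  by rewrite distrC (distrC x) (mulrC (wt x)); apply: hw;
    rewrite // (distrC y) (mulrC (wt y)).
have small z : `|z| <= k -> `|shrink c z| <= eta / 2.
  move=> zk; rewrite (le_trans (norm_shrink_le _ _))//.
  apply: le_trans ke; apply: (@powR_small b c); rewrite ?k0//; first lra.
  by move: cb; rewrite ler_norml => /andP[? ?]; lra.
have [yk|ky] := leP `|y| k.
  rewrite (le_trans (ler_normB _ _))// (le_trans (lerD (small _ _) (small _ yk)))//.
    exact: le_trans xy yk.
  by rewrite -splitr lerDl.
wlog y0 : x y xy ky P0 / 0 < y => [hw|].
  have [|yle0] := ltP 0 y; first exact: hw.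
  have := hw (- x) (- y); rewrite !shrinkN !normrN /wt !normrN -!opprD !normrN.
  apply => //; rewrite oppr_gt0 lt_neqAle yle0 andbT.
  by apply/eqP => y0; move: ky; rewrite y0 normr0; lra.
rewrite (gtr0_norm y0) in xy ky.
rewrite (le_trans (shrink_diff_large c1 y0 xy))//.
have yw : y `^ (1 - c) <= wt y ^+ 2.
  rewrite -[X in X `^ _](gtr0_norm y0); apply: powR_le_wt.
  by move: c1; rewrite ler_norml => /andP[? ?]; apply/andP; split; lra.
have d0 : 0 <= (y - x) / y.
  by rewrite divr_ge0 ?(ltW y0)// subr_ge0 (le_trans (ler_norm _) xy).
have dk : (y - x) / y <= `|x - y| / k.
  rewrite distrC; apply: ler_pM; rewrite ?invr_ge0 ?(ltW y0)// ?ler_norm//.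
    by rewrite subr_ge0 (le_trans (ler_norm _) xy).
  by rewrite lef_pV2 ?posrE// ltW.
have Y0 := powR_ge0 y (1 - c).
have -> : 2 / k * `|x - y| * (wt x * wt y) ^+ 2 =
    2 * (wt x ^+ 2 * (wt y ^+ 2 * (`|x - y| / k))) by ring.
rewrite -mulrA; apply: ler_wpDl; first exact: ltW.
rewrite ler_pM2l// (le_trans (ler_pM Y0 d0 yw dk))//.
by rewrite ler_peMl ?wtX_ge1//; nneg.
Qed.

(** In the exponent the Lipschitz constant involves [ln |x|], which explodes at 0: below the
    threshold smallness replaces it, above the threshold [ln_le_wt] bounds it. *)
Lemma shrink_modc b eta : 0 <= b < 1 -> 0 < eta ->
  exists2 M : R, 0 <= M & forall c c' x, `|c| <= b -> `|c'| <= b ->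
    `|shrink c x - shrink c' x| <= eta + M * `|c - c'| * wt x ^+ 3.
Proof.
move=> /andP[b0 b1] e0.
have e2 : 0 < eta / 2 by rewrite divr_gt0.
have [k [/andP[k0 k1] ke]] := small_threshold b1 e2.
have lk : ln k <= 0 by exact: ln_le0.
exists (2 * (1 - ln k)); first by rewrite mulr_ge0//; lra.
move=> c c' x cb cb'.
have W0 n : 0 <= wt x ^+ n by rewrite exprn_ge0// wt_ge0.
have [xk|kx] := leP `|x| k.
  have small d : `|d| <= b -> `|shrink d x| <= eta / 2.
    move=> db; rewrite (le_trans (norm_shrink_le _ _))//.
    apply: le_trans ke; apply: (@powR_small b d); rewrite ?k0//; first lra.
    by move: db; rewrite ler_norml => /andP[? ?]; lra.
  rewrite (le_trans (ler_normB _ _))// (le_trans (lerD (small _ cb) (small _ cb')))//.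
  by rewrite -splitr lerDl; nneg.
have x0 : 0 < `|x| by exact: lt_trans kx.
have kk : 0 < k <= 1 by rewrite k0.
have lx := ln_le_wt kk (ltW kx).
have pw d : `|d| <= b -> `|x| `^ (1 - d) <= wt x ^+ 2.
  rewrite ler_norml => /andP[? ?]; apply: powR_le_wt.
  by apply/andP; split; lra.
have sgx : `|Num.sg x| = 1 by rewrite normr_sg -normr_gt0 x0.
rewrite /shrink -mulrBr normrM sgx mul1r.
apply: ler_wpDl; first exact: ltW.
rewrite (le_trans (powRB_le _ _ x0))//.
have -> : 1 - c - (1 - c') = - (c - c') by ring.
rewrite normrN.
have -> : 2 * (1 - ln k) * `|c - c'| * wt x ^+ 3 =
  `|c - c'| * ((1 - ln k) * wt x) * (wt x ^+ 2 + wt x ^+ 2) by ring.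
apply: ler_pM; rewrite ?mulr_ge0 ?addr_ge0 ?powR_ge0//.
  by rewrite ler_wpM2l.
by rewrite lerD ?pw.
Qed.

(** Twice the nonnegative quantity [(eta y / 2 - x)^2 / eta]. The unbounded weight goes into [y],
    with a small coefficient, and the difference into [x]. *)
Lemma amgm_eta eta x y : 0 < eta ->
  2 * x * y <= eta / 2 * y ^+ 2 + 2 / eta * x ^+ 2.
Proof.
move=> e0; have i0 : 0 < eta^-1 by rewrite invr_gt0.
have := mulr_ge0 (ltW i0) (sqr_ge0 (eta * y / 2 - x)).
have -> : eta^-1 * (eta * y / 2 - x) ^+ 2 =
   (eta^-1 * eta) * (eta / 4 * y ^+ 2 - y * x) + eta^-1 * x ^+ 2.
  by field; rewrite gt_eqF.
rewrite mulVf ?gt_eqF// mul1r.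
have -> : 2 / eta * x ^+ 2 = 2 * (eta^-1 * x ^+ 2) by ring.
by lra.
Qed.

(** Arithmetic behind the choice [e1 = eta / (16 (1 + B)^2)] in the two moduli below: with [t]
    bounded by [B], the accumulated small terms fit into [eta], or into the half of it that AM-GM
    leaves. *)
Let const_half B e1 : 0 <= B -> 0 < e1 ->
  4 * B * (1 + B) * e1 <= e1 * (16 * (1 + B) ^+ 2) / 2.
Proof.
move=> B0 e0; rewrite -subr_ge0.
have -> : e1 * (16 * (1 + B) ^+ 2) / 2 - 4 * B * (1 + B) * e1 = 4 * e1 * (1 + B) * (2 + B) by field.
by nneg.
Qed.

Let const_half' B e1 : 0 <= B -> 0 < e1 ->
  2 * B ^+ 2 * e1 <= e1 * (16 * (1 + B) ^+ 2) / 2.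
Proof.
move=> B0 e0; rewrite -subr_ge0.
have -> : e1 * (16 * (1 + B) ^+ 2) / 2 - 2 * B ^+ 2 * e1 =
  e1 * (8 + 16 * B + 6 * B ^+ 2) by field.
by nneg.
Qed.

Let const_full B e1 : 0 <= B -> 0 < e1 ->
  4 * (2 + B) * (1 + B) * e1 + 4 * B * e1 <= e1 * (16 * (1 + B) ^+ 2).
Proof.
move=> B0 e0; rewrite -subr_ge0.
have -> : e1 * (16 * (1 + B) ^+ 2) - (4 * (2 + B) * (1 + B) * e1 + 4 * B * e1) =
  e1 * (8 + 16 * B + 12 * B ^+ 2) by ring.
by nneg.
Qed.

Let sqr_add2 x y : (x + y) ^+ 2 <= 2 * (x ^+ 2 + y ^+ 2).
Proof. by have := sqr_ge0 (x - y); rewrite sqrrB sqrrD; lra. Qed.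

Let sqr_add3 x y z : (x + y + z) ^+ 2 <= 3 * (x ^+ 2 + y ^+ 2 + z ^+ 2).
Proof.
have := sqr_ge0 (x - y); have := sqr_ge0 (x - z); have := sqr_ge0 (y - z).
by rewrite !sqrrB !sqrrD !mulrDl; lra.
Qed.

(** The mean cancels: the estimator at the observation [u + e], minus [u], is
    [e - t * shrink c (u + e)]. *)
Definition loss u e t c : R := (e - t * shrink c (u + e)) ^+ 2.

(* The weighted products of differences are split by AM-GM, so that small
   squared differences suffice. *)
Lemma loss_mod b B eta : 0 <= b < 1 -> 0 <= B -> 0 < eta ->
  exists2 M : R, 0 <= M & forall u u' e t t' c c',
    `|t| <= B -> `|t'| <= B -> `|c| <= b -> `|c'| <= b ->
    `|loss u e t c - loss u' e t' c'| <=
      eta * (wt u * wt u' * wt e) ^+ 12 +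
      M * ((t - t') ^+ 2 + (c - c') ^+ 2 + (u - u') ^+ 2).
Proof.
move=> hb B0 e0; have /andP[b0 b1] := hb.
pose e1 := eta / (16 * (1 + B) ^+ 2).
have B1 : 1 <= 1 + B by rewrite lerDl.
have B2 : 0 < 16 * (1 + B) ^+ 2 by rewrite mulr_gt0// exprn_gt0//; lra.
have e10 : 0 < e1 by rewrite divr_gt0.
have e1E : e1 * (16 * (1 + B) ^+ 2) = eta by rewrite /e1 divfK// gt_eqF.
have [M1 M10 hM1] := shrink_modx hb e10.
have [M2 M20 hM2] := shrink_modc hb e10.
pose K := 1 + B * M1 + B * M2.
have K0 : 0 <= K by rewrite /K; have := mulr_ge0 B0 M10; have := mulr_ge0 B0 M20; lra.
pose H := (1 + B) * K.
have H0 : 0 <= H by rewrite mulr_ge0//; lra.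
exists (6 * H ^+ 2 / eta); first by nneg.
move=> u u' e t t' c c' tB tB' cb cb'.
(* A single weight that dominates [wt (u + e)], [wt (u' + e)] and [|e|]. *)
set W := wt u * wt u' * wt e.
have W1 : 1 <= W by rewrite -[leLHS]mul1r -[X in X * _]mul1r !ler_pM ?wt_ge1.
have Wge x : 1 <= wt x -> 0 <= wt x by move=> *; exact: wt_ge0.
have wu : wt (u + e) <= W.
  rewrite (le_trans (wtD _ _))// /W ler_wpM2r ?wt_ge0// ler_peMr ?wt_ge0 ?wt_ge1//.
have wu' : wt (u' + e) <= W.
  rewrite (le_trans (wtD _ _))// /W ler_wpM2r ?wt_ge0// ler_peMl ?wt_ge0 ?wt_ge1//.
have we : `|e| <= W.
  rewrite (le_trans (norm_le_wt _))// /W ler_peMl ?wt_ge0//.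
  by rewrite -[leLHS]mul1r ler_pM ?wt_ge1.
have W0 : 0 <= W by lra.
have WX m n : (m <= n)%N -> W ^+ m <= W ^+ n by exact: ler_weXn2l.
have WX0 n : 0 <= W ^+ n by rewrite exprn_ge0.
set g := shrink c (u + e); set g' := shrink c' (u' + e).
have c1 : `|c| <= 1 by rewrite (le_trans cb)// ltW.
have c1' : `|c'| <= 1 by rewrite (le_trans cb')// ltW.
have gW : `|g| <= W ^+ 2.
  by rewrite (le_trans (norm_shrink_wt _ c1))// lerXn2r ?nnegrE ?wt_ge0.
have gW' : `|g'| <= W ^+ 2.
  by rewrite (le_trans (norm_shrink_wt _ c1'))// lerXn2r ?nnegrE ?wt_ge0.
set dt : R := `|t - t'|; set dc : R := `|c - c'|; set du : R := `|u - u'|.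
have dg : `|g - g'| <= 2 * e1 + M1 * du * W ^+ 4 + M2 * dc * W ^+ 4.
  have -> : g - g' = (g - shrink c (u' + e)) + (shrink c (u' + e) - g') by ring.
  rewrite (le_trans (ler_normD _ _))//.
  have := hM1 c (u + e) (u' + e) cb.
  have -> : u + e - (u' + e) = u - u' by ring.
  rewrite -/du -/g => h1; have := hM2 c c' (u' + e) cb cb'; rewrite -/dc -/g' => h2.
  have h3 : M1 * du * (wt (u + e) * wt (u' + e)) ^+ 2 <= M1 * du * W ^+ 4.
    have -> : W ^+ 4 = (W * W) ^+ 2 by ring.
    apply: ler_wpM2l; first by nneg.
    by rewrite lerXn2r ?nnegrE ?mulr_ge0 ?wt_ge0// ler_pM ?wt_ge0.
  have h4 : M2 * dc * wt (u' + e) ^+ 3 <= M2 * dc * W ^+ 4.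
    apply: ler_wpM2l; first by nneg.
    rewrite (le_trans _ (WX 3 4 _))//.
    by rewrite lerXn2r ?nnegrE ?mulr_ge0 ?wt_ge0.
  lra.
have dD : `|t * g - t' * g'| <= 2 * B * e1 + K * (dt + dc + du) * W ^+ 4.
  have -> : t * g - t' * g' = (t - t') * g + t' * (g - g') by ring.
  rewrite (le_trans (ler_normD _ _))// (normrM (t - t')) (normrM t') -/dt.
  have h1 : dt * `|g| <= dt * W ^+ 4.
    by apply: ler_wpM2l; [nneg|rewrite (le_trans gW)// WX].
  have h2 : `|t'| * `|g - g'| <= B * (2 * e1 + M1 * du * W ^+ 4 + M2 * dc * W ^+ 4).
    by rewrite ler_pM.
  have h3 : 0 <= B * M1 * (dt + dc) * W ^+ 4 by nneg.
  have h4 : 0 <= B * M2 * (dt + du) * W ^+ 4 by nneg.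
  have h5 : 0 <= (du + dc) * W ^+ 4 by nneg.
  by rewrite /K; clear -h1 h2 h3 h4 h5; lra.
have dS : `|e - t * g + (e - t' * g')| <= 2 * (1 + B) * W ^+ 2.
  have W12 := WX 1 2 isT; rewrite expr1 in W12.
  have h1 : `|t * g| <= B * W ^+ 2 by rewrite normrM ler_pM.
  have h2 : `|t' * g'| <= B * W ^+ 2 by rewrite normrM ler_pM.
  apply: (le_trans (ler_normD _ _)).
  have h3 := ler_normB e (t * g); have h4 := ler_normB e (t' * g').
  by clear -we W12 h1 h2 h3 h4; lra.
have -> : loss u e t c - loss u' e t' c' =
    (e - t * g + (e - t' * g')) * - (t * g - t' * g') by rewrite /loss -/g -/g'; ring.
rewrite normrM normrN (le_trans (ler_pM (normr_ge0 _) (normr_ge0 _) dS dD))//.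
set D := dt + dc + du.
have D0 : 0 <= D by rewrite /D /dt /dc /du; nneg.
have -> : 2 * (1 + B) * W ^+ 2 * (2 * B * e1 + K * D * W ^+ 4) =
   4 * B * (1 + B) * e1 * W ^+ 2 + 2 * (H * D) * W ^+ 6 by rewrite /H; ring.
have DS : D ^+ 2 <= 3 * ((t - t') ^+ 2 + (c - c') ^+ 2 + (u - u') ^+ 2).
  rewrite -(real_normK (num_real (t - t'))) -(real_normK (num_real (c - c'))).
  rewrite -(real_normK (num_real (u - u'))).
  exact: sqr_add3.
(* The sum of the two residuals costs [W ^+ 2] and their difference [W ^+ 4]; AM-GM squares the
   product, whence the exponent 12. *)
have am : 2 * (H * D) * W ^+ 6 <= eta / 2 * W ^+ 12 + 2 / eta * (H * D) ^+ 2.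
  have -> : W ^+ 12 = (W ^+ 6) ^+ 2 by ring.
  exact: amgm_eta.
have f1 : 4 * B * (1 + B) * e1 * W ^+ 2 <= eta / 2 * W ^+ 12.
  apply: (@le_trans _ _ (eta / 2 * W ^+ 2)).
    by rewrite ler_wpM2r// -e1E; exact: const_half.
  by rewrite ler_wpM2l ?WX// divr_ge0// ltW.
have f2 : 2 / eta * (H * D) ^+ 2 <= 6 * H ^+ 2 / eta *
    ((t - t') ^+ 2 + (c - c') ^+ 2 + (u - u') ^+ 2).
  have -> : 2 / eta * (H * D) ^+ 2 = 2 * H ^+ 2 / eta * D ^+ 2 by field; rewrite gt_eqF.
  have -> (z : R) : 6 * H ^+ 2 / eta * z = 2 * H ^+ 2 / eta * (3 * z) by field; rewrite gt_eqF.
  by rewrite ler_wpM2l//; nneg.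
by clear -am f1 f2; lra.
Qed.

(* A power of [1/|x|] dominating all [|x|^(-c)], [|c| <= b], but still
   integrable at 0. *)
Definition sing b x : R := `|x| `^ (- ((1 + b) / 2)).

Lemma sing_ge0 b x : 0 <= sing b x.
Proof. exact: powR_ge0. Qed.

(** Since [- b = (1 - (1 + b) / 2) - (1 + b) / 2], the power [|x|^(-b)] is [sing b x] times a
    positive power of [|x|], small below the threshold. *)
Lemma negpow_small b k eta c x : 0 <= b < 1 -> 0 < k <= 1 ->
  k `^ (1 - (1 + b) / 2) <= eta -> `|c| <= b -> x != 0 -> `|x| <= k ->
  `|x| `^ (- c) <= eta * sing b x.
Proof.
move=> /andP[b0 b1] /andP[k0 k1] ke cb x0 xk.
have x1 : 0 < `|x| <= 1 by rewrite normr_gt0 x0 (le_trans xk).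
move: cb; rewrite ler_norml => /andP[c1 c2].
apply: (@le_trans _ _ (`|x| `^ (- b))); first by apply: ger_powR => //; lra.
have -> : - b = (1 - (1 + b) / 2) + - ((1 + b) / 2) by field.
rewrite powRD; last by rewrite normr_eq0 x0 implybT.
rewrite ler_wpM2r ?powR_ge0// (le_trans _ ke)//.
by apply: (@powR_small b c); rewrite ?k0//; lra.
Qed.

Lemma negpow_large b k c x : 0 <= b < 1 -> 0 < k <= 1 -> `|c| <= b -> k < `|x| ->
  `|x| `^ (- c) <= (k^-1 + 1) * wt x.
Proof.
move=> /andP[b0 b1] /andP[k0 k1] cb kx.
have x0 : 0 < `|x| by exact: lt_trans kx.
have ki : 0 < k^-1 by rewrite invr_gt0.
have w1 := wt_ge1 x; have wx := norm_le_wt x.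
move: cb; rewrite ler_norml => /andP[c1 c2].
have [x1|x1] := leP `|x| 1.
  apply: (@le_trans _ _ (`|x| `^ (- 1))).
    by apply: ger_powR; [rewrite x0|lra].
  rewrite powR_inv1 ?(ltW x0)//.
  have : `|x|^-1 <= k^-1 by rewrite lef_pV2 ?posrE// ltW.
  by nra.
apply: (@le_trans _ _ (`|x| `^ 1)); first by apply: ler_powR; lra.
by rewrite powRr1 ?(ltW x0)//; nra.
Qed.

(** The coefficient of the singular part can be made as small as desired, at the price of a large
    [M], because [(1 + b) / 2] strictly exceeds every admissible [c]. *)
Lemma negpow_bound b eta : 0 <= b < 1 -> 0 < eta ->
  exists2 M : R, 0 <= M & forall c x, `|c| <= b -> x != 0 ->
    `|x| `^ (- c) <= M * wt x + eta * sing b x.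
Proof.
move=> hb e0; have /andP[b0 b1] := hb.
have b2 : (1 + b) / 2 < 1 by rewrite ltr_pdivrMr//; lra.
have [k [hk ke]] := small_threshold b2 e0; have /andP[k0 k1] := hk.
exists (k^-1 + 1); first by nneg.
move=> c x cb x0; have [xk|kx] := leP `|x| k.
  apply: (le_trans (negpow_small hb hk ke cb x0 xk)).
  by rewrite lerDr; nneg; exact: wt_ge0.
apply: (le_trans (negpow_large hb hk cb kx)).
by rewrite lerDl; nneg; exact: wt_ge0.
Qed.

(** Near 0 both powers are small multiples of [sing], and so is their difference; away from 0 the
    power is Lipschitz in its exponent. *)
Lemma negpow_modc b eta : 0 <= b < 1 -> 0 < eta ->
  exists2 M : R, 0 <= M & forall c c' x, `|c| <= b -> `|c'| <= b -> x != 0 ->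
    `| `|x| `^ (- c) - `|x| `^ (- c')| <=
      eta * sing b x + M * `|c - c'| * wt x ^+ 2.
Proof.
move=> hb e0; have /andP[b0 b1] := hb.
have b2 : (1 + b) / 2 < 1 by rewrite ltr_pdivrMr//; lra.
have [k [hk ke]] := small_threshold b2 e0; have /andP[k0 k1] := hk.
have lk : ln k <= 0 by exact: ln_le0.
exists ((1 - ln k) * (2 * (k^-1 + 1))); first by nneg.
move=> c c' x cb cb' x0.
have W0 := wt_ge0 x.
have [xk|kx] := leP `|x| k.
  have h1 := negpow_small hb hk ke cb x0 xk.
  have h2 := negpow_small hb hk ke cb' x0 xk.
  have p1 := powR_ge0 `|x| (- c); have p2 := powR_ge0 `|x| (- c').
  apply: ler_wpDr; first by nneg.
  by rewrite ler_norml; apply/andP; split; lra.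
have xp : 0 < `|x| by exact: lt_trans kx.
apply: ler_wpDl; first by nneg; exact: sing_ge0.
rewrite (le_trans (powRB_le _ _ xp))//.
have -> : - c - - c' = - (c - c') by ring.
rewrite normrN.
have -> : (1 - ln k) * (2 * (k^-1 + 1)) * `|c - c'| * wt x ^+ 2 =
  `|c - c'| * ((1 - ln k) * wt x) * ((k^-1 + 1) * wt x + (k^-1 + 1) * wt x) by ring.
apply: ler_pM; [by nneg|by nneg| |].
  by rewrite ler_wpM2l// ln_le_wt// ltW.
by rewrite lerD// (negpow_large hb hk).
Qed.

(* Stein's unbiased estimate: the integrand of [Rhat], up to sign, for
   constant [t] and [c]. *)
Definition sure x t c : R :=
  (`|x| `^ c)^-1 * (2 * t * (1 - c) - t ^+ 2 * `|x| `^ (2 - c)).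

(** The form to which Stein's identity applies: away from 0, [(1 - c) |x|^(-c)] is the derivative of
    [shrink c]. *)
Lemma sureE x t c : x != 0 ->
  sure x t c = 2 * (t * (1 - c)) * `|x| `^ (- c) - (t * shrink c x) ^+ 2.
Proof. by move=> x0; rewrite /sure exprMn shrinkX2// powRN; ring. Qed.

(** The point 0 is excluded because [|x|^(-c)] jumps there, from 1 at [c = 0] to 0 at other [c]. It
    is a null set for every Gaussian law. *)
Lemma sure_mod b B eta : 0 <= b < 1 -> 0 <= B -> 0 < eta ->
  exists2 M : R, 0 <= M & forall x t t' c c', x != 0 ->
    `|t| <= B -> `|t'| <= B -> `|c| <= b -> `|c'| <= b ->
    `|sure x t c - sure x t' c'| <=
      eta * (sing b x + wt x ^+ 10) + M * ((t - t') ^+ 2 + (c - c') ^+ 2).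
Proof.
move=> hb B0 e0; have /andP[b0 b1] := hb.
pose e1 := eta / (16 * (1 + B) ^+ 2).
have B1 : 1 <= 1 + B by rewrite lerDl.
have B2 : 0 < 16 * (1 + B) ^+ 2 by rewrite mulr_gt0// exprn_gt0//; lra.
have e10 : 0 < e1 by rewrite divr_gt0.
have e1E : e1 * (16 * (1 + B) ^+ 2) = eta by rewrite /e1 divfK// gt_eqF.
have [M1 M10 hM1] := negpow_bound hb e10.
have [M2 M20 hM2] := negpow_modc hb e10.
have [M3 M30 hM3] := shrink_modc hb e10.
pose H := (2 + B) * M1 + 2 * B * M2 + B * (1 + B * M3).
have H0 : 0 <= H by rewrite /H; nneg.
exists (4 * H ^+ 2 / eta); first by nneg.
move=> x t t' c c' x0 tB tB' cb cb'.
have W1 := wt_ge1 x; have W0 := wt_ge0 x; have S0 := sing_ge0 b x.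
set W := wt x in W1 W0 *; set S := sing b x in S0 *.
have WX m n : (m <= n)%N -> W ^+ m <= W ^+ n by exact: ler_weXn2l.
have WX0 n : 0 <= W ^+ n by rewrite exprn_ge0.
set dt : R := `|t - t'|; set dc : R := `|c - c'|.
have dt0 : 0 <= dt by exact: normr_ge0.
have dc0 : 0 <= dc by exact: normr_ge0.
pose D := dt + dc.
have c1 : `|c| <= 1 by rewrite (le_trans cb)// ltW.
have c1' : `|c'| <= 1 by rewrite (le_trans cb')// ltW.
have t1 : `|t * (1 - c) - t' * (1 - c')| <= (2 + B) * D.
  have -> : t * (1 - c) - t' * (1 - c') = (t - t') * (1 - c) - t' * (c - c') by ring.
  rewrite (le_trans (ler_normB _ _))// !normrM -/dt -/dc.
  have h1 : dt * `|1 - c| <= dt * 2.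
    by rewrite ler_wpM2l// (le_trans (ler_normB _ _))// normr1 lerD2l.
  have h2 : `|t'| * dc <= B * dc by rewrite ler_wpM2r.
  have h3 : 0 <= B * dt by exact: mulr_ge0.
  by rewrite /D; clear -h1 h2 h3 dc0; lra.
(* The product of [sing] and [D] cannot be split by AM-GM: the square of [sing] is [|x|^(-(1 + b))],
   which is not integrable at 0. This crude bound on [D] absorbs the product into the small multiple
   of [sing]. *)
have DB : D <= 2 * (1 + B).
  have h1 : dt <= B + B by rewrite (le_trans (ler_normB _ _))// lerD.
  have h2 : dc <= 1 + 1 by rewrite (le_trans (ler_normB _ _))// lerD.
  by rewrite /D; clear -h1 h2; lra.
have D0 : 0 <= D by rewrite addr_ge0.
rewrite !sureE//; set p := `|x| `^ (- c); set p' := `|x| `^ (- c').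
have p0 : 0 <= p by exact: powR_ge0.
have hp : p <= M1 * W + e1 * S by exact: hM1.
have hpp : `|p - p'| <= e1 * S + M2 * D * W ^+ 2.
  apply: (le_trans (hM2 _ _ _ cb cb' x0)); rewrite lerD2l ler_wpM2r// ler_wpM2l//.
  by rewrite /D lerDr.
set g := shrink c x; set g' := shrink c' x.
have gW : `|g| <= W ^+ 2 by exact: norm_shrink_wt.
have gW' : `|g'| <= W ^+ 2 by exact: norm_shrink_wt.
have hg : `|g - g'| <= e1 + M3 * D * W ^+ 3.
  apply: (le_trans (hM3 _ _ _ cb cb')); rewrite lerD2l ler_wpM2r// ler_wpM2l//.
  by rewrite /D lerDr.
have -> : 2 * (t * (1 - c)) * p - (t * g) ^+ 2 -
    (2 * (t' * (1 - c')) * p' - (t' * g') ^+ 2) =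
    2 * (t * (1 - c) - t' * (1 - c')) * p + 2 * (t' * (1 - c')) * (p - p')
    - (t * g - t' * g') * (t * g + t' * g') by ring.
have T1 : `|2 * (t * (1 - c) - t' * (1 - c')) * p| <=
    2 * ((2 + B) * M1 * D * W) + 4 * (2 + B) * (1 + B) * e1 * S.
  rewrite !normrM (ger0_norm p0) (ger0_norm (ler0n _ 2)) -mulrA.
  apply: (@le_trans _ _ (2 * ((2 + B) * D * (M1 * W + e1 * S)))).
    by rewrite ler_wpM2l// ler_pM.
  have h : (2 + B) * e1 * S * D <= (2 + B) * e1 * S * (2 * (1 + B)).
    by rewrite ler_wpM2l//; nneg.
  by clear -h; lra.
have T2 : `|2 * (t' * (1 - c')) * (p - p')| <= 4 * B * e1 * S + 4 * B * M2 * D * W ^+ 2.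
  rewrite normrM normrM (ger0_norm (ler0n _ 2)) normrM.
  have h1 : `|1 - c'| <= 2 by rewrite (le_trans (ler_normB _ _))// normr1 lerD2l.
  have h2 : `|t'| * `|1 - c'| <= B * 2 by rewrite ler_pM.
  apply: (@le_trans _ _ (2 * (B * 2) * (e1 * S + M2 * D * W ^+ 2))).
    by apply: ler_pM => //; rewrite ler_wpM2l.
  rewrite le_eqVlt; apply/orP; left; apply/eqP; ring.
have T3 : `|(t * g - t' * g') * (t * g + t' * g')| <=
    2 * B ^+ 2 * e1 * W ^+ 2 + 2 * B * (1 + B * M3) * D * W ^+ 5.
  rewrite normrM.
  have h1 : `|t * g - t' * g'| <= D * W ^+ 2 + B * (e1 + M3 * D * W ^+ 3).
    have -> : t * g - t' * g' = (t - t') * g + t' * (g - g') by ring.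
    rewrite (le_trans (ler_normD _ _))// (normrM (t - t')) (normrM t').
    by rewrite lerD// ler_pM// /D lerDl.
  have h2 : `|t * g + t' * g'| <= 2 * B * W ^+ 2.
    rewrite (le_trans (ler_normD _ _))// (normrM t) (normrM t').
    have a1 : `|t| * `|g| <= B * W ^+ 2 by rewrite ler_pM.
    have a2 : `|t'| * `|g'| <= B * W ^+ 2 by rewrite ler_pM.
    by clear -a1 a2; lra.
  apply: (le_trans (ler_pM (normr_ge0 _) (normr_ge0 _) h1 h2)).
  have h3 : D * W ^+ 2 <= D * W ^+ 3 by rewrite ler_wpM2l// WX.
  have : (D * W ^+ 2 + B * (e1 + M3 * D * W ^+ 3)) * (2 * B * W ^+ 2) <=
     (D * W ^+ 3 + B * (e1 + M3 * D * W ^+ 3)) * (2 * B * W ^+ 2).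
    by rewrite ler_wpM2r ?lerD2r//; nneg.
  move=> /le_trans; apply; rewrite le_eqVlt; apply/orP; left; apply/eqP; ring.
have := ler_normB (2 * (t * (1 - c) - t' * (1 - c')) * p + 2 * (t' * (1 - c')) * (p - p'))
  ((t * g - t' * g') * (t * g + t' * g')).
move=> /le_trans; apply.
have := ler_normD (2 * (t * (1 - c) - t' * (1 - c')) * p) (2 * (t' * (1 - c')) * (p - p')).
(* The heaviest term has weight [W ^+ 5], namely [W ^+ 3] from [shrink_modc] times [W ^+ 2]; AM-GM
   doubles the exponent. *)
have am : 2 * (H * D) * W ^+ 5 <= eta / 2 * W ^+ 10 + 2 / eta * (H * D) ^+ 2.
  have -> : W ^+ 10 = (W ^+ 5) ^+ 2 by ring.
  exact: amgm_eta.
have DS : D ^+ 2 <= 2 * ((t - t') ^+ 2 + (c - c') ^+ 2).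
  rewrite -(real_normK (num_real (t - t'))) -(real_normK (num_real (c - c'))).
  exact: sqr_add2.
have f2 : 2 / eta * (H * D) ^+ 2 <= 4 * H ^+ 2 / eta * ((t - t') ^+ 2 + (c - c') ^+ 2).
  have -> : 2 / eta * (H * D) ^+ 2 = 2 * H ^+ 2 / eta * D ^+ 2 by field; rewrite gt_eqF.
  have -> (z : R) : 4 * H ^+ 2 / eta * z = 2 * H ^+ 2 / eta * (2 * z) by field; rewrite gt_eqF.
  by rewrite ler_wpM2l//; nneg.
have a1 : 2 * ((2 + B) * M1 * D * W) <= 2 * ((2 + B) * M1 * D * W ^+ 5).
  by do 2!(apply: ler_wpM2l; first by nneg); rewrite -{1}(expr1 W) WX.
have a2 : 4 * B * M2 * D * W ^+ 2 <= 4 * B * M2 * D * W ^+ 5.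
  by apply: ler_wpM2l; [nneg|rewrite WX].
have a3 : 2 * B ^+ 2 * e1 * W ^+ 2 <= eta / 2 * W ^+ 10.
  apply: (@le_trans _ _ (eta / 2 * W ^+ 2)).
    by rewrite ler_wpM2r// -e1E; exact: const_half'.
  by apply: ler_wpM2l; [nneg|rewrite WX].
have a4 : (4 * (2 + B) * (1 + B) * e1 + 4 * B * e1) * S <= eta * S.
  by rewrite ler_wpM2r// -e1E; exact: const_full.
have HE : 2 * (H * D) * W ^+ 5 = 2 * ((2 + B) * M1 * D * W ^+ 5) +
   4 * B * M2 * D * W ^+ 5 + 2 * B * (1 + B * M3) * D * W ^+ 5 by rewrite /H; ring.
clear -T1 T2 T3 am f2 a1 a2 a3 a4 HE; lra.
Qed.

End pointwise.

(** * Gaussian integrals and Stein's identity *)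

Section integration.
Context d (T : measurableType d) (R : realType).
Local Open Scope ereal_scope.

(** Both [g] and the Radon-Nikodym derivative integrate to [nu A] over every measurable [A], so they
    agree almost everywhere, and the change of variables passes from the derivative to [g]. *)
Lemma ge0_integral_density (nu : {finite_measure set T -> \bar R})
    (mu : {sigma_finite_measure set T -> \bar R}) (g : T -> \bar R)
    (f : T -> \bar R) :
  nu `<< mu -> measurable_fun setT g -> (forall x, 0 <= g x) ->
  (forall A, measurable A -> nu A = \int[mu]_(x in A) g x) ->
  measurable_fun setT f -> (forall x, 0 <= f x) ->
  \int[nu]_x f x = \int[mu]_x (f x * g x).
Proof.
move=> numu mg g0 nuE mf f0.
rewrite -(Radon_Nikodym_SigmaFinite.change_of_variables numu)//.
have mRN := Radon_Nikodym_SigmaFinite.f_integrable numu.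
have mRN' := measurable_int _ mRN.
apply: ae_eq_integral => //; [exact: emeasurable_funM|exact: emeasurable_funM|].
apply: ae_eqe_mul2l; apply: integral_ae_eq => // E _ mE.
by rewrite -nuE// -Radon_Nikodym_SigmaFinite.f_integral.
Qed.

Lemma integrable_le (mu : {measure set T -> \bar R}) (f g : T -> R) :
  measurable_fun setT f -> (forall x, `|f x| <= g x)%R ->
  mu.-integrable setT (EFin \o g) -> mu.-integrable setT (EFin \o f).
Proof.
move=> mf fg; apply: le_integrable => //; first exact/measurable_EFinP.
by move=> x _ /=; rewrite lee_fin (le_trans (fg x))// ler_norm.
Qed.

Lemma measurable_boolR (b : T -> bool) : measurable_fun setT b ->
  measurable_fun setT (fun x => (b x)%:R : R).
Proof.
move=> mb; rewrite (_ : (fun _ => _) = fun x => if b x then 1%R else 0%R : R).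
  exact: measurable_fun_ifT.
by apply/funext => x; case: (b x).
Qed.

End integration.

Section gauss1.
Variable R : realType.
Notation mu := (@lebesgue_measure R).
Implicit Types (x y u e t c b B eta : R).

Definition N01 : probability (measurableTypeR R) R := normal_prob 0 1.

Lemma N01E A : N01 A = normal_prob 0 1 A.
Proof. by []. Qed.

Lemma phiE x : phi x = normal_peak 1 * expR (- (x ^+ 2 / 2)).
Proof.
rewrite /phi normal_pdfE ?oner_eq0// /normal_fun subr0 expr1n mulNr.
by [].
Qed.

Lemma phi_gt0 x : 0 < phi x.
Proof. by rewrite phiE mulr_gt0 ?expR_gt0// normal_peak_gt0// oner_eq0. Qed.

Lemma phi_ge0 x : 0 <= phi x.
Proof. exact/ltW/phi_gt0. Qed.

Lemma measurable_phi : measurable_fun setT (@phi R).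
Proof. exact: measurable_normal_pdf. Qed.

Lemma phiN x : phi (- x) = phi x.
Proof. by rewrite !phiE sqrrN. Qed.

Lemma integral_phi : (\int[mu]_x (phi x)%:E = 1)%E.
Proof. exact: integral_normal_pdf. Qed.

Lemma ge0_integral_N01 (f : R -> \bar R) :
  measurable_fun setT f -> (forall x, 0 <= f x)%E ->
  (\int[N01]_x f x = \int[mu]_x (f x * (phi x)%:E))%E.
Proof.
move=> mf f0; apply: ge0_integral_density => //.
- exact: normal_prob_dominates.
- by apply/measurable_EFinP; exact: measurable_phi.
- by move=> x; rewrite lee_fin phi_ge0.
Qed.

(** The shifted measure agrees with Lebesgue measure on half-open intervals, which determine it. *)
Lemma lebesgue_measureD (r : R) (A : set R) : measurable A ->
  pushforward mu (fun x => x + r : measurableTypeR R) A = mu A.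
Proof.
have mD : measurable_fun setT (fun x => x + r : measurableTypeR R).
  exact: measurable_funD.
pose nu := pushforward mu (fun x => x + r : measurableTypeR R).
move=> mA; apply/esym.
apply: (@lebesgue_measure_unique R nu) => // _ [[a b] _ <-] /=.
rewrite /nu.
rewrite /pushforward.
have -> : (fun x => x + r) @^-1` `]a, b]%classic = `]a - r, b - r]%classic.
  by apply/seteqP; split => x /=; rewrite !in_itv/= ltrBlDr lerBrDr.
rewrite !lebesgue_measure_itv/= !lte_fin ltrD2r.
by case: ifP => // _; rewrite -!EFinB; congr EFin; ring.
Qed.

Lemma ge0_integral_shift (r : R) (f : R -> \bar R) :
  measurable_fun setT f -> (forall x, 0 <= f x)%E ->
  (\int[mu]_x f (x + r)%R = \int[mu]_x f x)%E.
Proof.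
move=> mf f0.
have mD : measurable_fun setT (fun x => x + r : measurableTypeR R).
  exact: measurable_funD.
apply/esym; transitivity
    (\int[pushforward mu (fun x => (x + r)%R : measurableTypeR R)]_x f x)%E.
  by apply: eq_measure_integral => A mA _; apply/esym/lebesgue_measureD.
by rewrite ge0_integral_pushforward.
Qed.

Lemma N01_set1 x : N01 [set x] = 0%E.
Proof.
have /null_content_dominatesP := @normal_prob_dominates R 0 1.
by apply => //; exact: lebesgue_measure_set1.
Qed.

(** Exponentials have explicit Gaussian integrals, hence this comparison. The constant comes from
    one term of the exponential series at [1 + |x|]. *)
Lemma wtX_le_exp n : exists2 K : R, 0 <= K &
  forall x, wt x ^+ n <= K * (expR x + expR (- x)).
Proof.
exists (n.+1`!%:R * expR 1); first by rewrite mulr_ge0// expR_ge0.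
move=> x; apply: (@le_trans _ _ (wt x ^+ n.+1)); first exact: ler_wtX.
have h := expR_ge1Dxn n (wt_ge0 x).
have f0 : 0 < n.+1`!%:R :> R by rewrite ltr0n fact_gt0.
apply: (@le_trans _ _ (n.+1`!%:R * expR (wt x))).
  rewrite mulrC -ler_pdivrMr// (le_trans _ h)// lerDr//.
rewrite -mulrA ler_pM2l// /wt expRD ler_pM2l ?expR_gt0//.
have [x0|x0] := leP 0 x; first by rewrite ger0_norm// lerDl expR_ge0.
by rewrite ltr0_norm// lerDr expR_ge0.
Qed.

(** Completing the square: tilting the density by an exponential shifts it by [r]. *)
Lemma phi_expR r x : expR (r * x) * phi x = expR (r ^+ 2 / 2) * phi (x - r).
Proof.
rewrite !phiE mulrCA [RHS]mulrCA -!expRD; congr (_ * expR _).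
by field.
Qed.

Lemma integral_N01_expR r : (\int[N01]_x (expR (r * x))%:E = (expR (r ^+ 2 / 2))%:E)%E.
Proof.
have mp (s : R) : measurable_fun setT (fun x : R => (phi (x - s))%:E).
  apply/measurable_EFinP/measurableT_comp; first exact: measurable_phi.
  exact: measurable_funB.
rewrite ge0_integral_N01//.
  under eq_integral do rewrite -EFinM phi_expR EFinM.
  rewrite ge0_integralZl//; last 2 first.
    exact: mp.
    by move=> x _; rewrite lee_fin phi_ge0.
  rewrite (@ge0_integral_shift (- r) (fun x => (phi x)%:E)) ?integral_phi ?mule1//.
    by apply/measurable_EFinP; exact: measurable_phi.
  by move=> x; rewrite lee_fin phi_ge0.
by apply/measurable_EFinP/measurableT_comp => //; exact: measurable_funM.
Qed.

Lemma integrable_wtX n : N01.-integrable setT (EFin \o (fun x => wt x ^+ n)).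
Proof.
have [K K0 hK] := wtX_le_exp n.
have ie r : N01.-integrable setT (EFin \o (fun x => expR (r * x))).
  apply/integrableP; split.
    by apply/measurable_EFinP/measurableT_comp => //; exact: measurable_funM.
  under eq_integral do rewrite /= ger0_norm ?expR_ge0//.
  by rewrite integral_N01_expR ltry.
apply: (@integrable_le _ (measurableTypeR R) R N01 _
  (fun x : R => K * (expR (1 * x) + expR (-1 * x)))).
- by apply: measurable_funX; apply: measurable_funD => //; exact: measurableT_comp.
- move=> x; rewrite ger0_norm; last by rewrite exprn_ge0// wt_ge0.
  by rewrite mul1r mulN1r.
- rewrite (_ : _ \o _ = (fun x => K%:E * ((expR (1 * x))%:E + (expR (-1 * x))%:E))%E)//.
  by apply: integrableZl => //; apply: integrableD => //; exact: ie.
Qed.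

Definition gmom n : R := \int[N01]_x (wt x ^+ n).

Lemma gmomE n : (\int[N01]_x (wt x ^+ n)%:E = (gmom n)%:E)%E.
Proof. by rewrite fineK//; apply: integrable_fin_num (integrable_wtX n). Qed.

Lemma gmom_ge1 n : 1 <= gmom n.
Proof.
have -> : 1 = \int[N01]_x (1 : R).
  by rewrite Rintegral_cst//= probability_setT mulr1.
apply: le_Rintegral => //; [|exact: integrable_wtX|by move=> x _; exact: wtX_ge1].
exact: (integrable_wtX 0).
Qed.

(* A multiple of [x^a phi(x - v)] for [x > 0], but smooth in terms of [ln]. *)
Let K a v x : R := expR (a * ln x - (x - v) ^+ 2 / 2).

Let K_is_derive a v x : 0 < x ->
  is_derive x 1 (K a v) (K a v x * (a / x - (x - v))).
Proof.
move=> x0; rewrite /K.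
have h := is_derive1_ln x0.
have -> : (fun x => expR (a * ln x - (x - v) ^+ 2 / 2)) =
    expR \o (a *: (@ln R : R -> R) - 2^-1 *: (id - cst v) ^+ 2).
  by apply/funext => z /=; rewrite fctE /= !fctE /GRing.scale /= (mulrC 2^-1).
apply: is_derive_eq.
rewrite /= !fctE /GRing.scale /= (mulrC 2^-1).
by field; rewrite gt_eqF.
Qed.

Let KE a v x : 0 < x -> normal_peak 1 * K a v x = x `^ a * phi (x - v).
Proof.
by move=> x0; rewrite phiE /K expRB expRN /powR gt_eqF// mulrCA mulrA.
Qed.

Let Kcont a v x : 0 < x -> {for x, continuous (K a v)}.
Proof.
move=> x0; apply/differentiable_continuous/derivable1_diffP.
by have [] := K_is_derive a v x0.
Qed.

Let KD1 a v x : 0 < x -> K (a + 1) v x = K a v x * x.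
Proof.
move=> x0; have -> : K a v x * x = K a v x * expR (ln x) by rewrite lnK ?posrE.
by rewrite /K -expRD; congr expR; ring.
Qed.

Let K_ge0 a v x : 0 <= K a v x. Proof. exact: expR_ge0. Qed.

Let Kd a v x : R := K a v x * (a / x - (x - v)).

(** The quotient by [x] lowers the exponent and the product with [x] raises it, so the integrated
    derivative relates three half-line moments; this is the source of Stein's identity below. *)
Let KdE a v x : 0 < x ->
  Kd a v x = a * K (a - 1) v x - K (a + 1) v x + v * K a v x.
Proof.
move=> x0; rewrite /Kd KD1// -[in K a v x](subrK 1 a) KD1//.
by field; rewrite gt_eqF.
Qed.

(** With [ln x <= x], the exponent plus [x] is at most a quadratic polynomial in [x]; completing its
    square gives the constant. *)
Let K_decay a v : 0 <= a -> exists2 C : R, 0 <= C &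
  forall x, 0 < x -> K a v x <= C * expR (- x).
Proof.
move=> a0; exists (expR ((v + a + 1) ^+ 2 / 2)) => [|x x0]; first exact: expR_ge0.
rewrite /K -expRD ler_expR.
have h1 : a * ln x <= a * x by rewrite ler_wpM2l// ltW// ln_sublinear.
have h2 := sqr_ge0 (x - v - a - 1).
have h3 : (x - v - a - 1) ^+ 2 = (x - v) ^+ 2 - 2 * (a + 1) * (x - v) + (a + 1) ^+ 2 by ring.
have h4 : (v + a + 1) ^+ 2 = v ^+ 2 + 2 * (a + 1) * v + (a + 1) ^+ 2 by ring.
have h5 := sqr_ge0 v.
lra.
Qed.

Let K_cvgy a v : 0 <= a -> K a v n.+1%:R @[n --> \oo] --> 0.
Proof.
move=> a0; have [C C0 hC] := K_decay v a0.
apply: (@squeeze_cvgr _ _ _ _ (cst 0) (fun n => C * n.+1%:R^-1)).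
- near=> n; rewrite K_ge0/= (le_trans (hC _ _))// ler_wpM2l// expRN.
  rewrite lef_pV2 ?posrE ?expR_gt0// (le_trans _ (expR_ge1Dx _))//.
  by rewrite lerDr.
- exact: cvg_cst.
- rewrite -[X in _ --> X](mulr0 C); apply: cvgM; first exact: cvg_cst.
  exact: cvg_harmonic.
Unshelve. all: by end_near. Qed.

Let K_cvg0 a v : 0 < a -> K a v n.+1%:R^-1 @[n --> \oo] --> 0.
Proof.
move=> a0.
apply: (@squeeze_cvgr _ _ _ _ (cst 0) (fun n => n.+1%:R^-1 `^ a)).
- near=> n; rewrite K_ge0/= /K /powR invr_eq0 pnatr_eq0/= ler_expR.
  by rewrite lerBlDr lerDl divr_ge0// sqr_ge0.
- exact: cvg_cst.
- have := powR_cvg0 a0; apply: cvg_comp.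
  move=> A [e /= e0 hA]; have [N _ hN] := (@cvgrPdist_lt _ _ _ _ _ _ _).1 (@cvg_harmonic R) _ e0.
  exists N => // n Nn; apply: hA; last by rewrite invr_gt0.
  exact: hN.
Unshelve. all: by end_near. Qed.

Let Kdcont a v x : 0 < x -> {for x, continuous (Kd a v)}.
Proof.
move=> x0; apply: cvgM; first exact: Kcont.
apply: cvgB; last by apply: cvgB; [exact: cvg_id|exact: cvg_cst].
apply: cvgM; first exact: cvg_cst.
by apply: cvgV; [rewrite gt_eqF|exact: cvg_id].
Qed.

(** Compact intervals that exhaust the half-line and avoid the singularity at 0. For [n = 0] the
    interval is the single point 1, whence [0 < n] in the integration formulas. *)
Let itv n : set R := `[n.+1%:R^-1, n.+1%:R]%classic.

Let itv_pos n x : itv n x -> 0 < x.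
Proof. by rewrite /itv/= in_itv/= => /andP[+ _]; apply: lt_le_trans; rewrite invr_gt0. Qed.

Let itv_nd : {homo itv : n m / (n <= m)%N >-> (n <= m)%O}.
Proof.
move=> n m nm; rewrite subsetEset => x; rewrite /itv/= !in_itv/= => /andP[h1 h2].
have nm' : n.+1%:R <= m.+1%:R :> R by rewrite ler_nat.
apply/andP; split; last exact: le_trans h2 nm'.
by apply: le_trans h1; rewrite lef_pV2 ?posrE.
Qed.

Let bigcup_itv : \bigcup_n itv n = `]0, +oo[%classic.
Proof.
apply/seteqP; split => x /=.
  by move=> [n _ /itv_pos]; rewrite in_itv/= andbT.
rewrite in_itv/= andbT => x0.
have [n hn] : exists n, x + x^-1 < n.+1%:R.
  exists (Num.bound (x + x^-1)); apply: lt_le_trans (archi_boundP _) _.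
    by rewrite addr_ge0 ?invr_ge0// ltW.
  by rewrite ler_nat.
have xi : 0 < x^-1 by rewrite invr_gt0.
exists n => //; rewrite /itv/= in_itv/=; apply/andP; split; last lra.
by rewrite invf_ple ?posrE//; lra.
Qed.

Let FTCitv a v n : (0 < n)%N ->
  (\int[mu]_(x in itv n) (Kd a v x)%:E =
   (K a v n.+1%:R)%:E - (K a v n.+1%:R^-1)%:E)%E.
Proof.
move=> n0.
have lt1 : n.+1%:R^-1 < n.+1%:R :> R.
  apply: (@lt_trans _ _ 1); first by rewrite invf_lt1// ltr1n.
  by rewrite ltr1n.
have pos x : x \in `]n.+1%:R^-1, n.+1%:R[ -> 0 < x.
  by rewrite in_itv/= => /andP[+ _]; apply: lt_trans; rewrite invr_gt0.
apply: continuous_FTC2 => //.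
- apply: continuous_in_subspaceT => x; rewrite inE => xn.
  exact/Kdcont/(itv_pos xn).
- split.
  + by move=> x /pos x0; have [] := K_is_derive a v x0.
  + by apply: cvg_at_right_filter; apply: Kcont; rewrite invr_gt0.
  + by apply: cvg_at_left_filter; apply: Kcont.
- move=> x /pos x0; rewrite derive1E; have := K_is_derive a v x0.
  by move=> h; rewrite derive_val.
Qed.

Let Kint a v n : mu.-integrable (itv n) (EFin \o K a v).
Proof.
apply: continuous_compact_integrable; first exact: segment_compact.
by apply: continuous_in_subspaceT => x; rewrite inE => /itv_pos; exact: Kcont.
Qed.

Let mitv n : measurable (itv n : set (measurableTypeR R)).
Proof. exact: measurable_itv. Qed.

Let FTCK a v n : (0 < n)%N ->
  a * \int[mu]_(x in itv n) K (a - 1) v x = K a v n.+1%:R - K a v n.+1%:R^-1 +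
  \int[mu]_(x in itv n) K (a + 1) v x - v * \int[mu]_(x in itv n) K a v x.
Proof.
move=> n0; have := FTCitv a v n0; move=> /(congr1 fine); rewrite /= => h.
have i1 : mu.-integrable (itv n) (EFin \o (fun x => a * K (a - 1) v x)).
  rewrite (_ : _ \o _ = (fun x => a%:E * (K (a - 1) v x)%:E)%E)//.
  by apply: integrableZl => //; exact: Kint.
have i2 : mu.-integrable (itv n) (EFin \o (fun x => v * K a v x)).
  rewrite (_ : _ \o _ = (fun x => v%:E * (K a v x)%:E)%E)//.
  by apply: integrableZl => //; exact: Kint.
have i3 : mu.-integrable (itv n) (EFin \o (fun x => a * K (a - 1) v x - K (a + 1) v x)).
  rewrite (_ : _ \o _ = (fun x => (a * K (a - 1) v x)%:E - (K (a + 1) v x)%:E)%E)//.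
  by apply: integrableB => //; exact: Kint.
have : \int[mu]_(x in itv n) Kd a v x = a * \int[mu]_(x in itv n) K (a - 1) v x -
   \int[mu]_(x in itv n) K (a + 1) v x + v * \int[mu]_(x in itv n) K a v x.
  rewrite -(RintegralZl _ (mitv n) (Kint (a - 1) v n)).
  rewrite -(RintegralZl _ (mitv n) (Kint a v n)).
  rewrite -(RintegralB (mitv n) i1 (Kint (a + 1) v n)).
  rewrite -(RintegralD (mitv n) i3 i2).
  by apply: eq_Rintegral => x; rewrite inE => /itv_pos; exact: KdE.
have aux (A B C D : R) : D = A - B + C -> A = D + B - C by move=> ->; ring.
by rewrite {1}/Rintegral h => /aux.
Qed.

Definition powphi p v x : R := x `^ p * phi (x - v).

Lemma powphi_ge0 p v x : 0 <= powphi p v x.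
Proof. by rewrite mulr_ge0 ?powR_ge0 ?phi_ge0. Qed.

Lemma measurable_powphi p v : measurable_fun setT (powphi p v).
Proof.
apply: measurable_funM; first exact: measurable_powR.
by apply: measurableT_comp; [exact: measurable_phi|exact: measurable_funB].
Qed.

Let Mint a v n : mu.-integrable (itv n) (EFin \o powphi a v).
Proof.
apply: (@eq_integrable _ _ _ mu (itv n) (mitv n)
  (fun x => (normal_peak 1)%:E * (K a v x)%:E)%E).
  by move=> x; rewrite inE => /itv_pos x0; rewrite -EFinM KE.
by apply: integrableZl => //; exact: Kint.
Qed.

Let ME p v n : \int[mu]_(x in itv n) powphi p v x =
  normal_peak 1 * \int[mu]_(x in itv n) K p v x.
Proof.
rewrite -(RintegralZl _ (mitv n) (Kint p v n)).
by apply: eq_Rintegral => x; rewrite inE => /itv_pos x0; rewrite KE.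
Qed.

(** The truncated moment [E[X^p; X > 0]] for [X] with law N(v, 1). By reflection, the negative
    half-line contributes the same function at [- v]. *)
Definition halfmom p v : \bar R := (\int[mu]_(x in `]0%R, +oo[) (powphi p v x)%:E)%E.

Lemma halfmomE p v :
  halfmom p v = (\int[mu]_(x in `]0%R, +oo[) (powphi p v x)%:E)%E.
Proof. by []. Qed.

Lemma halfmom_ge0 p v : (0 <= halfmom p v)%E.
Proof. by apply: integral_ge0 => x _; rewrite lee_fin powphi_ge0. Qed.

Let halfmom_cvg p v : (\int[mu]_(x in itv n) powphi p v x)%:E @[n --> \oo] --> halfmom p v.
Proof.
rewrite /halfmom -bigcup_itv.
rewrite (_ : (fun n => _) = (fun n => \int[mu]_(x in itv n) (powphi p v x)%:E)%E).
  apply: ge0_nondecreasing_set_cvg_integral => //.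
    by move=> n; apply/measurable_EFinP/measurable_funTS; exact: measurable_powphi.
  by move=> n x _; rewrite lee_fin powphi_ge0.
apply/funext => n; rewrite fineK//.
by apply: integrable_fin_num (Mint p v n).
Qed.

Lemma ge0_integral_N01_shift u (f : R -> \bar R) :
  measurable_fun setT f -> (forall x, 0 <= f x)%E ->
  (\int[N01]_e f (u + e)%R = \int[mu]_x (f x * (phi (x - u))%:E))%E.
Proof.
move=> mf f0; rewrite ge0_integral_N01; last 2 first.
  by apply: (measurableT_comp mf); exact: measurable_funD.
  by move=> x; exact: f0.
rewrite -(@ge0_integral_shift u (fun x => (f x * (phi (x - u))%:E)%E)).
- by apply: eq_integral => x _; rewrite addrK addrC.
- apply: emeasurable_funM => //; apply/measurable_EFinP/measurableT_comp.
    exact: measurable_phi.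
  exact: measurable_funB.
- by move=> x; rewrite mule_ge0// lee_fin phi_ge0.
Qed.

Lemma halfmom_fin p v n : 0 <= p <= n%:R -> halfmom p v \is a fin_num.
Proof.
move=> hp; rewrite ge0_fin_numE ?halfmom_ge0//.
apply: (@le_lt_trans _ _ (\int[mu]_x ((wt x ^+ n)%:E * (phi (x - v))%:E))%E).
  apply: (@le_trans _ _ (\int[mu]_(x in `]0%R, +oo[) ((wt x ^+ n)%:E * (phi (x - v))%:E))%E).
    apply: ge0_le_integral => //.
    - by move=> x _; rewrite lee_fin powphi_ge0.
    - by apply/measurable_EFinP/measurable_funTS; exact: measurable_powphi.
    - apply/measurable_EFinP/measurable_funTS/measurable_funM.
        by apply: measurable_funX; apply: measurable_funD => //; exact: measurableT_comp.
      by apply: measurableT_comp; [exact: measurable_phi|exact: measurable_funB].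
    - move=> x; rewrite /= in_itv/= andbT => x0; rewrite lee_fin /powphi.
      rewrite ler_wpM2r ?phi_ge0// -[X in X `^ _](gtr0_norm x0).
      exact: powR_le_wt.
  apply: ge0_subset_integral => //.
  - apply/measurable_EFinP/measurable_funM.
      by apply: measurable_funX; apply: measurable_funD => //; exact: measurableT_comp.
    by apply: measurableT_comp; [exact: measurable_phi|exact: measurable_funB].
  - by move=> x _; rewrite lee_fin mulr_ge0 ?phi_ge0// exprn_ge0// wt_ge0.
have mw : measurable_fun setT (fun x : R => (wt x ^+ n)%:E).
  apply/measurable_EFinP.
  by apply: measurable_funX; apply: measurable_funD => //; exact: measurableT_comp.
rewrite -(@ge0_integral_N01_shift v (fun x => (wt x ^+ n)%:E))//; last first.
  by move=> x; rewrite lee_fin exprn_ge0// wt_ge0.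
apply: (@le_lt_trans _ _ (\int[N01]_e ((wt v ^+ n)%:E * (wt e ^+ n)%:E))%E).
  apply: ge0_le_integral => //.
  - by move=> x _; rewrite lee_fin exprn_ge0// wt_ge0.
  - by apply: (measurableT_comp mw); exact: measurable_funD.
  - by apply: measurable_funeM.
  - move=> x _; rewrite -EFinM lee_fin -exprMn lerXn2r// ?nnegrE ?mulr_ge0 ?wt_ge0//.
    exact: wtD.
rewrite ge0_integralZl//; last 2 first.
  by move=> x _; rewrite lee_fin exprn_ge0// wt_ge0.
  by rewrite lee_fin exprn_ge0// wt_ge0.
by rewrite gmomE -EFinM ltry.
Qed.

(** Integration by parts on [itv n]; the boundary terms vanish at infinity by Gaussian decay and at
    0 because [a > 0]. The exponent [a - 1] may be negative, so powers of [wt] do not dominate this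
    moment: it is finite because the integrals over [itv n] increase to it and, by the identity,
    converge to a real number. *)
Lemma half_stein a v : 0 < a <= 2 ->
  halfmom (a - 1) v \is a fin_num /\
  a * fine (halfmom (a - 1) v) = fine (halfmom (a + 1) v) - v * fine (halfmom a v).
Proof.
move=> /andP[a0 a2].
have f1 : halfmom (a + 1) v \is a fin_num.
  by apply: (@halfmom_fin _ _ 3); apply/andP; split; lra.
have f2 : halfmom a v \is a fin_num.
  by apply: (@halfmom_fin _ _ 3); apply/andP; split; lra.
pose J p n : R := \int[mu]_(x in itv n) powphi p v x.
have c1 : J (a + 1) n @[n --> \oo] --> fine (halfmom (a + 1) v).
  by have := @halfmom_cvg (a + 1) v; rewrite -{1}(fineK f1) => /fine_cvg.
have c2 : J a n @[n --> \oo] --> fine (halfmom a v).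
  by have := @halfmom_cvg a v; rewrite -{1}(fineK f2) => /fine_cvg.
pose L := fine (halfmom (a + 1) v) - v * fine (halfmom a v).
have JE : \forall n \near \oo, normal_peak 1 * (K a v n.+1%:R - K a v n.+1%:R^-1) +
    J (a + 1) n - v * J a n = a * J (a - 1) n.
  exists 1%N => // n /= n0.
  rewrite /J !ME [RHS]mulrCA (FTCK a v n0); set I1 := Rintegral _ _ _.
  by set I2 := Rintegral _ _ _; ring.
have c3 : a * J (a - 1) n @[n --> \oo] --> L.
  apply: cvg_trans; first exact: near_eq_cvg JE.
  have -> : L = normal_peak 1 * (0 - 0) + fine (halfmom (a + 1) v) - v * fine (halfmom a v).
    by rewrite subr0 mulr0 add0r.
  apply: cvgB; last by apply: cvgM => //; exact: cvg_cst.
  apply: cvgD; last exact: c1.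
  apply: cvgM; first exact: cvg_cst.
  by apply: cvgB; [exact: K_cvgy (ltW a0)|exact: K_cvg0].
have c4 : J (a - 1) n @[n --> \oo] --> a^-1 * L.
  have -> : (fun n => J (a - 1) n) = (fun n => a^-1 * (a * J (a - 1) n)).
    by apply/funext => n; rewrite mulKf// gt_eqF.
  by apply: cvgM => //; exact: cvg_cst.
have E : halfmom (a - 1) v = (a^-1 * L)%:E.
  apply: (cvg_unique (@ereal_hausdorff R) (@halfmom_cvg (a - 1) v)).
  by apply: cvg_EFin; [exact: nearW|exact: c4].
by rewrite E; split => //=; rewrite mulVKf// gt_eqF.
Qed.

End gauss1.

#[global] Opaque N01 halfmom.

Section gauss2.
Variable R : realType.
Notation mu := (@lebesgue_measure R).
Notation N01 := (N01 R).
Implicit Types (x y u e t c b B eta : R).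

(** The half-line moments see positive arguments only; reflection brings the negative half over and
    reverses the sign of [u]. *)
Lemma N01_split u (f : R -> R) : measurable_fun setT f -> (forall x, 0 <= f x) ->
  (\int[N01]_e (f (u + e))%:E =
   \int[mu]_(x in `]0%R, +oo[) (f x * phi (x - u))%:E +
   \int[mu]_(x in `]0%R, +oo[) (f (- x) * phi (x + u))%:E)%E.
Proof.
move=> mf f0.
have mF : measurable_fun setT (fun x : R => (f x * phi (x - u))%:E).
  apply/measurable_EFinP/measurable_funM => //; apply: measurableT_comp.
    exact: measurable_phi.
  exact: measurable_funB.
have mG : measurable_fun setT (fun x : R => (f (- x) * phi (x + u))%:E).
  apply/measurable_EFinP/measurable_funM.
    by apply: (measurableT_comp mf); exact: oppr_measurable.
  by apply: measurableT_comp; [exact: measurable_phi|exact: measurable_funD].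
rewrite (@ge0_integral_N01_shift R u (fun x => (f x)%:E)); last 2 first.
  exact/measurable_EFinP.
  by move=> x; rewrite lee_fin.
under eq_integral do rewrite -EFinM.
have -> : [set: R] = `]0, +oo[%classic `|` `]-oo, 0]%classic.
  by apply/seteqP; split => x //= _; rewrite !in_itv/= andbT; case: ltP; [left|right].
rewrite ge0_integral_setU; last first.
- rewrite disj_set2E; apply/eqP/seteqP; split => x //= []; rewrite !in_itv/= andbT.
  by move=> /lt_le_trans h /h; rewrite ltxx.
- by move=> x _; rewrite lee_fin mulr_ge0 ?phi_ge0.
- exact: measurable_funTS.
- exact: measurable_itv.
- exact: measurable_itv.
congr adde.
rewrite integral_itv_obnd_cbnd; last exact: measurable_funTS.
rewrite ge0_integration_by_substitution0; last 2 first.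
  exact: mG.
  by move=> x; rewrite lee_fin mulr_ge0 ?phi_ge0.
apply: eq_integral => x _; rewrite opprK -phiN; congr (_ * phi _)%:E.
by rewrite opprB addrC.
Qed.

Lemma N01_splitE u (f : R -> R) (A B : \bar R) :
  measurable_fun setT f -> (forall x, 0 <= f x) ->
  (\int[mu]_(x in `]0%R, +oo[) (f x * phi (x - u))%:E)%E = A ->
  (\int[mu]_(x in `]0%R, +oo[) (f (- x) * phi (x + u))%:E)%E = B ->
  (\int[N01]_e (f (u + e))%:E)%E = (A + B)%E.
Proof. by move=> mf f0 <- <-; exact: N01_split. Qed.

Let mabsp p : measurable_fun setT (fun x : R => `|x| `^ p).
Proof. by apply: (measurableT_comp (measurable_powR p)); exact: normr_measurable. Qed.

Lemma N01_absmom u p :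
  (\int[N01]_e (`|u + e| `^ p)%:E = halfmom p u + halfmom p (- u))%E.
Proof.
apply: (@N01_splitE u (fun x => `|x| `^ p)); [exact: mabsp|by move=> x; exact: powR_ge0| |].
  rewrite halfmomE; apply: eq_integral => x; rewrite inE/= in_itv/= andbT => x0.
  by rewrite gtr0_norm.
rewrite halfmomE; apply: eq_integral => x; rewrite inE/= in_itv/= andbT => x0.
by rewrite normrN gtr0_norm// /powphi opprK.
Qed.

Lemma N01_posmom u p :
  (\int[N01]_e (`|u + e| `^ p * (0 < u + e)%R%:R)%:E = halfmom p u)%E.
Proof.
rewrite -[RHS]adde0.
apply: (@N01_splitE u (fun x => `|x| `^ p * (0 < x)%R%:R)).
- apply: measurable_funM; first exact: mabsp.
  by apply: measurable_boolR; exact: measurable_fun_ltr.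
- by move=> x; rewrite mulr_ge0// powR_ge0.
- rewrite halfmomE; apply: eq_integral => x; rewrite inE/= in_itv/= andbT => x0.
  by rewrite gtr0_norm// x0 mulr1.
- apply: integral0_eq => x; rewrite /= in_itv/= andbT => x0.
  by rewrite oppr_gt0 ltNge (ltW x0) mulr0 mul0r.
Qed.

Lemma N01_negmom u p :
  (\int[N01]_e (`|u + e| `^ p * (u + e < 0)%R%:R)%:E = halfmom p (- u))%E.
Proof.
rewrite -[RHS]add0e.
apply: (@N01_splitE u (fun x => `|x| `^ p * (x < 0)%R%:R)).
- apply: measurable_funM; first exact: mabsp.
  by apply: measurable_boolR; exact: measurable_fun_ltr.
- by move=> x; rewrite mulr_ge0// powR_ge0.
- apply: integral0_eq => x; rewrite /= in_itv/= andbT => x0.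
  by rewrite ltNge (ltW x0) mulr0 mul0r.
- rewrite halfmomE; apply: eq_integral => x; rewrite inE/= in_itv/= andbT => x0.
  by rewrite normrN gtr0_norm// oppr_lt0 x0 mulr1 /powphi opprK.
Qed.

Lemma mwt : measurable_fun setT (@wt R).
Proof. by apply: measurable_funD => //; exact: normr_measurable. Qed.

Lemma mshrink c : measurable_fun setT (@shrink R c).
Proof.
have -> : @shrink R c = fun x =>
    `|x| `^ (1 - c) * (0 < x)%R%:R - `|x| `^ (1 - c) * (x < 0)%R%:R.
  by apply/funext => x; rewrite /shrink; case: sgrP => [x0|x0|x0];
    rewrite ?x0 ?ltxx ?(lt_gtF x0)/= ?mulr0 ?mulr1 ?subr0 ?sub0r ?mul0r ?mul1r ?mulN1r.
have m1 : measurable_fun setT (fun x : R => `|x| `^ (1 - c)).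
  by apply: (measurableT_comp (measurable_powR _)); exact: normr_measurable.
apply: measurable_funB; apply: measurable_funM => //.
  apply: measurable_boolR.
  exact: measurable_fun_ltr.
by apply: measurable_boolR; exact: measurable_fun_ltr.
Qed.

Lemma integrable_pos (f : R -> R) (k : R) : measurable_fun setT f ->
  (forall x, 0 <= f x) -> (\int[N01]_x (f x)%:E = k%:E)%E ->
  N01.-integrable setT (EFin \o f) /\ \int[N01]_x f x = k.
Proof.
move=> mf f0 fk; split; last by rewrite /Rintegral fk.
apply/integrableP; split; first exact/measurable_EFinP.
under eq_integral do rewrite /= ger0_norm//.
by rewrite fk ltry.
Qed.

(** Substituting [e = x - u] with [x = u + e] replaces the factor [e] by powers of [|x|] on the two
    half-lines, where truncated moments apply. *)
Lemma mul_shrinkE u c e : c < 1 -> let a := 1 - c in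
  e * shrink c (u + e) = `|u + e| `^ (a + 1) +
    (- u) * (`|u + e| `^ a * (0 < u + e)%R%:R) + u * (`|u + e| `^ a * (u + e < 0)%R%:R).
Proof.
move=> c1 a; have a1 : a + 1 != 0 by rewrite gt_eqF// /a; lra.
set x := u + e; have -> : e = x - u by rewrite /x; ring.
rewrite /shrink -/a.
have -> : `|x| `^ (a + 1) = `|x| * `|x| `^ a.
  by rewrite powRD ?(negbTE a1)// powRr1// mulrC.
case: sgrP => [x0|x0|x0].
- by ring.
- by rewrite /=; ring.
- by rewrite /=; ring.
Qed.

(** Stein's identity for [shrink c], whose derivative [(1 - c) |x|^(-c)] may be unbounded at 0 but
    is integrable. It is the sum over both half-lines of [half_stein] at the exponent [1 - c], that
    is, for the means [u] and [- u]. *)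
Lemma stein u c : `|c| < 1 ->
  [/\ N01.-integrable setT (EFin \o (fun e => `|u + e| `^ (- c))),
      N01.-integrable setT (EFin \o (fun e => e * shrink c (u + e))) &
      \int[N01]_e (e * shrink c (u + e)) =
        (1 - c) * \int[N01]_e (`|u + e| `^ (- c))].
Proof.
rewrite ltr_norml => /andP[c1 c2]; pose a := 1 - c.
have a0 : 0 < a by rewrite /a; lra.
have a2 : 0 < a <= 2 by rewrite /a; apply/andP; split; lra.
have ha : 0 <= a <= 3 by rewrite /a; apply/andP; split; lra.
have ha1 : 0 <= a + 1 <= 3 by rewrite /a; apply/andP; split; lra.
have [f1 h1] := half_stein u a2; have [f2 h2] := half_stein (- u) a2.
have g1 p : 0 <= p <= 3 -> halfmom p u \is a fin_num by exact: (@halfmom_fin R p u 3).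
have g2 p : 0 <= p <= 3 -> halfmom p (- u) \is a fin_num by exact: (@halfmom_fin R p (- u) 3).
have mp p : measurable_fun setT (fun e : measurableTypeR R => `|u + e| `^ p).
  apply: (measurableT_comp (measurable_powR p)).
  by apply: (measurableT_comp (@normr_measurable _ _)); exact: measurable_funD.
have ca : - c = a - 1 by rewrite /a; ring.
have [i1 e1] : N01.-integrable setT (EFin \o (fun e => `|u + e| `^ (- c))) /\
   \int[N01]_e (`|u + e| `^ (- c)) =
   fine (halfmom (a - 1) u) + fine (halfmom (a - 1) (- u)).
  apply: integrable_pos; [exact: mp|by move=> x; exact: powR_ge0|].
  by rewrite N01_absmom ca EFinD (fineK f1) (fineK f2).
have [i2 e2] : N01.-integrable setT (EFin \o (fun e => `|u + e| `^ (a + 1))) /\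
   \int[N01]_e (`|u + e| `^ (a + 1)) =
   fine (halfmom (a + 1) u) + fine (halfmom (a + 1) (- u)).
  apply: integrable_pos; [exact: mp|by move=> x; exact: powR_ge0|].
  by rewrite N01_absmom EFinD (fineK (g1 _ ha1)) (fineK (g2 _ ha1)).
have [i3 e3] : N01.-integrable setT (EFin \o (fun e => `|u + e| `^ a * (0 < u + e)%R%:R)) /\
   \int[N01]_e (`|u + e| `^ a * (0 < u + e)%R%:R) = fine (halfmom a u).
  apply: integrable_pos.
  - apply: measurable_funM; first exact: mp.
    apply: measurable_boolR.
    by apply: measurable_fun_ltr => //; exact: measurable_funD.
  - by move=> x; rewrite mulr_ge0// powR_ge0.
  - by rewrite N01_posmom (fineK (g1 _ ha)).
have [i4 e4] : N01.-integrable setT (EFin \o (fun e => `|u + e| `^ a * (u + e < 0)%R%:R)) /\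
   \int[N01]_e (`|u + e| `^ a * (u + e < 0)%R%:R) = fine (halfmom a (- u)).
  apply: integrable_pos.
  - apply: measurable_funM; first exact: mp.
    apply: measurable_boolR.
    by apply: measurable_fun_ltr => //; exact: measurable_funD.
  - by move=> x; rewrite mulr_ge0// powR_ge0.
  - by rewrite N01_negmom (fineK (g2 _ ha)).
have E (e : R) := @mul_shrinkE u c e c2.
rewrite -/a in E.
have j3 : N01.-integrable setT (EFin \o (fun e => - u * (`|u + e| `^ a * (0 < u + e)%R%:R))).
  rewrite (_ : _ \o _ = (fun e => (- u)%:E * (`|u + e| `^ a * (0 < u + e)%R%:R)%:E)%E)//.
  exact: integrableZl.
have j4 : N01.-integrable setT (EFin \o (fun e => u * (`|u + e| `^ a * (u + e < 0)%R%:R))).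
  rewrite (_ : _ \o _ = (fun e => u%:E * (`|u + e| `^ a * (u + e < 0)%R%:R)%:E)%E)//.
  exact: integrableZl.
have j2 : N01.-integrable setT (EFin \o (fun e => `|u + e| `^ (a + 1) +
    (- u) * (`|u + e| `^ a * (0 < u + e)%R%:R))).
  rewrite (_ : _ \o _ = (fun e => (`|u + e| `^ (a + 1))%:E +
    ((- u) * (`|u + e| `^ a * (0 < u + e)%R%:R))%:E)%E)//.
  exact: integrableD.
have -> : (fun e => e * shrink c (u + e)) = (fun e => `|u + e| `^ (a + 1) +
    (- u) * (`|u + e| `^ a * (0 < u + e)%R%:R) + u * (`|u + e| `^ a * (u + e < 0)%R%:R)).
  by apply/funext => e; exact: E.
clear E; split => //.
  rewrite (_ : _ \o _ = (fun e => (`|u + e| `^ (a + 1) +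
    (- u) * (`|u + e| `^ a * (0 < u + e)%R%:R))%:E +
    (u * (`|u + e| `^ a * (u + e < 0)%R%:R))%:E)%E)//.
  exact: integrableD.
rewrite (RintegralD measurableT j2 j4) (RintegralD measurableT i2 j3).
rewrite (RintegralZl _ measurableT i3) (RintegralZl _ measurableT i4) e1 e2 e3 e4.
have assemble (x1 x2 y1 y2 : R) :
    x1 + x2 + - u * y1 + u * y2 = x1 - u * y1 + (x2 - - u * y2) by ring.
by rewrite -/a mulrDr h1 h2; exact: assemble.
Qed.

End gauss2.

Section integral_helpers.
Context d (T : measurableType d) (R : realType).
Variable mu : {measure set T -> \bar R}.

Lemma Rint_sum (I : Type) (s : seq I) (f : I -> T -> R) :
  (forall i, mu.-integrable setT (EFin \o f i)) ->
  mu.-integrable setT (EFin \o (fun x => \sum_(i <- s) f i x)) /\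
  \int[mu]_x (\sum_(i <- s) f i x) = \sum_(i <- s) \int[mu]_x f i x.
Proof.
move=> fi; elim: s => [|i s [IH1 IH2]].
  have -> : (fun x => \sum_(i <- [::]) f i x) = (fun=> 0) by apply/funext => x; rewrite big_nil.
  rewrite big_nil; split; first exact: integrable0.
  by rewrite /Rintegral integral0.
have -> : (fun x => \sum_(j <- i :: s) f j x) = (fun x => f i x + \sum_(j <- s) f j x).
  by apply/funext => x; rewrite big_cons.
rewrite big_cons -IH2; split; last exact: RintegralD.
rewrite (_ : _ \o _ = (fun x => (f i x)%:E + (\sum_(j <- s) f j x)%:E)%E)//.
by apply: integrableD => //; exact: fi.
Qed.

Lemma Rint_scale (k : R) (f : T -> R) :
  mu.-integrable setT (EFin \o f) ->
  mu.-integrable setT (EFin \o (fun x => k * f x)) /\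
  \int[mu]_x (k * f x) = k * \int[mu]_x f x.
Proof.
move=> fi; split; last exact: RintegralZl.
rewrite (_ : _ \o _ = (fun x => k%:E * (f x)%:E)%E)//.
exact: integrableZl.
Qed.

Lemma Rint_add (f g : T -> R) :
  mu.-integrable setT (EFin \o f) -> mu.-integrable setT (EFin \o g) ->
  mu.-integrable setT (EFin \o (fun x => f x + g x)) /\
  \int[mu]_x (f x + g x) = \int[mu]_x f x + \int[mu]_x g x.
Proof.
move=> fi gi; split; last exact: RintegralD.
rewrite (_ : _ \o _ = (fun x => (f x)%:E + (g x)%:E)%E)//.
exact: integrableD.
Qed.

Lemma Rint_sub (f g : T -> R) :
  mu.-integrable setT (EFin \o f) -> mu.-integrable setT (EFin \o g) ->
  mu.-integrable setT (EFin \o (fun x => f x - g x)) /\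
  \int[mu]_x (f x - g x) = \int[mu]_x f x - \int[mu]_x g x.
Proof.
move=> fi gi; split; last exact: RintegralB.
rewrite (_ : _ \o _ = (fun x => (f x)%:E - (g x)%:E)%E)//.
exact: integrableB.
Qed.

Lemma Rint_absB (f g h : T -> R) :
  mu.-integrable setT (EFin \o f) -> mu.-integrable setT (EFin \o g) ->
  mu.-integrable setT (EFin \o h) -> (forall x, `|f x - g x| <= h x) ->
  `|\int[mu]_x f x - \int[mu]_x g x| <= \int[mu]_x h x.
Proof.
move=> fi gi hi fgh; have [si <-] := Rint_sub fi gi.
apply: (le_trans (le_normr_Rintegral measurableT si)).
apply: le_Rintegral => //.
by have := integrable_norm si.
Qed.

Lemma EFin_Rint (f : T -> R) : mu.-integrable setT (EFin \o f) ->
  (\int[mu]_x (f x)%:E)%E = (\int[mu]_x f x)%:E.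
Proof. by move=> fi; rewrite fineK//; exact: integrable_fin_num. Qed.

End integral_helpers.

Section gauss_risk.
Variable R : realType.
Notation N01 := (N01 R).
Implicit Types (x y u e t c b B eta : R).

(** The case [u = 0], [c = 0] of [stein], where [e * shrink 0 e] is [e ^+ 2]. *)
Lemma N01_sq : N01.-integrable setT (EFin \o (fun e => e ^+ 2)) /\
  \int[N01]_e (e ^+ 2) = 1.
Proof.
have c0 : `|0 : R| < 1 by rewrite normr0.
have [_ i2 e2] := stein 0 c0.
have E : (fun e : R => e * shrink 0 (0 + e)) = (fun e => e ^+ 2).
  apply/funext => e; rewrite add0r /shrink subr0 powRr1// -numEsg.
  by rewrite expr2.
rewrite E in i2 e2; split => //; rewrite e2 subr0 mul1r.
rewrite (_ : (fun e => _) = fun=> 1); last first.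
  by apply/funext => e; rewrite oppr0 powRr0.
by rewrite Rintegral_cst//= probability_setT mulr1.
Qed.

Lemma sureE' x t c : c < 1 ->
  sure x t c = 2 * (t * (1 - c)) * `|x| `^ (- c) - (t * shrink c x) ^+ 2.
Proof.
move=> c1; have [->|x0] := eqVneq x 0; last exact: sureE.
have c2 : 2 - c != 0 by rewrite gt_eqF//; lra.
rewrite /sure /shrink sgr0 mul0r normr0 powRN (powR0 c2); ring.
Qed.

Lemma integrable_shrink2 u c : `|c| <= 1 ->
  N01.-integrable setT (EFin \o (fun e => shrink c (u + e) ^+ 2)).
Proof.
move=> c1; apply: (@integrable_le _ (measurableTypeR R) R N01 _
   (fun e => wt u ^+ 4 * wt e ^+ 4)).
- apply: measurable_funX; apply: (measurableT_comp (@mshrink R c)).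
  exact: measurable_funD.
- move=> e; rewrite ger0_norm ?sqr_ge0// -(real_normK (num_real _)).
  have h := norm_shrink_wt (u + e) c1.
  apply: (@le_trans _ _ ((wt (u + e) ^+ 2) ^+ 2)).
    by rewrite lerXn2r ?nnegrE// exprn_ge0// wt_ge0.
  by rewrite -exprM -exprMn lerXn2r ?nnegrE ?mulr_ge0 ?wt_ge0 ?wtD.
- by have [] := Rint_scale (wt u ^+ 4) (integrable_wtX R 4).
Qed.

Definition lrisk u t c : R := \int[N01]_e (loss u e t c).

(** Stein's unbiased risk estimate: in the expanded square, [e ^+ 2] has mean 1 and [stein]
    evaluates the cross term. *)
Lemma lrisk_sure u t c : `|c| < 1 ->
  [/\ N01.-integrable setT (EFin \o (fun e => loss u e t c)),
      N01.-integrable setT (EFin \o (fun e => sure (u + e) t c)) &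
      lrisk u t c = 1 - \int[N01]_e (sure (u + e) t c)].
Proof.
move=> c1; have c2 : c < 1 by rewrite (le_lt_trans (ler_norm _)).
have [i1 i2 e2] := stein u c1; have [i3 e3] := N01_sq.
have i4 := integrable_shrink2 u (ltW c1).
have [j1 k1] := Rint_scale (2 * (t * (1 - c))) i1.
have [j2 k2] := Rint_scale (- (2 * t)) i2.
have [j4 k4] := Rint_scale (t ^+ 2) i4.
have [l1 m1] := Rint_add i3 j2; have [l2 m2] := Rint_add l1 j4.
have [l3 m3] := Rint_sub j1 j4.
have E1 : (fun e => loss u e t c) = (fun e => e ^+ 2 + - (2 * t) * (e * shrink c (u + e)) +
    t ^+ 2 * shrink c (u + e) ^+ 2) by apply/funext => e; rewrite /loss; ring.
have E2 : (fun e => sure (u + e) t c) = (fun e => 2 * (t * (1 - c)) * `|u + e| `^ (- c) -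
    t ^+ 2 * shrink c (u + e) ^+ 2) by apply/funext => e; rewrite sureE'// exprMn.
rewrite /lrisk E1 E2; split => //.
rewrite m2 m1 m3 k1 k2 k4 e3 e2.
set A := Rintegral _ _ _; set B := Rintegral _ _ _.
by ring.
Qed.

(** [stein] read backwards at [c = (1 + b) / 2]: up to the factor [(1 - b) / 2], the singular moment
    is the mean of [e * shrink c (u + e)], which has no singularity and grows polynomially. *)
Lemma sing_moment b u : 0 <= b < 1 ->
  N01.-integrable setT (EFin \o (fun e => sing b (u + e))) /\
  \int[N01]_e (sing b (u + e)) <= 2 / (1 - b) * gmom R 3 * wt u ^+ 2.
Proof.
move=> /andP[b0 b1].
have bb0 : 0 < (1 - b) / 2 by rewrite divr_gt0// subr_gt0.
have bb : `|(1 + b) / 2| < 1.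
  by rewrite ger0_norm; [rewrite ltr_pdivrMr//; lra|rewrite divr_ge0//; lra].
have bbE : 1 - (1 + b) / 2 = (1 - b) / 2 by field.
have [i1 i2 e2] := stein u bb; split; first exact: i1.
rewrite bbE in e2.
have -> : \int[N01]_e (sing b (u + e)) =
    ((1 - b) / 2)^-1 * \int[N01]_e (e * shrink ((1 + b) / 2) (u + e)).
  by rewrite e2 mulKf// gt_eqF.
rewrite invf_div -mulrA ler_wpM2l//; first by rewrite divr_ge0// subr_ge0 ltW.
have [j1 k1] := Rint_scale (wt u ^+ 2) (integrable_wtX R 3).
have -> : gmom R 3 * wt u ^+ 2 = \int[N01]_x (wt u ^+ 2 * wt x ^+ 3).
  by rewrite k1 mulrC.
apply: le_Rintegral => // e _.
rewrite (le_trans (ler_norm _))// normrM.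
apply: (@le_trans _ _ (wt e * (wt u * wt e) ^+ 2)).
  apply: ler_pM => //; first exact: norm_le_wt.
  rewrite (le_trans (norm_shrink_wt _ (ltW bb)))//.
  by rewrite lerXn2r ?nnegrE ?mulr_ge0 ?wt_ge0 ?wtD.
by rewrite le_eqVlt; apply/orP; left; apply/eqP; ring.
Qed.

End gauss_risk.

(** * Independent Gaussian noise: laws, pairs and variances of sums *)

Section iid.
Context disp (Omega : measurableType disp) (R : realType).
Variables (P : probability Omega R) (d : nat) (eps : 'I_d -> Omega -> R).
Hypothesis hiid : iid_std_normal P eps.
Notation N01 := (N01 R).

Let meps i : measurable_fun setT (eps i : Omega -> measurableTypeR R).
Proof. by have [+ _ _] := hiid; apply. Qed.

Let lawE i (A : set (measurableTypeR R)) : measurable A ->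
  pushforward P (eps i : Omega -> measurableTypeR R) A = N01 A.
Proof. by move=> mA; have [_ _ h] := hiid; rewrite /pushforward h// N01E. Qed.

Lemma ge0_law i (h : R -> \bar R) : measurable_fun setT h ->
  (forall x, 0 <= h x)%E -> (\int[P]_w h (eps i w) = \int[N01]_e h e)%E.
Proof.
move=> mh h0.
transitivity (\int[pushforward P (eps i : Omega -> measurableTypeR R)]_e h e)%E.
  by rewrite ge0_integral_pushforward.
by apply: eq_measure_integral => A mA _; exact: lawE.
Qed.

Lemma law_int i (h : R -> R) : measurable_fun setT h ->
  N01.-integrable setT (EFin \o h) ->
  P.-integrable setT (EFin \o (fun w => h (eps i w))) /\
  \int[P]_w h (eps i w) = \int[N01]_e h e.
Proof.
move=> mh ih.
have mh' : measurable_fun setT (EFin \o h) by exact/measurable_EFinP.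
have ih' : P.-integrable setT (EFin \o (fun w => h (eps i w))).
  apply/integrableP; split; first exact: (measurableT_comp mh' (meps i)).
  rewrite (@ge0_law i (fun e => `|(h e)%:E|%E)); last 2 first.
    by apply: measurableT_comp.
    by move=> x; exact: abse_ge0.
  by move/integrableP : ih => [].
split => //; congr fine.
transitivity (\int[pushforward P (eps i : Omega -> measurableTypeR R)]_e (h e)%:E)%E.
  rewrite (@integral_pushforward _ _ _ _ _ _ (meps i) P setT (EFin \o h)) => //.
by apply: eq_measure_integral => A mA _; exact: lawE.
Qed.

Let lawpair i j (A B : set (measurableTypeR R)) : i != j ->
  measurable A -> measurable B ->
  P ((fun w => (eps i w, eps j w)) @^-1` (A `*` B)) = (N01 A * N01 B)%E.
Proof.
move=> ij mA mB; have [_ + hl] := hiid.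
pose F k : set R := if k == i then A else if k == j then B else setT.
move=> /(_ F) hF.
have -> : (fun w => (eps i w, eps j w)) @^-1` (A `*` B) = [set w | forall k, F k (eps k w)].
  apply/seteqP; split => w /=.
    by move=> [a b] k; rewrite /F; case: eqP => [->//|_]; case: eqP => [->|].
  move=> h; split; first by have := h i; rewrite /F eqxx.
  by have := h j; rewrite /F eq_sym (negbTE ij) eqxx.
rewrite hF; last by move=> k; rewrite /F; case: ifP => // _; case: ifP.
rewrite (bigD1 i)//= (bigD1 j)/=; last by rewrite eq_sym.
rewrite big1 => [|k /andP[ki kj]]; last first.
  by rewrite /F (negbTE ki) (negbTE kj) preimage_setT probability_setT.
rewrite mule1 /F eqxx (eq_sym j) (negbTE ij) eqxx.
by rewrite !hl.
Qed.

(** The joint law of two coordinates is the product measure, since both agree on rectangles; Fubini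
    then factorizes the mean. Pairs suffice because only variances of sums are taken. *)
Lemma law_pair i j (h k : R -> R) : i != j ->
  measurable_fun setT h -> measurable_fun setT k ->
  N01.-integrable setT (EFin \o h) -> N01.-integrable setT (EFin \o k) ->
  P.-integrable setT (EFin \o (fun w => h (eps i w) * k (eps j w))) /\
  \int[P]_w (h (eps i w) * k (eps j w)) = \int[N01]_e h e * \int[N01]_e k e.
Proof.
move=> ij mh mk ih ik.
pose T := (measurableTypeR R * measurableTypeR R)%type.
pose X w : T := (eps i w, eps j w).
have mX : measurable_fun setT X by apply: measurable_fun_pair; exact: meps.
pose f (z : T) : R := h z.1 * k z.2.
have mf : measurable_fun setT f.
  apply: measurable_funM.
    exact: (measurableT_comp mh measurable_fst).
  exact: (measurableT_comp mk measurable_snd).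
have mf' : measurable_fun setT (EFin \o f) by exact/measurable_EFinP.
have PE A : measurable A -> pushforward P X A = (N01 \x N01)%E A.
  move=> mA; apply/esym.
  pose nu := pushforward P X.
  apply: (@product_measure_unique _ _ _ _ _ N01 N01 nu) => // B C mB mC.
  exact: lawpair.
have ifp : (N01 \x N01)%E.-integrable setT (EFin \o f).
  apply/integrableP; split => //.
  rewrite fubini_tonelli1; last 2 first.
    exact: measurableT_comp.
    by move=> x; exact: abse_ge0.
  have [ihn iknR] := (integrable_norm ih, integrable_norm ik).
  have [j1 j2] := Rint_scale (\int[N01]_y `|k y|) ihn.
  suff -> : (\int[N01]_x (fubini_F N01 (fun z => `|(EFin \o f) z|) x) =
      (\int[N01]_y `|k y| * \int[N01]_y `|h y|)%:E)%E by rewrite ltry.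
  rewrite -j2 -EFin_Rint//; apply: eq_integral => x _.
  have [l1 l2] := Rint_scale `|h x| iknR.
  rewrite mulrC -l2 -EFin_Rint//; apply: eq_integral => y _.
  by rewrite /f /= normrM.
have ifP : P.-integrable setT (EFin \o (fun w => h (eps i w) * k (eps j w))).
  apply/integrableP; split; first exact: (measurableT_comp mf' mX).
  rewrite -(@ge0_integral_pushforward _ _ _ _ _ _ mX P setT (fun z => `|(f z)%:E|%E))//; last first.
    by apply: measurableT_comp.
  rewrite (eq_measure_integral (N01 \x N01)%E); last by move=> A mA _; exact: PE.
  by move/integrableP : ifp => [].
split => //.
transitivity (fine (\int[(N01 \x N01)%E]_z (f z)%:E)%E).
  congr fine; transitivity (\int[pushforward P X]_z (f z)%:E)%E.
    by rewrite (@integral_pushforward _ _ _ _ _ _ mX P setT (EFin \o f)).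
  by apply: eq_measure_integral => A mA _; exact: PE.
rewrite -(integral12_prod_meas1 ifp) /fubini_F /=.
have [j1 j2] := Rint_scale (\int[N01]_y k y) ih.
rewrite [RHS]mulrC -j2; congr fine; apply: eq_integral => x _.
have [l1 l2] := Rint_scale (h x) ik.
by rewrite mulrC -l2 -EFin_Rint.
Qed.

(** Cross terms vanish by independence and centering. The envelope separates [D i], which will carry
    the mean of the i-th coordinate, from a moment of the noise. *)
Lemma variance_sum (g : 'I_d -> R -> R) (D : 'I_d -> R) N :
  (forall i, measurable_fun setT (g i)) -> (forall i, 0 <= D i) ->
  (forall i e, `|g i e| <= D i * wt e ^+ N) ->
  (forall i, \int[N01]_e g i e = 0) ->
  P.-integrable setT (EFin \o (fun w => (\sum_i g i (eps i w)) ^+ 2)) /\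
  \int[P]_w ((\sum_i g i (eps i w)) ^+ 2) <= gmom R (N * 2) * \sum_i D i ^+ 2.
Proof.
move=> mg D0 gD g0.
have ig i : N01.-integrable setT (EFin \o g i).
  apply: (@integrable_le _ (measurableTypeR R) R N01 _ (fun e => D i * wt e ^+ N)).
  - exact: mg.
  - exact: gD.
  - by have [] := Rint_scale (D i) (integrable_wtX R N).
have ig2 i : N01.-integrable setT (EFin \o (fun e => g i e * g i e)) /\
    \int[N01]_e (g i e * g i e) <= gmom R (N * 2) * D i ^+ 2.
  have le2 e : `|g i e * g i e| <= D i ^+ 2 * wt e ^+ (N * 2).
    by rewrite normrM -expr2 exprM -exprMn lerXn2r// nnegrE mulr_ge0// exprn_ge0// wt_ge0.
  have [j k] := Rint_scale (D i ^+ 2) (integrable_wtX R (N * 2)).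
  have ii : N01.-integrable setT (EFin \o (fun e => g i e * g i e)).
    apply: (@integrable_le _ (measurableTypeR R) R N01 _
      (fun e => D i ^+ 2 * wt e ^+ (N * 2))) => //.
    by apply: measurable_funM; exact: mg.
  split => //; rewrite mulrC -k; apply: le_Rintegral => // e _.
  by rewrite (le_trans (ler_norm _)).
have ipair i j : P.-integrable setT (EFin \o (fun w => g i (eps i w) * g j (eps j w))) /\
   \int[P]_w (g i (eps i w) * g j (eps j w)) =
     if i == j then \int[N01]_e (g i e * g i e) else 0.
  have [->|ij] := eqVneq i j.
    have [j1 _] := ig2 j.
    by apply: (@law_int j (fun e => g j e * g j e)) => //; exact: measurable_funM.
  have [j1 j2] := law_pair ij (mg i) (mg j) (ig i) (ig j).
  by split => //; rewrite j2 g0 mul0r.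
have E : (fun w => (\sum_i g i (eps i w)) ^+ 2) =
   (fun w => \sum_i \sum_j (g i (eps i w) * g j (eps j w))).
  by apply/funext => w; rewrite expr2 big_distrlr.
have inner i := @Rint_sum _ _ _ P 'I_d (index_enum 'I_d)
  (fun j w => g i (eps i w) * g j (eps j w)) (fun j => (ipair i j).1).
have [r1 r2] := @Rint_sum _ _ _ P 'I_d (index_enum 'I_d)
  (fun i w => \sum_j (g i (eps i w) * g j (eps j w))) (fun i => (inner i).1).
rewrite E; split => //; rewrite r2 mulr_sumr; apply: ler_sum => i _.
rewrite (inner i).2 (bigD1 i)//= big1 => [|j ji].
  by rewrite (ipair i i).2 eqxx addr0; have [] := ig2 i.
by rewrite (ipair i j).2 eq_sym (negbTE ji).
Qed.

End iid.

(** * The product Gaussian measure on tuples *)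

Section gauss_tuple.
Variable R : realType.
Let rT := measurableTypeR R.
Notation mu := (@lebesgue_measure R).

Lemma lebesgue_tuple_sigma_finite n : sigma_finite setT (lebesgue_tuple R n).
Proof.
exists (fun k => [set z : n.-tuple rT | forall i, `[- k%:R, k%:R]%classic (tnth z i)]).
  apply/seteqP; split => // z _ /=.
  exists (\max_(i < n) Num.bound `|tnth z i|)%N => // i /=.
  rewrite in_itv/= -ler_norml.
  have h : (Num.bound `|tnth z i| <= \max_(j < n) Num.bound `|tnth z j|)%N.
    exact: leq_bigmax.
  rewrite (le_trans (ltW (archi_boundP (normr_ge0 _))))// ler_nat//.
move=> k; split.
  rewrite (_ : [set _ | _] = \bigcap_(i in [set: 'I_n])
      ((fun z : n.-tuple rT => tnth z i) @^-1` `[- k%:R, k%:R]%classic)).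
    apply: fin_bigcap_measurable => // i _; rewrite -[X in measurable X]setTI.
    by apply: measurable_tnth => //; exact: measurable_itv.
  by apply/seteqP; split => z /= h i; [move=> _|]; apply: h.
rewrite (@lebesgue_tuple_box R n (fun=> `[- k%:R, k%:R]%classic)); last first.
  by move=> i; exact: measurable_itv.
rewrite -ge0_fin_numE; last by apply: prode_ge0 => i _; exact: measure_ge0.
apply: prode_fin_num => i _.
by rewrite lebesgue_measure_itv/=; case: ifP.
Qed.

(* [lebesgue_tuple] as a plain set function, to which the structure of a
   sigma-finite measure can be attached. *)
Definition lebt n (A : set (n.-tuple rT)) : \bar R := lebesgue_tuple R n A.

HB.instance Definition _ n := isMeasure.Build _ _ _ (@lebt n)
  (measure0 (lebesgue_tuple R n)) (fun A => measure_ge0 (lebesgue_tuple R n) A)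
  (@measure_semi_sigma_additive _ _ _ (lebesgue_tuple R n)).

HB.instance Definition _ n := Measure_isSigmaFinite.Build _ _ _ (@lebt n)
  (lebesgue_tuple_sigma_finite n).

Lemma integral_lebt n (f : n.-tuple rT -> \bar R) :
  (\int[@lebt n]_z f z = \int[lebesgue_tuple R n]_z f z)%E.
Proof. by apply: eq_measure_integral. Qed.

(** The recursive measure is built from the product [\x^], while Tonelli's theorem is applied to the
    product [\x] with the sigma-finite [lebt]; uniqueness of the product measure identifies the
    two. *)
Lemma integral_lebesgue_tupleS n (f : n.+1.-tuple rT -> \bar R) :
  measurable_fun setT f -> (forall z, 0 <= f z)%E ->
  (\int[lebesgue_tuple R n.+1]_z f z =
   \int[lebesgue_tuple R n]_z \int[mu]_x f (tuple_cons (x, z)))%E.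
Proof.
move=> mf f0.
transitivity (\int[(mu \x^ lebesgue_tuple R n)%E]_p f (tuple_cons p))%E.
  rewrite /= /lebesgue_cons.
  by rewrite (ge0_integral_pushforward (@measurable_tuple_cons R n)).
have mg : measurable_fun setT (fun p => f (@tuple_cons R n p)).
  exact: (measurableT_comp mf (@measurable_tuple_cons R n)).
transitivity (\int[(mu \x @lebt n)%E]_p f (tuple_cons p))%E.
  apply: eq_measure_integral => A mA _; apply/esym.
  apply: (@product_measure_unique _ _ _ _ _ mu (@lebt n)
    (mu \x^ lebesgue_tuple R n)%E) => // B C mB mC.
  exact: (@product_measure2E _ _ _ _ R mu (lebesgue_tuple R n) B C mB mC).
by rewrite (@fubini_tonelli2 _ _ _ _ _ mu (@lebt n))// integral_lebt.
Qed.

Definition gden n (u z : n.-tuple R) : R := \prod_(j < n) phi (tnth z j - tnth u j).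

Lemma gden_ge0 n (u z : n.-tuple R) : 0 <= gden u z.
Proof. by apply: prodr_ge0 => j _; exact: phi_ge0. Qed.

Lemma measurable_prodR d (T : measurableType d) (I : Type) (s : seq I) (f : I -> T -> R) :
  (forall i, measurable_fun setT (f i)) ->
  measurable_fun setT (fun x => \prod_(i <- s) f i x).
Proof.
move=> mf; elim: s => [|i s IH].
  by rewrite (_ : (fun _ => _) = fun=> 1)//; apply/funext => x; rewrite big_nil.
rewrite (_ : (fun _ => _) = fun x => f i x * \prod_(j <- s) f j x).
  exact: measurable_funM.
by apply/funext => x; rewrite big_cons.
Qed.

Lemma mtnth n (i : 'I_n) : measurable_fun setT (fun z : n.-tuple rT => tnth z i : R).
Proof. exact: measurable_tnth. Qed.

Lemma measurable_gden n (u : n.-tuple R) : measurable_fun setT (gden u : n.-tuple rT -> R).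
Proof.
apply: measurable_prodR => j; apply: (measurableT_comp (@measurable_phi R)).
by apply: measurable_funB => //; exact: mtnth.
Qed.

(** The law of independent N(u_i, 1) coordinates; the product of densities in [Hhat] is its
    density. *)
Definition gmeas n (u : n.-tuple R) (A : set (n.-tuple rT)) : \bar R :=
  (\int[lebesgue_tuple R n]_(z in A) (gden u z)%:E)%E.

Section gmeas_measure.
Variables (n : nat) (u : n.-tuple R).

Let g0 : gmeas u set0 = 0%E. Proof. exact: integral_set0. Qed.
Let gge0 A : (0 <= gmeas u A)%E.
Proof. by apply: integral_ge0 => z _; rewrite lee_fin gden_ge0. Qed.
Let gsigma : semi_sigma_additive (gmeas u).
Proof.
move=> /= F mF tF mUF; rewrite /gmeas; apply: cvg_toP.
  apply: ereal_nondecreasing_is_cvgn => m k mk.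
  apply: lee_sum_nneg_natr => // j _ _.
  by apply: integral_ge0 => /= x _; rewrite lee_fin gden_ge0.
rewrite ge0_integral_bigcup//=.
- by apply/measurable_EFinP/measurable_funTS; exact: measurable_gden.
- by move=> x _; rewrite lee_fin gden_ge0.
Qed.
HB.instance Definition _ := isMeasure.Build _ _ _ (gmeas u) g0 gge0 gsigma.
End gmeas_measure.

Definition nbox (u : R) (A : set R) : \bar R := (\int[mu]_(x in A) (phi (x - u))%:E)%E.

Lemma nbox_ge0 u A : (0 <= nbox u A)%E.
Proof. by apply: integral_ge0 => x _; rewrite lee_fin phi_ge0. Qed.

Let mphiB u : measurable_fun setT (fun x : R => (phi (x - u))%:E).
Proof.
apply/measurable_EFinP; apply: (measurableT_comp (@measurable_phi R)).
exact: measurable_funB.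
Qed.

Lemma nbox_shift u (A : set rT) : measurable A ->
  nbox u [set x | A (x - u)] = N01 R A.
Proof.
move=> mA; rewrite N01E /normal_prob /nbox.
have mS : measurable [set x : rT | A (x - u)].
  rewrite -[X in measurable X]setTI.
  by apply: (@measurable_funB _ _ _ setT id (cst u)).
rewrite [LHS]integral_mkcond [RHS]integral_mkcond.
rewrite -[RHS](@ge0_integral_shift R (- u)); last 2 first.
- apply/(measurable_restrictT _ mA)/measurable_EFinP/measurable_funTS.
  exact: measurable_normal_pdf.
- by move=> x; apply: erestrict_ge0 => y _; rewrite lee_fin normal_pdf_ge0.
apply: eq_integral => x _; rewrite /patch.
have -> // : (x \in [set x0 | A (x0 - u)]) = (x - u \in A).
by apply/idP/idP; rewrite !inE.
Qed.

Lemma nboxT u : nbox u setT = 1%E.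
Proof.
by have := @nbox_shift u setT measurableT; rewrite probability_setT.
Qed.

(** Tonelli splits off the first coordinate, along which both the density and the indicator of the
    box factor. Boxes are all that independence and the marginal laws require. *)
Lemma gmeas_box n (u : n.-tuple R) (A : 'I_n -> set rT) :
  (forall i, measurable (A i)) ->
  gmeas u [set z | forall i, A i (tnth z i)] = (\prod_(i < n) nbox (tnth u i) (A i))%E.
Proof.
elim: n u A => [|n IH] u A mA.
  rewrite big_ord0 /gmeas (_ : [set _ | _] = setT); last first.
    by apply/seteqP; split => // z _ [].
  rewrite integral_dirac//= ?diracT ?mul1e; last first.
    by apply/measurable_EFinP; exact: measurable_gden.
  by rewrite /gden big_ord0.
have mB m (B : 'I_m -> set rT) : (forall i, measurable (B i)) ->
    measurable [set z : m.-tuple rT | forall i, B i (tnth z i)].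
  move=> hB; rewrite (_ : [set _ | _] = \bigcap_(i in [set: 'I_m])
      ((fun z : m.-tuple rT => tnth z i) @^-1` B i)).
    apply: fin_bigcap_measurable => // i _; rewrite -[X in measurable X]setTI.
    exact: measurable_tnth.
  by apply/seteqP; split => z /= h i; [move=> _|]; apply: h.
have mden m (v : m.-tuple R) := measurable_gden v.
rewrite big_ord_recl /gmeas integral_mkcond integral_lebesgue_tupleS; last 2 first.
- apply/(measurable_restrictT _ (mB _ _ mA))/measurable_EFinP/measurable_funTS.
  exact: mden.
- by move=> z; apply: erestrict_ge0 => y _; rewrite lee_fin gden_ge0.
pose u' := [tuple tnth u (lift ord0 i) | i < n].
rewrite (eq_bigr (fun i => nbox (tnth u' i) (A (lift ord0 i)))); last first.
  by move=> i _; rewrite tnth_mktuple.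
rewrite -(IH u' (fun i => A (lift ord0 i)))// /gmeas [in RHS]integral_mkcond.
rewrite -ge0_integralZl; last 4 first.
- exact: measurableT.
- apply/(measurable_restrictT _ (mB _ _ (fun i => mA (lift ord0 i))))/measurable_EFinP/measurable_funTS.
  exact: mden.
- by move=> z _; apply: erestrict_ge0 => y _; rewrite lee_fin gden_ge0.
- exact: nbox_ge0.
apply: eq_integral => z _; rewrite [RHS]muleC /nbox [in RHS]integral_mkcond.
have c0 : (0 <= ((fun z0 => (gden u' z0)%:E) \_
    [set z0 : n.-tuple rT | forall i, A (lift ord0 i) (tnth z0 i)]) z)%E.
  by apply: erestrict_ge0 => y _; rewrite lee_fin gden_ge0.
rewrite -ge0_integralZl; last 4 first.
- exact: measurableT.
- by apply/(measurable_restrictT _ (mA ord0))/measurable_funTS; exact: mphiB.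
- by move=> x _; apply: erestrict_ge0 => y _; rewrite lee_fin phi_ge0.
- exact: c0.
apply: eq_integral => x _; rewrite /patch.
have boxE : [set z0 : n.+1.-tuple rT | forall i, A i (tnth z0 i)] (tuple_cons (x, z)) <->
   A ord0 x /\ [set z0 : n.-tuple rT | forall i, A (lift ord0 i) (tnth z0 i)] z.
  split => /=.
    move=> h; split; first exact: (h ord0).
    by move=> i; have := h (lift ord0 i); rewrite /tuple_cons tnthS.
  move=> [h0 h] i; case: (unliftP ord0 i) => [j|] ->; last exact: h0.
  by rewrite /tuple_cons tnthS; exact: h.
have denE : gden u (tuple_cons (x, z)) = gden u' z * phi (x - tnth u ord0).
  rewrite /gden big_ord_recl mulrC; congr (_ * _).
  by apply: eq_bigr => i _; rewrite tnth_mktuple /tuple_cons tnthS.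
case: ifPn => [/set_mem/boxE[h0 h]|].
  by rewrite mem_set// mem_set// denE EFinM.
rewrite notin_setE => nb; case: ifPn => [/set_mem h|]; last by rewrite mul0e.
case: ifPn => [/set_mem h0|]; last by rewrite mule0.
by exfalso; apply: nb; apply/boxE.
Qed.

Lemma gmeasT n (u : n.-tuple R) : gmeas u setT = 1%E.
Proof.
have -> : [set: n.-tuple rT] = [set z | forall i : 'I_n, [set: rT] (tnth z i)].
  by apply/seteqP; split.
rewrite (@gmeas_box n u (fun=> setT))//.
by rewrite big1// => i _; exact: nboxT.
Qed.

HB.instance Definition _ n (u : n.-tuple R) :=
  @Measure_isProbability.Build _ _ R (gmeas u) (gmeasT u).

(** Hence whatever is proved about noise on an abstract probability space, concentration in
    particular, also holds on tuples under [gmeas u], with the residuals as noise. *)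
Lemma gmeas_iid n (u : n.-tuple R) :
  iid_std_normal (gmeas u : probability _ _)
    (fun i (z : n.-tuple rT) => tnth z i - tnth u i).
Proof.
have me (i : 'I_n) : measurable_fun setT (fun z : n.-tuple rT => tnth z i - tnth u i : rT).
  by apply: measurable_funB => //; exact: mtnth.
have mS (v : R) (A : set rT) : measurable A -> measurable [set x : rT | A (x - v)].
  move=> mA; rewrite -[X in measurable X]setTI.
  by apply: (@measurable_funB _ _ _ setT id (cst v)).
have one i (A : set rT) : measurable A ->
    gmeas u [set z | A (tnth z i - tnth u i)] = N01 R A.
  move=> mA.
  pose B (k : 'I_n) : set rT := if k == i then [set x | A (x - tnth u i)] else setT.
  have -> : [set z : n.-tuple rT | A (tnth z i - tnth u i)] =
      [set z | forall k, B k (tnth z k)].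
    apply/seteqP; split => z /= h; last by have := h i; rewrite /B eqxx.
    by move=> k; rewrite /B; case: eqP => [->|].
  rewrite gmeas_box; last by move=> k; rewrite /B; case: ifP => // _; exact: mS.
  rewrite (bigD1 i)//= big1 => [|k ki]; last by rewrite /B (negbTE ki) nboxT.
  by rewrite mule1 /B eqxx nbox_shift.
split => //.
move=> A mA.
  have := @gmeas_box n u (fun i => [set x | A i (x - tnth u i)]) (fun i => mS _ _ (mA i)).
  move=> /= ->; apply: eq_bigr => i _; rewrite nbox_shift; last exact: mA.
  by apply/esym; apply: one; exact: mA.
Qed.

Lemma ge0_integral_gmeas n (u : n.-tuple R) (f : n.-tuple rT -> \bar R) :
  measurable_fun setT f -> (forall z, 0 <= f z)%E ->
  (\int[gmeas u]_z f z = \int[lebesgue_tuple R n]_z (f z * (gden u z)%:E))%E.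
Proof.
move=> mf f0.
rewrite -integral_lebt.
apply: (@ge0_integral_density _ _ _ (gmeas u) (@lebt n)) => //.
- apply/null_content_dominatesP => A mA A0.
  apply: (@null_set_integral _ _ _ (lebesgue_tuple R n)) => //.
  by apply/measurable_EFinP/measurable_funTS; exact: measurable_gden.
- by apply/measurable_EFinP; exact: measurable_gden.
- by move=> z; rewrite lee_fin gden_ge0.
Qed.

(** Positive and negative parts are transferred separately, so that integrability of [f] need not be
    known beforehand. *)
Lemma integral_gmeas n (u : n.-tuple R) (f : n.-tuple rT -> R) :
  measurable_fun setT f ->
  (\int[lebesgue_tuple R n]_z (f z * gden u z)%:E = \int[gmeas u]_z (f z)%:E)%E.
Proof.
move=> mf; have mf' : measurable_fun setT (EFin \o f) by exact/measurable_EFinP.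
rewrite [LHS]integralE [RHS]integralE.
rewrite (@ge0_integral_gmeas n u (EFin \o f)^\+%E); last 2 first.
  exact: measurable_funepos.
  by move=> z; exact: funepos_ge0.
rewrite (@ge0_integral_gmeas n u (EFin \o f)^\-%E); last 2 first.
  exact: measurable_funeneg.
  by move=> z; exact: funeneg_ge0.
have e (x y : R) : 0 <= y -> (maxe (x * y)%:E 0 = maxe x%:E 0 * y%:E)%E.
  move=> y0; rewrite -!EFin_max -EFinM; congr EFin.
  by have [x0|x0] := leP 0 x; [rewrite max_l// mulr_ge0|rewrite max_r ?mul0r// mulr_le0_ge0// ltW].
rewrite (eq_integral (fun z => ((EFin \o f)^\+ z * (gden u z)%:E)%E)); last first.
  by move=> z _; rewrite !funeposE /= e ?gden_ge0.
rewrite [X in (_ - X)%E](eq_integral (fun z => ((EFin \o f)^\- z * (gden u z)%:E)%E))//.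
move=> z _; rewrite !funenegE /=.
by rewrite -[RHS](e (- f z)) ?gden_ge0// mulNr.
Qed.

End gauss_tuple.

(** * Functionals of summaries *)

Section functional.
Context {R : realType} {q : nat}.
Implicit Types (f : 'rV[R]_q -> R) (s v : 'rV[R]_q).

Lemma diff_partial f s v : differentiable f s ->
  'd f s v = \sum_j v 0 j * partial f j s.
Proof.
move=> df; rewrite {1}(row_sum_delta v) linear_sum; apply: eq_bigr => j _.
by rewrite linearZ /= /partial deriveE.
Qed.

Lemma norm_partial_le f j s : `|partial f j s| <= norm2 (grad f s).
Proof.
rewrite /norm2 -sqrtr_sqr ler_sqrt; last by apply: sumr_ge0 => i _; exact: sqr_ge0.
by rewrite (bigD1 j)//= mxE lerDl; apply: sumr_ge0 => i _; exact: sqr_ge0.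
Qed.

Lemma is_derive_line f s v x : differentiable f (x *: v + s) ->
  is_derive (x : R) 1 (fun x : R => f (x *: v + s)) ('d f (x *: v + s) v).
Proof.
move=> df; have E : (fun h : R => h^-1 *: (((fun x : R => f (x *: v + s)) \o shift x) (h *: (1 : R))
     - f (x *: v + s))) =
   (fun h : R => h^-1 *: ((f \o shift (x *: v + s)) (h *: v) - f (x *: v + s))).
  apply/funext => h /=; congr (_ *: (f _ - _)).
  by rewrite scalerDl /GRing.scale /= mulr1 addrA.
split.
- by rewrite /derivable E; exact: diff_derivable.
- by rewrite /derive E -deriveE.
Qed.

(** The mean value theorem along the segment from [s'] to [s]; each partial derivative is at most
    the norm of the gradient. *)
Lemma grad_lipschitz f L : (forall s, differentiable f s) ->
  (forall s, norm2 (grad f s) <= L) ->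
  forall s s', `|f s - f s'| <= L * \sum_j `|s 0 j - s' 0 j|.
Proof.
move=> df gL s s'.
pose g (x : R) := f (x *: (s - s') + s').
have dg (x : R) : is_derive x 1 g ('d f (x *: (s - s') + s') (s - s')).
  exact: is_derive_line.
have [|c _] := @MVT R g _ 0 1 ltr01 (fun x _ => dg x).
  by apply: derivable_within_continuous => x _; have [] := dg x.
rewrite subr0 mulr1 /g /= scale1r scale0r subrK add0r => ->.
rewrite diff_partial//; apply: le_trans (ler_norm_sum _ _ _) _.
rewrite mulr_sumr; apply: ler_sum => j _; rewrite normrM mulrC !mxE.
by apply: ler_wpM2r => //; apply: le_trans (norm_partial_le _ _ _) (gL _).
Qed.

End functional.

Section measurable_continuous.
Context {R : realType} {q : nat} d (T : measurableType d).

Lemma measurable_setprop (Q : Prop) : measurable [set w : T | Q].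
Proof.
have [h|h] := pselect Q.
  by rewrite (_ : [set _ | _] = setT)//; apply/seteqP; split.
by rewrite (_ : [set _ | _] = set0)//; apply/seteqP; split.
Qed.

(* Row vectors carry no sigma-algebra: [f] is approximated by its values at
   the countably many points of the grids [Z^q / n]. *)
Lemma measurable_continuous_row (f : 'rV[R]_q -> R) (X : 'I_q -> T -> R) :
  continuous f -> (forall j, measurable_fun setT (X j)) ->
  measurable_fun setT (fun w => f (\row_j X j w)).
Proof.
move=> cf mX.
pose h n w := f (\row_j ((Num.floor (n.+1%:R * X j w))%:~R / n.+1%:R)).
apply: (@measurable_fun_cvg _ _ _ _ h) => [n|w _].
- move=> _ B mB; rewrite setTI.
  have -> : h n @^-1` B = \bigcup_(k in [set: 'rV[int]_q])
      ((\bigcap_(j in [set: 'I_q])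
       (fun w => n.+1%:R * X j w) @^-1` `[(k 0 j)%:~R, (k 0 j + 1)%:~R[%classic)
       `&` [set w | B (f (\row_j ((k 0 j)%:~R / n.+1%:R)))]).
    apply/seteqP; split=> w /=.
      move=> Bw; exists (\row_j Num.floor (n.+1%:R * X j w)) => //; split.
        move=> j _ /=; rewrite !mxE in_itv /=.
        exact: floor_itv.
      move: Bw; rewrite /h; congr (B (f _)).
      by apply/rowP => j; rewrite !mxE.
    move=> [k _ [hk Bk]]; rewrite /h; move: Bk; congr (B (f _)).
    apply/rowP => j; rewrite !mxE; congr (_%:~R / _).
    have /= := hk j Logic.I; rewrite in_itv /= => hkj.
    by apply/esym; apply/floor_def.
  apply: countable_bigcupT_measurable => [|k].
    exact: countableP.
  apply: measurableI; last exact: measurable_setprop.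
  apply: fin_bigcap_measurable => // j _; rewrite -[X in measurable X]setTI.
  by apply: measurable_funM => //.
- apply: (@cvg_comp _ _ _ (fun n : nat => \row_j ((Num.floor (n.+1%:R * X j w))%:~R / n.+1%:R : R)) f
    _ (nbhs (\row_j X j w : 'rV[R]_q))); last exact: cf.
  apply/cvgrPdist_le => /= e e0.
  near=> n.
  rewrite /Num.Def.normr/= mx_normrE (bigmax_le _ (ltW e0))//= => i _.
  rewrite !mxE.
  have n0 : 0 < n.+1%:R :> R by [].
  have -> : X i.2 w - (Num.floor (n.+1%:R * X i.2 w))%:~R / n.+1%:R =
     n.+1%:R^-1 * (n.+1%:R * X i.2 w - (Num.floor (n.+1%:R * X i.2 w))%:~R).
    by field; rewrite addrC natr1.
  have /andP[h1 h2] := floor_itv (n.+1%:R * X i.2 w).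
  rewrite intrD in h2.
  rewrite normrM ger0_norm ?invr_ge0// (ger0_norm (_ : 0 <= _ - _)) ?subr_ge0//.
  apply: (@le_trans _ _ n.+1%:R^-1).
    by rewrite ler_piMr ?invr_ge0// lerBlDl ltW.
  by apply: ltW; near: n; exact: (near_infty_natSinv_lt (PosNum e0)).
Unshelve. all: by end_near. Qed.

End measurable_continuous.

Section chain.
Context {R : realType} {q : nat} (psi : 'I_q -> R -> R).
Hypothesis dpsi : forall j x, derivable (psi j) x 1.
Variable (f : 'rV[R]_q -> R).
Hypothesis df : forall s, differentiable f s.

(** Only the i-th summand of each average moves. The resulting factor [d%:R^-1] makes the derivative
    terms of [Hhat] O(1) in total instead of O(d). *)
Lemma derive_functional d (z : d.-tuple R) (i : 'I_d) :
  derive1 (fun x => f (summary psi (set_coord z i x))) (tnth z i) =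
  d%:R^-1 * \sum_j partial f j (summary psi z) * derive1 (psi j) (tnth z i).
Proof.
set x0 := tnth z i.
pose g (x : R) := summary psi (set_coord z i x).
have gx0 : g x0 = summary psi z.
  rewrite /g; congr summary; apply: eq_from_tnth => j; rewrite tnth_mktuple.
  by case: eqP => [->|].
have dg j : is_derive x0 1 (fun x => g x 0 j) (d%:R^-1 * derive1 (psi j) x0).
  rewrite (_ : (fun x => g x 0 j) = (fun x => d%:R^-1 * (psi j x +
     \sum_(k < d | k != i) psi j (tnth z k)))).
    have hd' : is_derive x0 1 (psi j) (derive1 (psi j) x0).
      by rewrite derive1E; apply: derivableP; exact: dpsi.
    apply: is_derive_eq.
    by rewrite /GRing.scale/= addr0.
  apply/funext => x; rewrite mxE (bigD1 i)//= tnth_mktuple eqxx.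
  congr (_ * (_ + _)); apply: eq_bigr => k /negbTE ki.
  by rewrite tnth_mktuple ki.
have derg : derivable g x0 1.
  apply/derivable_mxP => a j; rewrite ord1; by have [] := dg j.
rewrite derive1E deriveE; last first.
  by apply: differentiable_comp => //; exact/derivable1_diffP.
rewrite (@diff_comp _ _ _ _ g f)//; last exact/derivable1_diffP.
rewrite /= diff_partial// gx0 mulr_sumr; apply: eq_bigr => j _.
rewrite -deriveE; last exact/derivable1_diffP.
rewrite derive_mx// mxE; have [_ ->] := dg j.
by rewrite -mulrA [X in _ * X]mulrC.
Qed.

End chain.

Lemma measurable_powR2 {R : realType} d (T : measurableType d) (X C : T -> R) :
  measurable_fun setT X -> measurable_fun setT C ->
  measurable_fun setT (fun w => X w `^ C w).
Proof.
move=> mX mC; rewrite /powR.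
apply: measurable_fun_ifT => //=.
- apply: (measurable_fun_eqr mX); exact: measurable_cst.
- apply: measurable_boolR. apply: (measurable_fun_eqr mC); exact: measurable_cst.
- apply: measurableT_comp => //; apply: measurable_funM => //.
  exact: measurableT_comp.
Qed.

(** * Averages over coordinates and concentration of the summaries *)

Section average.
Context {R : realType}.

Definition avg d (F : 'I_d -> R) : R := d%:R^-1 * \sum_i F i.

Lemma ler_avg d (F F' : 'I_d -> R) : (forall i, F i <= F' i) -> avg F <= avg F'.
Proof. by move=> h; rewrite ler_wpM2l ?invr_ge0// ler_sum. Qed.

Lemma avg_ge0 d (F : 'I_d -> R) : (forall i, 0 <= F i) -> 0 <= avg F.
Proof. by move=> h; rewrite mulr_ge0 ?invr_ge0// sumr_ge0. Qed.

Lemma avgD d (F F' : 'I_d -> R) : avg (fun i => F i + F' i) = avg F + avg F'.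
Proof. by rewrite /avg big_split mulrDr. Qed.

Lemma avgB d (F F' : 'I_d -> R) : avg (fun i => F i - F' i) = avg F - avg F'.
Proof. by rewrite /avg sumrB mulrBr. Qed.

Lemma avgZ d (k : R) (F : 'I_d -> R) : avg (fun i => k * F i) = k * avg F.
Proof. by rewrite /avg -mulr_sumr mulrCA. Qed.

Lemma norm_avg_le d (F : 'I_d -> R) : `|avg F| <= avg (fun i => `|F i|).
Proof.
by rewrite /avg normrM ger0_norm ?invr_ge0// ler_wpM2l ?invr_ge0// ler_norm_sum.
Qed.

Lemma avg_cst d (k : R) : (0 < d)%N -> avg (fun _ : 'I_d => k) = k.
Proof.
by move=> d0; rewrite /avg sumr_const card_ord -[k *+ d]mulr_natl mulKf// pnatr_eq0 -lt0n.
Qed.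

Lemma sqr_sum_le q (a : 'I_q -> R) : (\sum_j a j) ^+ 2 <= q%:R * \sum_j a j ^+ 2.
Proof.
rewrite expr2 mulr_suml.
apply: (@le_trans _ _ (\sum_i \sum_j (a i ^+ 2 / 2 + a j ^+ 2 / 2))).
  apply: ler_sum => i _; rewrite mulr_sumr; apply: ler_sum => j _.
  by have := sqr_ge0 (a i - a j); rewrite sqrrB; lra.
under eq_bigr do rewrite big_split /= sumr_const card_ord.
rewrite big_split /= sumr_const card_ord -sumrMnl -big_split /=.
rewrite mulr_sumr ler_sum// => i _.
by rewrite -mulrnDl -splitr mulr_natl.
Qed.

End average.

Section concentration.
Context {R : realType} {q : nat} (psi : 'I_q -> R -> R).
Notation N01 := (N01 R).

Definition psi_tame (C : R) (N : nat) :=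
  [/\ forall j x, derivable (psi j) x 1, forall j, continuous (derive1 (psi j)) &
    forall j x, `|psi j x| <= C * wt x ^+ N /\ `|derive1 (psi j) x| <= C * wt x ^+ N].

(** What the proof uses of an extended function. The bound concerns the absolute value because an
    extension may leave [[0, ub]]; this is why the estimates allow every [c] with [|c| <= b],
    negative ones included. *)
Definition tame (L b : R) (f : 'rV[R]_q -> R) :=
  [/\ C1_on setT f, forall s, `|f s| <= b & forall s, norm2 (grad f s) <= L].

Variables (C : R) (N : nat).
Hypothesis C0 : 0 <= C.
Hypothesis hpsi : psi_tame C N.

Lemma psi_measurable j : measurable_fun setT (psi j).
Proof.
apply: continuous_measurable_fun => x.
have [h _ _] := hpsi; have := h j x => /derivable1_diffP; exact: differentiable_continuous.
Qed.

Lemma psi_shift_le j u e : `|psi j (u + e)| <= C * wt u ^+ N * wt e ^+ N.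
Proof.
have [_ _ /(_ j (u + e))[h _]] := hpsi.
apply: le_trans h _; rewrite -mulrA -exprMn ler_wpM2l// lerXn2r ?nnegrE ?mulr_ge0 ?wt_ge0//.
exact: wtD.
Qed.

Lemma psi_integrable j u : N01.-integrable setT (EFin \o (fun e => psi j (u + e))).
Proof.
apply: (@integrable_le _ (measurableTypeR R) R N01 _ (fun e => C * wt u ^+ N * wt e ^+ N)).
- apply: (measurableT_comp (psi_measurable j)).
  by apply: measurable_funD => //; exact: measurable_cst.
- by move=> e; exact: psi_shift_le.
- by have [] := Rint_scale (C * wt u ^+ N) (integrable_wtX R N).
Qed.

Definition pmean j u : R := \int[N01]_e psi j (u + e).

Lemma norm_pmean j u : `|pmean j u| <= C * gmom R N * wt u ^+ N.
Proof.
have [i1 e1] := Rint_scale (C * wt u ^+ N) (integrable_wtX R N).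
apply: (le_trans (le_normr_Rintegral measurableT (psi_integrable j u))).
rewrite mulrAC -e1; apply: le_Rintegral => //; first by have := integrable_norm (psi_integrable j u).
by move=> e _; exact: psi_shift_le.
Qed.

Definition emean d (u : d.-tuple R) : 'rV[R]_q := \row_j avg (fun i => pmean j (tnth u i)).

Lemma psi_lip j x y : `|psi j x - psi j y| <= C * (wt x * wt y) ^+ N * `|x - y|.
Proof.
wlog xy : x y / y < x.
  move=> h; have [xy|yx|->] := ltgtP x y; last by rewrite !subrr normr0 mulr0.
    by rewrite distrC (distrC x) (mulrC (wt x)); exact: h.
  exact: h.
have [dp _ gp] := hpsi.
have [||c cin ->] := @MVT R (psi j) (derive1 (psi j)) y x xy.
- by move=> z _; rewrite derive1E; apply: derivableP; exact: dp.
- by apply: derivable_within_continuous => z _; exact: dp.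
rewrite normrM ler_wpM2r//; have [_ h] := gp j c; apply: le_trans h _.
rewrite ler_wpM2l// lerXn2r ?nnegrE ?mulr_ge0 ?wt_ge0//.
have wxy : wt c <= Num.max (wt x) (wt y).
  rewrite /wt le_max !lerD2l; move: cin; rewrite in_itv /= => /andP[c1 c2].
  have [c0|c0] := leP 0 c.
    by rewrite (ger0_norm c0) (le_trans (ltW c2)) ?ler_norm.
  by rewrite (ltr0_norm c0) [`|y|]ltr0_norm ?(lt_trans c1)// lerN2 (ltW c1) orbT.
apply: le_trans wxy _; rewrite ge_max.
by rewrite ler_peMr ?ler_peMl ?wt_ge0 ?wt_ge1.
Qed.

Lemma pmean_lip j u v :
  `|pmean j u - pmean j v| <= C * gmom R (N + N) * (wt u * wt v) ^+ N * `|u - v|.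
Proof.
pose k := C * (wt u * wt v) ^+ N * `|u - v|.
have [i1 e1] := Rint_scale k (integrable_wtX R (N + N)).
have := Rint_absB (psi_integrable j u) (psi_integrable j v) i1.
rewrite e1 => h; apply: le_trans (h _) _; last by rewrite /k -/(gmom _ _); lra.
move=> e; apply: le_trans (psi_lip _ _ _) _.
have -> : u + e - (v + e) = u - v by ring.
rewrite /k (mulrAC _ `|u - v|) ler_wpM2r// -mulrA ler_wpM2l// exprD -!exprMn.
rewrite lerXn2r ?nnegrE ?mulr_ge0 ?wt_ge0//.
have -> : wt u * wt v * (wt e * wt e) = (wt u * wt e) * (wt v * wt e) by ring.
by apply: ler_pM; rewrite ?wt_ge0 ?wtD.
Qed.

(** The local Lipschitz constant in [pmean_lip] grows polynomially, while [u] and [v] will be close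
    in mean square only; AM-GM separates the weight from the distance. *)
Lemma emean_mod eta : 0 < eta -> exists2 M : R, 0 <= M &
  forall d (u v : d.-tuple R) j,
    `|emean u 0 j - emean v 0 j| <=
    eta * avg (fun i => (wt (tnth u i) * wt (tnth v i)) ^+ (N * 2)) +
    M * avg (fun i => (tnth u i - tnth v i) ^+ 2).
Proof.
move=> e0; pose k := C * gmom R (N + N).
have k0 : 0 <= k by rewrite mulr_ge0// (le_trans _ (gmom_ge1 _ _)).
pose e1 := eta / (k + 1).
have e10 : 0 < e1 by rewrite divr_gt0// ltr_wpDl.
exists (k * (1 / e1)) => [|d u v j]; first by rewrite mulr_ge0// divr_ge0// ltW.
rewrite !mxE -avgB; apply: le_trans (norm_avg_le _) _.
rewrite -!avgZ -avgD; apply: ler_avg => i.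
apply: le_trans (pmean_lip _ _ _) _; rewrite -/k.
set W := wt _ * wt _; set D := tnth u i - tnth v i.
have := @amgm_eta R (2 * e1) `|D| (W ^+ N).
rewrite -exprM (real_normK (num_real D)) => h.
have h1 : `|D| * W ^+ N <= e1 / 2 * W ^+ (N * 2) + 1 / e1 * D ^+ 2.
  have e1n : e1 != 0 by rewrite gt_eqF.
  have := h (mulr_gt0 (ltr0Sn _ 1) e10).
  have -> : 2 * e1 / 2 = e1 by field.
  have -> : 2 / (2 * e1) = 1 / e1 by field.
  have := sqr_ge0 D; have : 0 <= 1 / e1 by rewrite divr_ge0// ltW.
  by nra.
have h2 : k * (e1 / 2) <= eta.
  have -> : eta = k * e1 + e1 by rewrite /e1 -[X in _ + X]mul1r -mulrDl mulrC divfK// gt_eqF// ltr_wpDl.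
  apply: (@le_trans _ _ (k * e1)); last by rewrite lerDl ltW.
  by rewrite ler_wpM2l// ler_pdivrMr// mulrDr mulr1 lerDl ltW.
have W0 : 0 <= W ^+ (N * 2) by rewrite exprn_ge0// mulr_ge0 ?wt_ge0.
rewrite -mulrA [W ^+ N * _]mulrC.
apply: le_trans (ler_wpM2l k0 h1) _.
by rewrite mulrDr (mulrA k) (mulrA k (1 / e1)) lerD2r ler_wpM2r.
Qed.

Section variance.
Context disp (Omega : measurableType disp) (P : probability Omega R).
Variables (d : nat) (eps : 'I_d -> Omega -> R) (u : d.-tuple R).
Hypothesis hiid : iid_std_normal P eps.

Lemma measurable_summary_comp (g : 'rV[R]_q -> R) : continuous g ->
  measurable_fun setT (fun w => g (summary psi (observation u eps w))).
Proof.
move=> cg; have [me _ _] := hiid.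
apply: (measurable_continuous_row (X := fun m w =>
  d%:R^-1 * \sum_(i < d) psi m (tnth (observation u eps w) i))) => // j.
apply: measurable_funM => //; apply: measurable_sum => i.
rewrite (_ : (fun _ => _) = (fun w => psi j (tnth u i + eps i w))); last first.
  by apply/funext => w; rewrite tnth_mktuple.
apply: (measurableT_comp (psi_measurable j)).
by apply: measurable_funD => //; exact: measurable_cst.
Qed.

Lemma summary_variance :
  let s w := summary psi (observation u eps w) in
  P.-integrable setT (EFin \o (fun w => \sum_j (s w 0 j - emean u 0 j) ^+ 2)) /\
  \int[P]_w (\sum_j (s w 0 j - emean u 0 j) ^+ 2) <=
  q%:R * (2 * C * gmom R N) ^+ 2 * gmom R (N * 2) / d%:R *
    avg (fun i => wt (tnth u i) ^+ (N * 2)).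
Proof.
move=> s.
pose g j i e := psi j (tnth u i + e) - pmean j (tnth u i).
(* The 2 accounts for [psi] and its mean, each bounded by half the envelope because weights and
   moments are at least 1. *)
pose D i := 2 * C * gmom R N * wt (tnth u i) ^+ N.
have g1 : 1 <= gmom R N := gmom_ge1 R N.
have g0 : 0 <= gmom R N := le_trans ler01 g1.
have D0 i : 0 <= D i by rewrite !mulr_ge0// exprn_ge0// wt_ge0.
have gD j i e : `|g j i e| <= D i * wt e ^+ N.
  apply: le_trans (ler_normB _ _) _.
  apply: le_trans (lerD (psi_shift_le _ _ _) (norm_pmean _ _)) _.
  have h1 := wtX_ge1 e N; have h2 := wtX_ge1 (tnth u i) N.
  rewrite /D.
  have CW : 0 <= C * wt (tnth u i) ^+ N by rewrite mulr_ge0// (le_trans ler01).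
  have -> : 2 * C * gmom R N * wt (tnth u i) ^+ N * wt e ^+ N =
    C * wt (tnth u i) ^+ N * (gmom R N * wt e ^+ N + gmom R N * wt e ^+ N) by ring.
  have -> : C * wt (tnth u i) ^+ N * wt e ^+ N + C * gmom R N * wt (tnth u i) ^+ N =
    C * wt (tnth u i) ^+ N * (wt e ^+ N + gmom R N) by ring.
  rewrite ler_wpM2l// lerD//.
    by rewrite ler_peMl// (le_trans ler01).
  by rewrite ler_peMr.
have mg j i : measurable_fun setT (g j i).
  apply: measurable_funB; last exact: measurable_cst.
  apply: (measurableT_comp (psi_measurable j)).
  by apply: measurable_funD => //; exact: measurable_cst.
have g00 j i : \int[N01]_e g j i e = 0.
  have ic : N01.-integrable setT (EFin \o (fun=> pmean j (tnth u i))).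
    by apply: finite_measure_integrable_cst.
  have [_ ->] := Rint_sub (psi_integrable j (tnth u i)) ic.
  rewrite [X in _ - X](_ : _ = pmean j (tnth u i)) ?subrr//.
  by rewrite Rintegral_cst// -[fine _]/(fine (N01 setT)) probability_setT mulr1.
have hv j := variance_sum hiid (mg j) D0 (gD j) (g00 j).
have sE w j : s w 0 j - emean u 0 j = d%:R^-1 * \sum_i g j i (eps i w).
  rewrite !mxE -mulrBr -sumrB; congr (_ * _); apply: eq_bigr => i _.
  by rewrite tnth_mktuple.
have hi j := Rint_scale (d%:R^-1 ^+ 2) (hv j).1.
have [hs1 hs2] := Rint_sum (index_enum 'I_q) (fun j => (hi j).1).
have E : (fun w => \sum_j (s w 0 j - emean u 0 j) ^+ 2) =
    (fun w => \sum_j (d%:R^-1 ^+ 2 * (\sum_i g j i (eps i w)) ^+ 2)).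
  by apply/funext => w; apply: eq_bigr => j _; rewrite sE exprMn.
rewrite E; split => //; rewrite hs2.
apply: (@le_trans _ _ (\sum_(j < q) (d%:R^-1 ^+ 2 * (gmom R (N * 2) * \sum_i D i ^+ 2)))).
  by apply: ler_sum => j _; rewrite (hi j).2 ler_wpM2l ?sqr_ge0//; exact: (hv j).2.
rewrite sumr_const card_ord -[_ *+ q]mulr_natl.
under eq_bigr do rewrite /D exprMn -exprM.
rewrite -mulr_sumr /avg.
by set x := \sum_(_ | _) _; set y := d%:R^-1; rewrite le_eqVlt; apply/orP; left; apply/eqP; ring.
Qed.

End variance.

Section lipschitz.
Variables (L b : R) (f : 'rV[R]_q -> R).
Hypothesis hf : tame L b f.

Lemma tame_lip s s' : `|f s - f s'| <= L * \sum_j `|s 0 j - s' 0 j|.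
Proof.
have [[h _] _ g] := hf; apply: grad_lipschitz => // x; exact: h.
Qed.

Lemma tame_lip_le (s s' : 'rV[R]_q) (e : R) : (forall j, `|s 0 j - s' 0 j| <= e) ->
  `|f s - f s'| <= `|L| * q%:R * e.
Proof.
move=> h; apply: (le_trans (tame_lip s s')).
have L0 : 0 <= L by have [_ _ /(_ s)] := hf; apply: le_trans; exact: sqrtr_ge0.
rewrite (ger0_norm L0) -mulrA ler_wpM2l// mulr_natl -[in leRHS](card_ord q) -sumr_const.
by apply: ler_sum => j _; exact: h.
Qed.

Lemma tame_lip2 s s' : (f s - f s') ^+ 2 <= L ^+ 2 * q%:R * \sum_j (s 0 j - s' 0 j) ^+ 2.
Proof.
have h := tame_lip s s'; rewrite -(real_normK (num_real _)).
apply: (@le_trans _ _ ((L * \sum_j `|s 0 j - s' 0 j|) ^+ 2)).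
  by rewrite lerXn2r ?nnegrE// (le_trans _ h).
rewrite exprMn -mulrA ler_wpM2l ?sqr_ge0//.
apply: le_trans (sqr_sum_le _) _; rewrite ler_wpM2l//.
by apply: ler_sum => j _; rewrite real_normK// num_real.
Qed.

Lemma tame_continuous : continuous f.
Proof. by have [[h _] _ _] := hf => s; apply: differentiable_continuous; exact: h. Qed.

Context disp (Omega : measurableType disp) (P : probability Omega R).
Variables (d : nat) (eps : 'I_d -> Omega -> R) (u : d.-tuple R).
Hypothesis hiid : iid_std_normal P eps.

Lemma concentration :
  P.-integrable setT (EFin \o (fun w =>
    (f (summary psi (observation u eps w)) - f (emean u)) ^+ 2)) /\
  \int[P]_w ((f (summary psi (observation u eps w)) - f (emean u)) ^+ 2) <=
  L ^+ 2 * q%:R * (q%:R * (2 * C * gmom R N) ^+ 2 * gmom R (N * 2) / d%:R *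
    avg (fun i => wt (tnth u i) ^+ (N * 2))).
Proof.
have [v1 v2] := summary_variance u hiid.
pose k := L ^+ 2 * q%:R.
have k0 : 0 <= k by rewrite mulr_ge0// sqr_ge0.
have [ht1 ht2] := Rint_scale k v1.
have ii : P.-integrable setT (EFin \o (fun w =>
    (f (summary psi (observation u eps w)) - f (emean u)) ^+ 2)).
  apply: (integrable_le _ _ ht1) => [|w]; last by rewrite ger0_norm ?sqr_ge0 ?tame_lip2.
  apply: measurable_funX; apply: measurable_funB => //.
  exact: (measurable_summary_comp u hiid tame_continuous).
split => //; apply: le_trans _ (ler_wpM2l k0 v2); rewrite -ht2.
by apply: le_Rintegral => // w _; exact: tame_lip2.
Qed.

End lipschitz.
End concentration.

(** * The risk and its approximation *)

Lemma archi_le {R : realType} (x e : R) : 0 < e ->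
  exists D0 : nat, forall d, (D0 <= d)%N -> x <= e * d%:R.
Proof.
move=> e0; exists (Num.truncn (`|x| / e)).+1 => d hd.
have h1 : `|x| / e < (Num.truncn (`|x| / e)).+1%:R by exact: truncnS_gt.
have h2 : (Num.truncn (`|x| / e)).+1%:R <= d%:R :> R by rewrite ler_nat.
have := lt_le_trans h1 h2; rewrite ltr_pdivrMr// mulrC => h3.
by rewrite (le_trans (ler_norm _)) ?ltW.
Qed.

Section small.
Context {R : realType} {q : nat} (psi : 'I_q -> R -> R).
Variables (C : R) (N : nat).
Hypothesis C0 : 0 <= C.
Hypothesis hpsi : psi_tame psi C N.
Variables (L b : R).

(** [delta] is uniform in [f], which will be selected by the data. *)
Lemma emean_close eta K : 0 < eta -> 0 <= K -> exists2 delta : R, 0 < delta &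
  forall (f : 'rV[R]_q -> R) d (u v : d.-tuple R), tame L b f ->
    avg (fun i => (wt (tnth u i) * wt (tnth v i)) ^+ (N * 2)) <= K ->
    avg (fun i => (tnth u i - tnth v i) ^+ 2) <= delta ->
    (f (emean psi u) - f (emean psi v)) ^+ 2 <= eta.
Proof.
move=> e0 K0.
(* Since [z <= 1], an increment of at most [z] has square at most [z <= eta]. *)
pose z := Num.min 1 eta.
have z0 : 0 < z by rewrite /z lt_min ltr01.
have z1 : z <= 1 by rewrite /z ge_min lexx.
have ze : z <= eta by rewrite /z ge_min lexx orbT.
pose e1 := z / (`|L| * q%:R + 1).
have Lq : 0 <= `|L| * q%:R by rewrite mulr_ge0.
have e10 : 0 < e1 by rewrite divr_gt0// ltr_wpDl.
have e2 : 0 < e1 / 2 / (K + 1) by rewrite !divr_gt0// ltr_wpDl.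
have [M M0 hM] := emean_mod C0 hpsi e2.
exists (e1 / 2 / (M + 1)) => [|f d u v hf hK hd]; first by rewrite !divr_gt0// ltr_wpDl.
have hj j : `|emean psi u 0 j - emean psi v 0 j| <= e1.
  apply: le_trans (hM _ _ _ _) _; rewrite [leRHS](splitr e1) lerD//.
    apply: (@le_trans _ _ (e1 / 2 / (K + 1) * (K + 1))); last by rewrite divfK// gt_eqF// ltr_wpDl.
    by rewrite ler_wpM2l ?(ltW e2)// (le_trans hK)// lerDl.
  apply: (@le_trans _ _ ((M + 1) * (e1 / 2 / (M + 1)))); last by rewrite mulrC divfK// gt_eqF// ltr_wpDl.
  apply: ler_pM => //; [by apply: avg_ge0 => i; exact: sqr_ge0|by rewrite lerDl].
have h : `|f (emean psi u) - f (emean psi v)| <= z.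
  apply: le_trans (tame_lip_le hf hj) _.
  rewrite /e1 mulrA ler_pdivrMr; last by rewrite ltr_wpDl.
  by rewrite mulrC; apply: ler_wpM2l; [exact: ltW|rewrite lerDl].
rewrite -(real_normK (num_real _)); apply: le_trans ze.
apply: (@le_trans _ _ (z ^+ 2)); first by rewrite lerXn2r ?nnegrE// ltW.
by rewrite expr2 ler_piMr// ltW.
Qed.

(** The probability space comes after the threshold: it will be the space of the data in one use,
    and tuples under a Gaussian measure depending on the observation in the other. *)
Lemma concentration_small eta K : 0 < eta -> exists D0 : nat,
  forall (f : 'rV[R]_q -> R) disp (Omega : measurableType disp) (P : probability Omega R)
    d (eps : 'I_d -> Omega -> R) (u : d.-tuple R),
    tame L b f -> iid_std_normal P eps -> (0 < d)%N -> (D0 <= d)%N ->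
    avg (fun i => wt (tnth u i) ^+ (N * 2)) <= K ->
    P.-integrable setT (EFin \o (fun w =>
      (f (summary psi (observation u eps w)) - f (emean psi u)) ^+ 2)) /\
    \int[P]_w ((f (summary psi (observation u eps w)) - f (emean psi u)) ^+ 2) <= eta.
Proof.
move=> e0; pose k := L ^+ 2 * q%:R * (q%:R * (2 * C * gmom R N) ^+ 2 * gmom R (N * 2)).
have [D0 hD] := archi_le (k * K) e0.
exists D0 => f disp Omega P d eps u hf hiid d0 Dd hK.
have [h1 h2] := concentration C0 hpsi hf u hiid; split => //.
apply: le_trans h2 _; rewrite 2!mulrA -/k.
have k0 : 0 <= k.
  have g0 : 0 <= gmom R (N * 2) := le_trans ler01 (gmom_ge1 _ _).
  apply: mulr_ge0; first by apply: mulr_ge0 => //; exact: sqr_ge0.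
  by apply: mulr_ge0 => //; apply: mulr_ge0 => //; exact: sqr_ge0.
have dr : 0 < d%:R :> R by rewrite ltr0n.
rewrite mulrAC ler_pdivrMr//; apply: le_trans (hD _ Dd).
by rewrite ler_wpM2l.
Qed.

End small.

Lemma measurable_sg {R : realType} : measurable_fun setT (@Num.sg R : R -> R).
Proof.
rewrite (_ : @Num.sg R = (fun x => (0 < x)%R%:R - (x < 0)%R%:R)).
  apply: measurable_funB; apply: measurable_boolR;
    by apply: measurable_fun_ltr => //; exact: measurable_cst.
apply/funext => x; have [x0|x0|->] := ltgtP x 0.
- by rewrite ltr0_sg// sub0r.
- by rewrite gtr0_sg// subr0.
- by rewrite sgr0 subr0.
Qed.

Lemma measurable_shrink2 {R : realType} d (T : measurableType d) (X Cf : T -> R) :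
  measurable_fun setT X -> measurable_fun setT Cf ->
  measurable_fun setT (fun w => shrink (Cf w) (X w)).
Proof.
move=> mX mC; rewrite /shrink; apply: measurable_funM; first exact: (measurableT_comp measurable_sg).
apply: measurable_powR2; first exact: measurableT_comp.
by apply: measurable_funB => //; exact: measurable_cst.
Qed.

Lemma measurable_loss {R : realType} d (T : measurableType d) v (X Tf Gf : T -> R) :
  measurable_fun setT X -> measurable_fun setT Tf -> measurable_fun setT Gf ->
  measurable_fun setT (fun z => loss v (X z) (Tf z) (Gf z)).
Proof.
move=> mX mTf mGf.
apply: measurable_funX; apply: measurable_funB => //; apply: measurable_funM => //.
by apply: measurable_shrink2 => //; apply: measurable_funD => //; exact: measurable_cst.
Qed.

Lemma split5 {R : realType} (x m e a h : R) : x <= h / 5 -> m * e <= h / 5 / 4 ->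
  m * a <= m * e -> 0 < h -> x + (2 * m * (2 * e) + m * (4 * e + a)) <= h.
Proof. by move=> *; lra. Qed.

Section risk_estimate.
Context {R : realType} {qt qc : nat}.
Variables (psit : 'I_qt -> R -> R) (psic : 'I_qc -> R -> R) (C : R) (N : nat).
Hypothesis C0 : 0 <= C.
Hypothesis hpsit : psi_tame psit C N.
Hypothesis hpsic : psi_tame psic C N.
Variables (Lt Lc B b : R).
Hypothesis hb : 0 <= b < 1.

(* The common limit of [R / d] at [theta] and of [Rhat / d]: the functionals
   are frozen at the means of the summaries of independent N(u_i, 1). *)
Definition plug (ft : 'rV[R]_qt -> R) (fc : 'rV[R]_qc -> R) d (u : d.-tuple R) : R :=
  avg (fun i => lrisk (tnth u i) (ft (emean psit u)) (fc (emean psic u))).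

(** Here [u] is deterministic: it will be the denoised observation at a fixed outcome, while the
    risk integrates over all noise. [loss_mod] replaces the mean and both functionals at once; the
    functionals reach their values at [emean psit theta] and [emean psic theta] by concentration,
    and then those at [u] by [emean_close]. *)
Lemma risk_estimate eta K : 0 < eta -> 0 <= K -> exists2 delta : R, 0 < delta &
  exists D0 : nat, forall ft fc disp (Omega : measurableType disp) (P : probability Omega R)
    d (eps : 'I_d -> Omega -> R) (theta u : d.-tuple R),
    tame Lt B ft -> tame Lc b fc -> iid_std_normal P eps -> (0 < d)%N -> (D0 <= d)%N ->
    avg (fun i => (wt (tnth theta i) * wt (tnth u i)) ^+ (N * 2 + 12)) <= K ->
    avg (fun i => (tnth theta i - tnth u i) ^+ 2) <= delta ->
    exists2 r : R, risk P theta eps (fun z => ft (summary psit z)) (fun z => fc (summary psic z)) =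
        (d%:R * r)%:E & `|r - plug ft fc u| <= eta.
Proof.
move=> e0 K0; have /andP[b0 b1] := hb.
have e5 : 0 < eta / 5 by rewrite divr_gt0.
pose g12 := gmom R 12.
have g1 : 1 <= g12 := gmom_ge1 R 12.
(* With average weight at most [K] and noise moment [g12], the weighted term costs a fifth of [eta].
   Adding 1 to [K], and to [M] below, keeps the denominators positive. *)
pose e1 := eta / 5 / (g12 * (K + 1)).
have gK : 0 < g12 * (K + 1) by rewrite mulr_gt0// ?ltr_wpDl// (lt_le_trans ltr01).
have e10 : 0 < e1 by rewrite divr_gt0.
have [M M0 hM] := loss_mod hb (normr_ge0 B) e10.
pose e2 := eta / 5 / (4 * (M + 1)).
have M1 : 0 < 4 * (M + 1) by rewrite mulr_gt0// ltr_wpDl.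
have e20 : 0 < e2 by rewrite divr_gt0.
have [dt dt0 hdt] := emean_close C0 hpsit Lt B e20 K0.
have [dc dc0 hdc] := emean_close C0 hpsic Lc b e20 K0.
have [Dt hDt] := concentration_small C0 hpsit Lt B K e20.
have [Dc hDc] := concentration_small C0 hpsic Lc b K e20.
exists (Num.min e2 (Num.min dt dc)); first by rewrite !lt_min e20 dt0 dc0.
exists (maxn Dt Dc) => ft fc disp Omega P d eps theta u hft hfc hiid d0.
rewrite geq_max => /andP[Dtd Dcd] hK; rewrite !le_min => /and3P[hd hdt' hdc'].
have W1 i : 1 <= wt (tnth theta i) * wt (tnth u i).
  by rewrite -[1]mul1r ler_pM ?wt_ge1.
have hKn n : (n <= N * 2 + 12)%N ->
    avg (fun i => (wt (tnth theta i) * wt (tnth u i)) ^+ n) <= K.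
  by move=> hn; apply: le_trans hK; apply: ler_avg => i; rewrite ler_weXn2l.
have hK1 : avg (fun i => wt (tnth theta i) ^+ (N * 2)) <= K.
  apply: le_trans (hKn (N * 2)%N (leq_addr _ _)); apply: ler_avg => i.
  by rewrite lerXn2r ?nnegrE ?wt_ge0 ?mulr_ge0 ?wt_ge0// ler_peMr ?wt_ge0 ?wt_ge1.
have [it et] := hDt _ _ _ _ _ _ theta hft hiid d0 Dtd hK1.
have [ic ec] := hDc _ _ _ _ _ _ theta hfc hiid d0 Dcd hK1.
have st := hdt _ _ _ _ hft (hKn _ (leq_addr _ _)) hdt'.
have sc := hdc _ _ _ _ hfc (hKn _ (leq_addr _ _)) hdc'.
pose T w := ft (summary psit (observation theta eps w)).
pose G w := fc (summary psic (observation theta eps w)).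
pose t0 := ft (emean psit theta); pose c0 := fc (emean psic theta).
pose t1 := ft (emean psit u); pose c1 := fc (emean psic u).
pose A i w := loss (tnth theta i) (eps i w) (T w) (G w).
pose A1 i w := loss (tnth u i) (eps i w) t1 c1.
have tB f' s : tame Lt B f' -> `|f' s| <= `|B|.
  by move=> [_ h _]; rewrite (le_trans (h s))// ler_norm.
have cB f' s : tame Lc b f' -> `|f' s| <= b by move=> [_ h _].
pose wu i := (wt (tnth theta i) * wt (tnth u i)) ^+ 12.
pose S w := (T w - t0) ^+ 2 + (G w - c0) ^+ 2.
(* Passing through [t0] and [c0] doubles the squares; the two deterministic gaps, each at most [e2],
   thus contribute [4 * e2]. *)
pose k i := 4 * e2 + (tnth theta i - tnth u i) ^+ 2.
have bound i w : `|A i w - A1 i w| <= e1 * wu i * wt (eps i w) ^+ 12 + (2 * M * S w + M * k i).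
  apply: le_trans (hM _ _ _ _ _ _ _ _ _ _ _) _ => //; [exact: tB|exact: tB|exact: cB|exact: cB|].
  rewrite exprMn -/(wu i) mulrA lerD2l.
  have -> : 2 * M * S w + M * k i = M * (2 * S w + k i) by ring.
  rewrite ler_wpM2l//.
  have dbl (x y z : R) : (x - z) ^+ 2 <= 2 * (x - y) ^+ 2 + 2 * (y - z) ^+ 2.
    by have := sqr_ge0 (x - y - (y - z)); rewrite !expr2; lra.
  have := dbl (T w) t0 t1; have := dbl (G w) c0 c1; rewrite /S /k.
  move: st sc; rewrite -/t0 -/t1 -/c0 -/c1; clear; lra.
have mT : measurable_fun setT T.
  by apply: (measurable_summary_comp hpsit theta hiid); exact: tame_continuous hft.
have mG : measurable_fun setT G.
  by apply: (measurable_summary_comp hpsic theta hiid); exact: tame_continuous hfc.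
have [me _ _] := hiid.
have mA i : measurable_fun setT (A i) by exact: measurable_loss.
have c1b : `|c1| < 1 by apply: le_lt_trans b1; exact: cB.
have ml1 i : measurable_fun setT (fun e => loss (tnth u i) e t1 c1) by exact: measurable_loss.
have iA1 i : P.-integrable setT (EFin \o A1 i) /\ \int[P]_w A1 i w = lrisk (tnth u i) t1 c1.
  by have [l1 _ _] := lrisk_sure (tnth u i) t1 c1b; exact: law_int.
have mw12 : measurable_fun setT (fun e : R => wt e ^+ 12).
  by apply: measurable_funX; exact: mwt.
have iw i : P.-integrable setT (EFin \o (fun w => wt (eps i w) ^+ 12)) /\
    \int[P]_w (wt (eps i w) ^+ 12) = g12.
  by apply: (law_int hiid i mw12); exact: integrable_wtX.
have iS : P.-integrable setT (EFin \o S) /\ \int[P]_w S w <= 2 * e2.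
  have [s1 s2] := Rint_add it ic; split => //.
  by rewrite /S s2; move: et ec; rewrite -/t0 -/c0 -/(T _) -/(G _); clear; lra.
pose H i w := e1 * wu i * wt (eps i w) ^+ 12 + (2 * M * S w + M * k i).
have iH i : P.-integrable setT (EFin \o H i) /\
    \int[P]_w H i w <= e1 * g12 * wu i + (2 * M * (2 * e2) + M * k i).
  have [p1 p2] := Rint_scale (e1 * wu i) (iw i).1.
  have [p3 p4] := Rint_scale (2 * M) iS.1.
  have p5 : P.-integrable setT (EFin \o (fun=> M * k i)) by apply: finite_measure_integrable_cst.
  have [p6 p7] := Rint_add p3 p5.
  have [p8 p9] := Rint_add p1 p6; split => //.
  rewrite p9 p2 p7 p4 (iw i).2 (Rintegral_cst _ measurableT).
  rewrite -[fine _]/(fine (P setT)) probability_setT mulr1 (mulrAC e1) lerD2l lerD2r.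
  by rewrite ler_wpM2l ?mulr_ge0//; exact: iS.2.
have [iH1 iH2] := Rint_sum (index_enum 'I_d) (fun i => (iH i).1).
have [iB1 iB2] := Rint_sum (index_enum 'I_d) (fun i => (iA1 i).1).
have [iHB _] := Rint_add iH1 iB1.
have hAB w : `|\sum_i A i w - \sum_i A1 i w| <= \sum_i H i w.
  by rewrite -sumrB (le_trans (ler_norm_sum _ _ _))// ler_sum.
have iA : P.-integrable setT (EFin \o (fun w => \sum_i A i w)).
  apply: (integrable_le _ _ iHB) => [|w]; first exact: measurable_sum.
  have -> : \sum_i A i w = (\sum_i A i w - \sum_i A1 i w) + \sum_i A1 i w by rewrite subrK.
  rewrite (le_trans (ler_normD _ _))// lerD// ger0_norm//.
  by apply: sumr_ge0 => i _; exact: sqr_ge0.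
exists (d%:R^-1 * \int[P]_w (\sum_i A i w)).
  rewrite mulVKf ?pnatr_eq0 -?lt0n// -EFin_Rint//.
  rewrite /risk unlock; apply: eq_integral => w _; congr EFin; apply: eq_bigr => i _.
  by rewrite !tnth_mktuple /A /loss /shrink; congr (_ ^+ 2); rewrite /T /G; ring.
have := Rint_absB iA iB1 iH1 hAB.
rewrite iB2 iH2 => h.
have -> : plug ft fc u = d%:R^-1 * \sum_i \int[P]_w A1 i w.
  by congr (_ * _); apply: eq_bigr => i _; rewrite (iA1 i).2.
rewrite -mulrBr normrM ger0_norm ?invr_ge0//.

apply: (@le_trans _ _ (avg (fun i => e1 * g12 * wu i + (2 * M * (2 * e2) + M * k i)))).
  rewrite ler_wpM2l ?invr_ge0// (le_trans h)// ler_sum// => i _; exact: (iH i).2.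
rewrite avgD avgD avg_cst// !avgZ avgD avg_cst//.
have r1 : e1 * g12 * avg wu <= eta / 5.
  apply: (@le_trans _ _ (e1 * g12 * (K + 1))).
    apply: ler_wpM2l.
      by apply: mulr_ge0; [exact: ltW|exact: le_trans ler01 g1].
    by apply: (le_trans (hKn 12%N (leq_addl _ _))); rewrite lerDl.
  have -> : e1 * g12 * (K + 1) = eta / 5 / (g12 * (K + 1)) * (g12 * (K + 1)) by rewrite -mulrA.
  by rewrite divfK// gt_eqF.
have r2 : M * e2 <= eta / 5 / 4.
  rewrite /e2 mulrA ler_pdivrMr//.
  have -> : eta / 5 / 4 * (4 * (M + 1)) = eta / 5 * M + eta / 5 by field.
  by rewrite mulrC lerDl ltW.
have r3 : M * avg (fun i => (tnth theta i - tnth u i) ^+ 2) <= M * e2 by rewrite ler_wpM2l.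
exact: split5 r1 r2 r3 e0.
Qed.

End risk_estimate.

(** * Derivative terms and the approximate risk *)

Section pointwise_bounds.
Context {R : realType}.
Implicit Types (x b c t p r D B : R).

(** For [|x| <= 1] the weight is at most 2, and beyond 1 [sing] is at most 1: the two factors are
    never large together. *)
Lemma sing_wt b x n : 0 <= b < 1 -> sing b x * wt x ^+ n <= 2 ^+ n * sing b x + wt x ^+ n.
Proof.
move=> /andP[b0 b1]; have w0 : 0 <= wt x ^+ n by rewrite exprn_ge0// wt_ge0.
have [x1|x1] := leP `|x| 1.
  apply: (@le_trans _ _ (2 ^+ n * sing b x)); last by rewrite lerDl.
  rewrite mulrC ler_wpM2r ?sing_ge0// lerXn2r ?nnegrE ?wt_ge0//.
  by rewrite /wt; lra.
apply: (@le_trans _ _ (wt x ^+ n)); last by rewrite lerDr mulr_ge0 ?exprn_ge0 ?sing_ge0.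
rewrite ler_piMl// /sing -[leRHS](powRr0 `|x|).
by apply: ler_powR; [exact: ltW|lra].
Qed.

Lemma mul_norm_ln_le x : `|x| * `|ln `|x| | <= wt x ^+ 2.
Proof.
have [->|x0] := eqVneq x 0; first by rewrite normr0 mul0r exprn_ge0// wt_ge0.
have nx : 0 < `|x| by rewrite normr_gt0.
have h1 := ln_sublinear nx.
have ix : 0 < `|x|^-1 by rewrite invr_gt0.
have h2 := ln_sublinear ix.
rewrite lnV ?posrE// in h2.
have h3 : `|x| * `|x|^-1 = 1 by rewrite mulfV// gt_eqF.
have h4 : `|ln `|x| | <= `|x| + `|x|^-1.
  by rewrite ler_norml; apply/andP; split; lra.
apply: (le_trans (ler_wpM2l (normr_ge0 x) h4)).
rewrite mulrDr h3 /wt; nra.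
Qed.

(** The factor [|x|] tames the logarithm at 0, so that [|x|^(-c)] is the only singularity left. [M]
    does not depend on [D], which will carry the factor 1/d of the derivatives. *)
Lemma deriv_term_le b B N : 0 <= b < 1 -> 0 <= B -> exists2 M : R, 0 <= M &
  forall x t c p r D, `|t| <= B -> `|c| <= b ->
    `|p| <= D * wt x ^+ N -> `|r| <= D * wt x ^+ N ->
    `|(`|x| `^ c)^-1 * (2 * `|x| * p - 2 * t * `|x| * ln `|x| * r)| <=
    M * D * (sing b x + wt x ^+ (N + 3)).
Proof.
move=> hb B0; have [M M0 hM] := negpow_bound hb ltr01.
pose k : R := 2 * (1 + B).
have k0 : 0 <= k by rewrite mulr_ge0// addr_ge0.
exists (k * (M + 1 + 2 ^+ (N + 2))) => [|x t c p r D tB cb hp hr].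
  by rewrite mulr_ge0// !addr_ge0// exprn_ge0.
have w0 : 0 <= wt x := wt_ge0 x.
have D0 : 0 <= D.
  have := le_trans (normr_ge0 _) hp; rewrite pmulr_lge0// exprn_gt0//; exact: wt_gt0.
have [x00|x0] := eqVneq x 0.
  have -> : `|x| = 0 by rewrite x00 normr0.
  rewrite !(mulr0, mul0r) subr0 mulr0 normr0.
  apply: mulr_ge0; last by rewrite addr_ge0 ?sing_ge0// exprn_ge0.
  apply: mulr_ge0 => //; apply: mulr_ge0 => //.
  by rewrite !addr_ge0// exprn_ge0.
rewrite -powRN normrM (ger0_norm (powR_ge0 _ _)).
have hx : `|x| <= wt x ^+ 2.
  by apply: (le_trans (norm_le_wt x)); rewrite expr2 ler_peMr// wt_ge1.
have h1 : `|2 * `|x| * p - 2 * t * `|x| * ln `|x| * r| <= k * D * wt x ^+ (N + 2).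
  apply: (le_trans (ler_normB _ _)).
  have -> : `|2 * `|x| * p| = 2 * (`|x| * `|p|).
    by rewrite -mulrA normrM ger0_norm// normrM normr_id.
  have -> : `|2 * t * `|x| * ln `|x| * r| = 2 * (`|t| * ((`|x| * `|ln `|x| |) * `|r|)).
    by rewrite -!mulrA normrM ger0_norm// !normrM normr_id.
  have a1 : `|x| * `|p| <= wt x ^+ 2 * (D * wt x ^+ N) by apply: ler_pM.
  have a2 : `|x| * `|ln `|x| | * `|r| <= wt x ^+ 2 * (D * wt x ^+ N).
    by apply: ler_pM => //; exact: mul_norm_ln_le.
  have a3 : `|t| * (`|x| * `|ln `|x| | * `|r|) <= B * (wt x ^+ 2 * (D * wt x ^+ N)).
    by apply: ler_pM => //; rewrite !mulr_ge0.
  have -> : k * D * wt x ^+ (N + 2) = 2 * (wt x ^+ 2 * (D * wt x ^+ N)) +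
       2 * (B * (wt x ^+ 2 * (D * wt x ^+ N))) by rewrite exprD /k; ring.
  by rewrite lerD// ler_wpM2l.
have W0 n : 0 <= wt x ^+ n by rewrite exprn_ge0.
apply: (le_trans (ler_pM (powR_ge0 _ _) (normr_ge0 _) (hM c x cb x0) h1)).
have s0 := sing_ge0 b x.
have -> : (M * wt x + 1 * sing b x) * (k * D * wt x ^+ (N + 2)) =
   k * D * (M * wt x ^+ (N + 3) + sing b x * wt x ^+ (N + 2)).
  by rewrite (addnS N 2) exprS; ring.
have -> : k * (M + 1 + 2 ^+ (N + 2)) * D * (sing b x + wt x ^+ (N + 3)) =
  k * D * ((M + 1 + 2 ^+ (N + 2)) * (sing b x + wt x ^+ (N + 3))) by ring.
apply: ler_wpM2l; first exact: mulr_ge0.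
apply: (le_trans (lerD (lexx _) (sing_wt x (N + 2) hb))).
have h3 : wt x ^+ (N + 2) <= wt x ^+ (N + 3) by apply: ler_wtX; rewrite leq_add2l.
have p0 : 0 <= 2 ^+ (N + 2) :> R by rewrite exprn_ge0.
have h5 := mulr_ge0 M0 s0; have h6 := mulr_ge0 p0 (W0 (N + 3)%N).
rewrite -subr_ge0.
have -> : (M + 1 + 2 ^+ (N + 2)) * (sing b x + wt x ^+ (N + 3)) -
   (M * wt x ^+ (N + 3) + (2 ^+ (N + 2) * sing b x + wt x ^+ (N + 2))) =
   (wt x ^+ (N + 3) - wt x ^+ (N + 2)) + M * sing b x + sing b x + 2 ^+ (N + 2) * wt x ^+ (N + 3).
  by ring.
have : 0 <= wt x ^+ (N + 3) - wt x ^+ (N + 2) by rewrite subr_ge0.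
by move: (_ - _) => dw dw0; rewrite !addr_ge0.
Qed.

(** Complements [sure_mod] at the excluded point. By the conventions for powers and inverses of 0,
    the value there is [2 * t] if [c = 0] and 0 otherwise. *)
Lemma sure0 t c B : `|t| <= B -> 0 <= B -> `|sure 0 t c| <= 2 * B.
Proof.
move=> tB B0; rewrite /sure normr0 /powR eqxx.
have [->|c0] := eqVneq c 0; last by rewrite invr0 mul0r normr0 mulr_ge0.
by rewrite !subr0 invr1 mul1r mulr1 pnatr_eq0 /= mulr0 subr0 normrM ger0_norm// ler_wpM2l.
Qed.

End pointwise_bounds.

Lemma measurable_sure {R : realType} d (T : measurableType d) (X Tf Gf : T -> R) :
  measurable_fun setT X -> measurable_fun setT Tf -> measurable_fun setT Gf ->
  measurable_fun setT (fun z => sure (X z) (Tf z) (Gf z)).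
Proof.
move=> mX mTf mGf.
rewrite /sure (_ : (fun _ => _) = (fun z => `|X z| `^ (- Gf z) *
   (2 * Tf z * (1 - Gf z) - Tf z ^+ 2 * `|X z| `^ (2 - Gf z)))); last first.
  by apply/funext => z; rewrite powRN.
have mX' : measurable_fun setT (fun z => `|X z|) by exact: measurableT_comp.
apply: measurable_funM; first by apply: measurable_powR2 => //; exact: measurableT_comp.
apply: measurable_funB.
  by apply: measurable_funM; [exact: measurable_funM|exact: measurable_funB].
apply: measurable_funM; first exact: measurable_funX.
by apply: measurable_powR2 => //; exact: measurable_funB.
Qed.

Section rhat_estimate.
Context {R : realType} {qt qc : nat}.
Variables (psit : 'I_qt -> R -> R) (psic : 'I_qc -> R -> R) (C : R) (N : nat).
Hypothesis C0 : 0 <= C.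
Hypothesis hpsit : psi_tame psit C N.
Hypothesis hpsic : psi_tame psic C N.
Variables (Lt Lc B b : R).
Hypothesis hb : 0 <= b < 1.

Lemma dabs_summary q (psi : 'I_q -> R -> R) L B' (f : 'rV[R]_q -> R) d (z : d.-tuple R) i :
  psi_tame psi C N -> tame L B' f ->
  dabs (fun z => f (summary psi z)) i z = Num.sg (tnth z i) *
    (d%:R^-1 * \sum_j partial f j (summary psi z) * derive1 (psi j) (tnth z i)) /\
  `|dabs (fun z => f (summary psi z)) i z| <=
    d%:R^-1 * (q%:R * `|L| * C) * wt (tnth z i) ^+ N.
Proof.
move=> [h1 h2 h3] [[h4 h5] h6 h7].
have E : dabs (fun z => f (summary psi z)) i z = Num.sg (tnth z i) *
    (d%:R^-1 * \sum_j partial f j (summary psi z) * derive1 (psi j) (tnth z i)).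
  by rewrite /dabs derive_functional// => s; exact: h4.
split => //; rewrite E normrM.
have sg1 : `|Num.sg (tnth z i)| <= 1 by rewrite normr_sg; case: (_ != _).
apply: (le_trans (ler_wpM2r (normr_ge0 _) sg1)); rewrite mul1r.
rewrite normrM ger0_norm ?invr_ge0// -mulrA ler_wpM2l ?invr_ge0//.
apply: (le_trans (ler_norm_sum _ _ _)).
apply: (@le_trans _ _ (\sum_(j < q) `|L| * (C * wt (tnth z i) ^+ N))).
  apply: ler_sum => j _; rewrite normrM ler_pM//; last by have [] := h3 j (tnth z i).
  by apply: (le_trans (norm_partial_le _ _ _)); apply: (le_trans (h7 _)); exact: ler_norm.
by rewrite sumr_const card_ord -[_ *+ q]mulr_natl !mulrA.
Qed.

(** The noise on the space of tuples: every tuple is its own observation around [u], so the lemmas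
    about [observation] apply to it. *)
Let dev d (u : d.-tuple R) (i : 'I_d) (z : d.-tuple (measurableTypeR R)) : R :=
  tnth z i - tnth u i.

Lemma observation_dev d (u z : d.-tuple R) : observation u (dev u) z = z.
Proof. by apply: eq_from_tnth => i; rewrite tnth_mktuple /dev addrC subrK. Qed.

(** Deterministic in [y]: the only randomness is that of [gmeas u], against which [Hhat] is minus a
    sum of derivative terms and of [sure]. With frozen functionals [sure] has mean [1 - lrisk], so
    [d] plus the integral becomes [d] times [plug]. *)
Lemma rhat_estimate eta K : 0 < eta -> 0 <= K ->
  exists D0 : nat, forall ft fc d (y u : d.-tuple R) (s : R -> R),
    tame Lt B ft -> tame Lc b fc -> (0 < d)%N -> (D0 <= d)%N ->
    (forall i, tnth u i = tnth y i + s (tnth y i)) ->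
    avg (fun i => wt (tnth u i) ^+ (N * 2 + 12)) <= K ->
    exists2 r : R, Rhat s y (fun z => ft (summary psit z)) (fun z => fc (summary psic z)) =
        (d%:R * r)%:E & `|r - plug psit psic ft fc u| <= eta.
Proof.
move=> e0 K0; have /andP[b0 b1] := hb.
(* Collects the moment constants of the three weights that occur: [sing], [wt ^+ (N + 3)] and
   [wt ^+ 10]. *)
pose kap := 2 / (1 - b) * gmom R 3 + gmom R (N + 3) + gmom R 10.
have gm n : 0 <= gmom R n := le_trans ler01 (gmom_ge1 _ _).
have kap1 : 0 <= 2 / (1 - b) * gmom R 3.
  by rewrite mulr_ge0// divr_ge0// subr_ge0 ltW.
have kap0 : 0 < kap.
  by rewrite /kap ltr_wpDl ?addr_ge0// (lt_le_trans ltr01) ?gmom_ge1.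
pose e1 := eta / 3 / (2 * kap * (K + 1)).
have kK : 0 < 2 * kap * (K + 1) by rewrite !mulr_gt0// ltr_wpDl.
have e10 : 0 < e1 by rewrite !divr_gt0.
have [M M0 hM] := sure_mod hb (normr_ge0 B) e10.
pose e2 := eta / 3 / (2 * (M + 1)).
have M1 : 0 < 2 * (M + 1) by rewrite mulr_gt0// ltr_wpDl.
have e20 : 0 < e2 by rewrite !divr_gt0.
have [M2 M20 hM2] := deriv_term_le N hb (normr_ge0 B).
pose D := (qt%:R * `|Lt| * C) + (qc%:R * `|Lc| * C).
have D0 : 0 <= D by rewrite addr_ge0 ?mulr_ge0.
have [Dt hDt] := concentration_small C0 hpsit Lt B K e20.
have [Dc hDc] := concentration_small C0 hpsic Lc b K e20.
have e3 : 0 < eta / 3 by rewrite divr_gt0.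
(* The derivative terms of all coordinates together cost at most [M2 * D * (2 * kap) * K]; dividing
   by a large [d] leaves [eta / 3]. *)
have [D3 hD3] := archi_le (M2 * D * (2 * kap) * K) e3.
exists (maxn D3 (maxn Dt Dc)) => ft fc d y u s hft hfc d0.
rewrite !geq_max => /and3P[D3d Dtd Dcd] hu hK.
have dr : 0 < d%:R :> R by rewrite ltr0n.
pose P : probability _ R := gmeas u.
have hiid : iid_std_normal P (dev u) := gmeas_iid u.
have hK1 : avg (fun i => wt (tnth u i) ^+ (N * 2)) <= K.
  by apply: le_trans hK; apply: ler_avg => i; rewrite ler_wtX// leq_addr.
have [it et] := hDt _ _ _ _ _ _ u hft hiid d0 Dtd hK1.
have [ic ec] := hDc _ _ _ _ _ _ u hfc hiid d0 Dcd hK1.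
pose T (z : d.-tuple (measurableTypeR R)) := ft (summary psit z).
pose G (z : d.-tuple (measurableTypeR R)) := fc (summary psic z).
pose t1 := ft (emean psit u); pose c1 := fc (emean psic u).
have TE : T = (fun z => ft (summary psit (observation u (dev u) z))).
  by apply/funext => z; rewrite observation_dev.
have GE : G = (fun z => fc (summary psic (observation u (dev u) z))).
  by apply/funext => z; rewrite observation_dev.
have {}it : P.-integrable setT (EFin \o (fun z => (T z - t1) ^+ 2)) by rewrite TE.
have {}ic : P.-integrable setT (EFin \o (fun z => (G z - c1) ^+ 2)) by rewrite GE.
have {}et : \int[P]_z ((T z - t1) ^+ 2) <= e2 by rewrite TE.
have {}ec : \int[P]_z ((G z - c1) ^+ 2) <= e2 by rewrite GE.
have mT : measurable_fun setT T.
  by rewrite TE; apply: (measurable_summary_comp hpsit u hiid); exact: tame_continuous hft.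
have mG : measurable_fun setT G.
  by rewrite GE; apply: (measurable_summary_comp hpsic u hiid); exact: tame_continuous hfc.
have tB s' : `|ft s'| <= `|B| by have [_ h _] := hft; rewrite (le_trans (h s'))// ler_norm.
have cB s' : `|fc s'| <= b by have [_ h _] := hfc.
have mz i : measurable_fun setT (fun z : d.-tuple (measurableTypeR R) => tnth z i : R).
  exact: mtnth.
have mnz i : measurable_fun setT (fun z : d.-tuple (measurableTypeR R) => `|tnth z i| : R).
  by apply: measurableT_comp => //; exact: mtnth.
pose dt i (z : d.-tuple (measurableTypeR R)) := dabs (fun z => ft (summary psit z)) i z.
pose dc i (z : d.-tuple (measurableTypeR R)) := dabs (fun z => fc (summary psic z)) i z.
have mdabs q (psi : 'I_q -> R -> R) L B' (f : 'rV[R]_q -> R) i :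
    psi_tame psi C N -> tame L B' f ->
    measurable_fun setT (fun z : d.-tuple (measurableTypeR R) =>
      dabs (fun z => f (summary psi z)) i z).
  move=> hpsi hf.
  rewrite (_ : (fun _ => _) = (fun z => Num.sg (tnth z i) *
    (d%:R^-1 * \sum_j partial f j (summary psi z) * derive1 (psi j) (tnth z i)))); last first.
    by apply/funext => z; have [] := dabs_summary z i hpsi hf.
  apply: measurable_funM; first exact: (measurableT_comp measurable_sg).
  apply: measurable_funM => //; apply: measurable_sum => j.
  apply: measurable_funM.
    rewrite (_ : (fun _ => _) = (fun z => partial f j (summary psi (observation u (dev u) z)))).
      apply: (measurable_summary_comp hpsi u hiid) => s'.
      by have [[_ h] _ _] := hf; exact: h.
    by apply/funext => z; rewrite observation_dev.
  have [_ h _] := hpsi.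
  by apply: (measurableT_comp (continuous_measurable_fun (h j))).
have mdt i : measurable_fun setT (dt i) by exact: mdabs hpsit hft.
have mdc i : measurable_fun setT (dc i) by exact: mdabs hpsic hfc.
pose Q i (z : d.-tuple (measurableTypeR R)) : R := (`|tnth z i| `^ G z)^-1 *
  (2 * `|tnth z i| * dt i z - 2 * T z * `|tnth z i| * ln `|tnth z i| * dc i z).
pose A i (z : d.-tuple (measurableTypeR R)) : R := sure (tnth z i) (T z) (G z).
pose A1 i (z : d.-tuple (measurableTypeR R)) : R := sure (tnth z i) t1 c1.
pose F (z : d.-tuple (measurableTypeR R)) : R := - \sum_i (Q i z + A i z).
have mQ i : measurable_fun setT (Q i).
  rewrite /Q (_ : (fun _ => _) = (fun z => `|tnth z i| `^ (- G z) *
    (2 * `|tnth z i| * dt i z - 2 * T z * `|tnth z i| * ln `|tnth z i| * dc i z))); last first.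
    by apply/funext => z; rewrite powRN.
  apply: measurable_funM; first by apply: measurable_powR2 => //; exact: measurableT_comp.
  have mln : measurable_fun setT (fun z : d.-tuple (measurableTypeR R) => ln `|tnth z i| : R).
    exact: (measurableT_comp (measurable_ln (R := R))).
  apply: measurable_funB; apply: measurable_funM => //.
    by apply: measurable_funM.
  by apply: measurable_funM => //; apply: measurable_funM => //; exact: measurable_funM.
have mA i : measurable_fun setT (A i) by exact: measurable_sure.
have mF : measurable_fun setT F.
  apply: measurableT_comp => //; apply: measurable_sum => i; exact: measurable_funD.
have c1b : `|c1| < 1 by apply: le_lt_trans b1; exact: cB.
have mu' (h : R -> R) i : measurable_fun setT h -> measurable_fun setT (fun e => h (tnth u i + e)).
  by move=> mh; apply: (measurableT_comp mh); apply: measurable_funD => //; exact: measurable_cst.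
have lawz (h : R -> R) i : measurable_fun setT h ->
    (N01 R).-integrable setT (EFin \o (fun e => h (tnth u i + e))) ->
    P.-integrable setT (EFin \o (fun z => h (tnth z i))) /\
    \int[P]_z h (tnth z i) = \int[N01 R]_e h (tnth u i + e).
  move=> mh ih; have [h1 h2] := @law_int _ _ _ P d (dev u) hiid i (fun e => h (tnth u i + e)) (mu' h i mh) ih.
  have E z : tnth u i + dev u i z = tnth z i by rewrite /dev addrC subrK.
  by split; [under eq_fun do rewrite -E|under eq_Rintegral do rewrite -E].
have msing : measurable_fun setT (@sing R b).
  by apply: measurable_powR2 => //; exact: measurable_cst.
have mwtX n : measurable_fun setT (fun x : R => wt x ^+ n) by apply: measurable_funX; exact: mwt.
have iw n i : P.-integrable setT (EFin \o (fun z => wt (tnth z i) ^+ n)) /\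
    \int[P]_z (wt (tnth z i) ^+ n) <= gmom R n * wt (tnth u i) ^+ n.
  have [i1 i2] := Rint_scale (wt (tnth u i) ^+ n) (integrable_wtX R n).
  have le1 e : wt (tnth u i + e) ^+ n <= wt (tnth u i) ^+ n * wt e ^+ n.
    by rewrite -exprMn lerXn2r ?nnegrE ?mulr_ge0 ?wt_ge0// wtD.
  have i3 : (N01 R).-integrable setT (EFin \o (fun e => wt (tnth u i + e) ^+ n)).
    apply: (@integrable_le _ (measurableTypeR R) R (N01 R) _
       (fun e => wt (tnth u i) ^+ n * wt e ^+ n)) => //.
      exact: (mu' (fun x => wt x ^+ n) i (mwtX n)).
    by move=> e; rewrite ger0_norm ?exprn_ge0 ?wt_ge0.
  have [h1 h2] := lawz (fun x => wt x ^+ n) i (mwtX n) i3; split => //.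
  rewrite h2 mulrC -i2; exact: le_Rintegral.
have isg i : P.-integrable setT (EFin \o (fun z => sing b (tnth z i))) /\
    \int[P]_z (sing b (tnth z i)) <= 2 / (1 - b) * gmom R 3 * wt (tnth u i) ^+ 2.
  have [i1 i2] := sing_moment (tnth u i) hb.
  by have [h1 h2] := lawz (@sing R b) i msing i1; rewrite h2.
(* A coordinate vanishes with probability 0, so the correction needed where [sure_mod] does not
   apply disappears after integration. *)
have i0 i : P.-integrable setT (EFin \o (fun z => (tnth z i == 0)%:R)) /\
    \int[P]_z ((tnth z i == 0)%:R) = 0 :> R.
  pose h (x : R) : R := (x == 0)%:R.
  have mh : measurable_fun setT h.
    by apply: measurable_boolR; apply: measurable_fun_eqr => //; exact: measurable_cst.
  have ih : (N01 R).-integrable setT (EFin \o (fun e => h (tnth u i + e))).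
    apply: (@integrable_le _ (measurableTypeR R) R (N01 R) _ (fun e => wt e ^+ 0)).
    - exact: mu'.
    - by move=> e; rewrite /h; case: (_ == _); rewrite ?normr0 ?normr1.
    - exact: integrable_wtX.
  have [h1 h2] := lawz h i mh ih; split => //; rewrite h2 /Rintegral.
  rewrite (_ : (\int[_]_e _)%E = 0%E)//.
  transitivity (\int[N01 R]_e (\1_[set - tnth u i] e)%:E)%E.
    apply: eq_integral => e _; rewrite /h indicE; congr ((nat_of_bool _)%:R%:E).
    apply/idP/idP => [/eqP he|].
      by rewrite inE /=; apply/eqP; rewrite -addr_eq0 addrC he.
    by rewrite inE /= => ->; rewrite subrr.
  by rewrite integral_indic// setIT; exact: N01_set1.
pose S z := (T z - t1) ^+ 2 + (G z - c1) ^+ 2.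
have iS : P.-integrable setT (EFin \o S) /\ \int[P]_z S z <= 2 * e2.
  have [s1 s2] := Rint_add it ic; split => //.
  by rewrite /S s2 -[2]/(1 + 1) mulrDl mul1r lerD.
pose k := M2 * (d%:R^-1 * D).
have k0 : 0 <= k by rewrite !mulr_ge0// invr_ge0.
pose H i z := k * (sing b (tnth z i) + wt (tnth z i) ^+ (N + 3)) +
  (e1 * (sing b (tnth z i) + wt (tnth z i) ^+ 10) + (M * S z + 4 * `|B| * (tnth z i == 0)%:R)).
have bound i z : `|Q i z + A i z - A1 i z| <= H i z.
  rewrite -addrA (le_trans (ler_normD _ _))// lerD//.
    have D1 (a c : R) : 0 <= a -> 0 <= c -> a <= a + c /\ c <= a + c by move=> ? ?; rewrite lerDl lerDr.
    have [Dt1 Dc1] := D1 _ _ (mulr_ge0 (mulr_ge0 (ler0n _ qt) (normr_ge0 Lt)) C0)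
       (mulr_ge0 (mulr_ge0 (ler0n _ qc) (normr_ge0 Lc)) C0).
    apply: hM2 => //; [exact: tB|exact: cB| |].
      have [_ h] := dabs_summary z i hpsit hft; apply: (le_trans h).
      apply: ler_wpM2r; first by rewrite exprn_ge0// wt_ge0.
      by rewrite ler_wpM2l ?invr_ge0.
    have [_ h] := dabs_summary z i hpsic hfc; apply: (le_trans h).
    apply: ler_wpM2r; first by rewrite exprn_ge0// wt_ge0.
    by rewrite ler_wpM2l ?invr_ge0.
  have [z0|z0] := eqVneq (tnth z i) 0; last first.
    rewrite mulr0 addr0; apply: hM => //; [exact: tB|exact: tB|exact: cB|exact: cB].
  rewrite mulr1 addrA; apply: ler_wpDl.
    rewrite addr_ge0//; first by rewrite mulr_ge0 ?addr_ge0 ?sing_ge0 ?exprn_ge0 ?wt_ge0// ltW.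
    by rewrite mulr_ge0// addr_ge0// sqr_ge0.
  rewrite /A /A1 z0 (le_trans (ler_normB _ _))//.
  have -> : 4 * `|B| = 2 * `|B| + 2 * `|B| by ring.
  by rewrite lerD// sure0//; exact: tB.
have iH i : P.-integrable setT (EFin \o H i) /\
    \int[P]_z H i z <= (k + e1) * (2 * kap) * wt (tnth u i) ^+ (N * 2 + 12) + M * (2 * e2).
  have [sa1 sa2] := isg i; have [wa1 wa2] := iw (N + 3)%N i; have [wb1 wb2] := iw 10%N i.
  have [x1 x2] := Rint_add sa1 wa1; have [x3 x4] := Rint_scale k x1.
  have [y1 y2] := Rint_add sa1 wb1; have [y3 y4] := Rint_scale e1 y1.
  have [v1 v2] := Rint_scale M iS.1; have [v3 v4] := Rint_scale (4 * `|B|) (i0 i).1.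
  have [v5 v6] := Rint_add v1 v3; have [v7 v8] := Rint_add y3 v5.
  have [v9 v10] := Rint_add x3 v7; split => //.
  rewrite v10 v8 v6 v4 (i0 i).2 mulr0 addr0 v2 x4 y4 x2 y2 addrA lerD//; last first.
    by rewrite ler_wpM2l//; exact: iS.2.
  have wn n : (n <= N * 2 + 12)%N -> wt (tnth u i) ^+ n <= wt (tnth u i) ^+ (N * 2 + 12).
    by move=> hn; rewrite ler_wtX.
  set W := wt (tnth u i) ^+ (N * 2 + 12).
  have W0 : 0 <= W by rewrite exprn_ge0// wt_ge0.
  have sk : \int[P]_z (sing b (tnth z i)) <= kap * W.
    apply: (le_trans sa2); apply: (@le_trans _ _ (2 / (1 - b) * gmom R 3 * W)).
      by apply: ler_wpM2l => //; apply: wn; rewrite (leq_trans _ (leq_addl _ _)).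
    by apply: ler_wpM2r => //; rewrite /kap -addrA lerDl addr_ge0.
  have wk : \int[P]_z (wt (tnth z i) ^+ (N + 3)) <= kap * W.
    apply: (le_trans wa2); apply: (@le_trans _ _ (gmom R (N + 3) * W)).
      apply: ler_wpM2l => //; apply: wn; rewrite leq_add// leq_pmulr//.
    by apply: ler_wpM2r => //; rewrite /kap addrAC lerDr addr_ge0.
  have wk' : \int[P]_z (wt (tnth z i) ^+ 10) <= kap * W.
    apply: (le_trans wb2); apply: (@le_trans _ _ (gmom R 10 * W)).
      by apply: ler_wpM2l => //; apply: wn; rewrite (leq_trans _ (leq_addl _ _)).
    by apply: ler_wpM2r => //; rewrite /kap lerDr addr_ge0.
  have -> : (k + e1) * (2 * kap) * W = k * (kap * W + kap * W) + e1 * (kap * W + kap * W) by ring.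
  by rewrite lerD// ler_wpM2l ?(ltW e10)// lerD.
have iA1 i : P.-integrable setT (EFin \o A1 i) /\
    \int[P]_z A1 i z = 1 - lrisk (tnth u i) t1 c1.
  have [l1 l2 l3] := lrisk_sure (tnth u i) t1 c1b.
  have ms : measurable_fun setT (fun x : R => sure x t1 c1).
    by apply: measurable_sure; [exact: measurable_id|exact: measurable_cst|exact: measurable_cst].
  have [h1 h2] := lawz (fun x => sure x t1 c1) i ms l2; split => //.
  by rewrite h2 l3; ring.
have [iH1 iH2] := Rint_sum (index_enum 'I_d) (fun i => (iH i).1).
have [iB1 iB2] := Rint_sum (index_enum 'I_d) (fun i => (iA1 i).1).
have [iHB _] := Rint_add iH1 (integrable_norm iB1).
have hAB z : `|\sum_i (Q i z + A i z) - \sum_i A1 i z| <= \sum_i H i z.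
  by rewrite -sumrB (le_trans (ler_norm_sum _ _ _))// ler_sum.
have iA : P.-integrable setT (EFin \o (fun z => \sum_i (Q i z + A i z))).
  apply: (integrable_le _ _ iHB) => [|z].
    by apply: measurable_sum => i; exact: measurable_funD.
  have -> : \sum_i (Q i z + A i z) = (\sum_i (Q i z + A i z) - \sum_i A1 i z) + \sum_i A1 i z.
    by rewrite subrK.
  by rewrite (le_trans (ler_normD _ _))// lerD.
have := Rint_absB iA iB1 iH1 hAB.
rewrite iB2 iH2 => h.
have [iF eF] := Rint_scale (-1) iA.
exists (1 - d%:R^-1 * \int[P]_z (\sum_i (Q i z + A i z))).
  rewrite mulrBr mulr1 mulVKf ?pnatr_eq0 -?lt0n// EFinB /Rhat; congr (_ + _)%E.
  transitivity (\int[lebesgue_tuple R d]_z (F z * gden u z)%:E)%E.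
    apply: eq_integral => z _; congr EFin; rewrite /Hhat; congr (_ * _); last first.
      by apply: eq_bigr => i _; rewrite hu; congr phi; ring.
    congr (- _); apply: eq_bigr => i _.
    by rewrite /Q /A /sure /T /G /dt /dc; ring.
  rewrite integral_gmeas// -EFinN.
  have -> : - (\int[P]_z (\sum_i (Q i z + A i z))) = -1 * \int[P]_z (\sum_i (Q i z + A i z)).
    by rewrite mulN1r.
  rewrite -eF -EFin_Rint//; apply: eq_integral => z _; congr EFin.
  by rewrite /F mulN1r.
have -> : plug psit psic ft fc u = 1 - d%:R^-1 * \sum_i \int[P]_z A1 i z.
  have -> : 1 - d%:R^-1 * \sum_i \int[P]_z A1 i z =
      avg (fun _ : 'I_d => 1) - avg (fun i => \int[P]_z A1 i z) by rewrite avg_cst.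
  rewrite -avgB; congr (_ * _); apply: eq_bigr => i _.
  by rewrite (iA1 i).2 /t1 /c1; ring.
have swap (v0 v1 v2 : R) : 1 - v2 * v0 - (1 - v2 * v1) = v2 * - (v0 - v1) by ring.
rewrite swap normrM ger0_norm ?invr_ge0// normrN.
apply: (@le_trans _ _ (avg (fun i => (k + e1) * (2 * kap) * wt (tnth u i) ^+ (N * 2 + 12) + M * (2 * e2)))).
  rewrite ler_wpM2l ?invr_ge0// (le_trans h)// ler_sum// => i _; exact: (iH i).2.
rewrite avgD avg_cst// avgZ.
have r1 : k * (2 * kap) * K <= eta / 3.
  have -> : k * (2 * kap) * K = M2 * D * (2 * kap) * K / d%:R by rewrite /k; ring.
  by rewrite ler_pdivrMr// hD3.
have r2 : e1 * (2 * kap) * (K + 1) = eta / 3.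
  have -> : e1 * (2 * kap) * (K + 1) = eta / 3 / (2 * kap * (K + 1)) * (2 * kap * (K + 1)).
    by rewrite -mulrA.
  by rewrite divfK// gt_eqF.
have r3 : M * (2 * e2) <= eta / 3.
  have -> : eta / 3 = (M + 1) * (2 * e2).
    have -> : (M + 1) * (2 * e2) = eta / 3 / (2 * (M + 1)) * (2 * (M + 1)) by rewrite /e2; ring.
    by rewrite divfK// gt_eqF.
  by apply: ler_wpM2r; [apply: mulr_ge0 => //; exact: ltW|rewrite lerDl].
have -> : eta = eta / 3 + eta / 3 + eta / 3 by field.
rewrite lerD// (mulrDl k e1) (mulrDl (k * (2 * kap))) lerD//.
  apply: le_trans r1; apply: ler_wpM2l => //; apply: mulr_ge0 => //.
  by apply: mulr_ge0 => //; exact: ltW.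
rewrite -r2; apply: ler_wpM2l; last by apply: (le_trans hK); rewrite lerDl.
by apply: mulr_ge0; [exact: ltW|apply: mulr_ge0 => //; exact: ltW].
Qed.

End rhat_estimate.

(** * Events of high probability *)

Section empirical_score.
Context {R : realType}.

Lemma is_derive_phi (x : R) : is_derive x 1 (@phi R) (- x * phi x).
Proof.
have h1 : is_derive x 1 (fun x : R => - (x ^+ 2 / 2)) (- x).
  apply: is_derive_eq.
  have sc (r s : R) : r *: (s : R^o) = r * s by [].
  by rewrite !sc; field.
have h2 := @is_derive1_comp R (@expR R) _ x _ _ (is_derive_expR _) h1.
have h3 := @is_deriveZ _ _ _ _ (normal_peak (1 : R)) _ _ _ h2.
rewrite (_ : @phi R = normal_peak (1 : R) *: (expR \o (fun x : R => - (x ^+ 2 / 2)))).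
  suff -> : - x * (normal_peak (1 : R) *: (expR \o (fun x : R => - (x ^+ 2 / 2)))) x =
      normal_peak 1 *: (expR (- (x ^+ 2 / 2)) * - x) by [].
  transitivity (- x * (normal_peak 1 * expR (- (x ^+ 2 / 2)))) => //.
  transitivity (normal_peak 1 * (expR (- (x ^+ 2 / 2)) * - x)) => //.
  ring.
by apply/funext => y; rewrite phiE.
Qed.

Lemma mixture_empirical d (theta : d.-tuple R) z : (0 < d)%N ->
  mixture (empirical theta) z = d%:R^-1 * \sum_i phi (z - tnth theta i).
Proof.
move=> d0; rewrite /mixture /Rintegral /empirical.
have mp : measurable_fun setT (fun x : measurableTypeR R => (phi (z - x))%:E).
  apply/measurable_EFinP; apply: (measurableT_comp (@measurable_phi R)).
  by apply: measurable_funB => //; exact: measurable_cst.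
have p0 (x : measurableTypeR R) : (0 <= (phi (z - x))%:E)%E by rewrite lee_fin phi_ge0.
rewrite ge0_integral_mscale// ge0_integral_measure_sum//.
rewrite (eq_bigr (fun i : 'I_d => (phi (z - tnth theta i))%:E)); last first.
  by move=> i _; rewrite integral_dirac// diracT mul1e (tnth_nth 0).
by rewrite sumEFin.
Qed.

(** Markov's inequality for the squared error of the score needs this. The score is a derivative of
    a logarithm; for a finite Gaussian mixture it is a quotient of explicit sums. *)
Lemma measurable_score_empirical d (theta : d.-tuple R) : (0 < d)%N ->
  measurable_fun setT (score (empirical theta)).
Proof.
move=> d0.
pose m z := d%:R^-1 * \sum_i phi (z - tnth theta i).
pose m' z := d%:R^-1 * \sum_i (- (z - tnth theta i) * phi (z - tnth theta i)).
have dr : 0 < d%:R^-1 :> R by rewrite invr_gt0 ltr0n.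
have m0 z : 0 < m z.
  rewrite mulr_gt0//; have i0 := Ordinal d0.
  rewrite (bigD1 i0)//= ltr_wpDr ?phi_gt0//.
  by apply: sumr_ge0 => i _; exact: phi_ge0.
have dm (z : R) : is_derive z 1 m (m' z).
  have ds : is_derive z 1 (\sum_(i < d) (fun z => phi (z - tnth theta i)))
      (\sum_(i < d) (- (z - tnth theta i) * phi (z - tnth theta i))).
    apply: is_derive_sum => i.
    have h1 : is_derive z 1 (fun z : R => z - tnth theta i) 1.
      apply: is_derive_eq; by rewrite subr0.
    have h2 := is_derive_phi (z - tnth theta i).
    have := @is_derive1_comp R (@phi R) (fun z => z - tnth theta i) z _ _ h2 h1.
    by rewrite mulr1.
  rewrite (_ : m = d%:R^-1 *: (\sum_(i < d) (fun z => phi (z - tnth theta i)))); last first.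
    by apply/funext => x; rewrite /m /= fct_sumE.
  apply: is_derive_eq.
  by [].
have E : score (empirical theta) = (fun z => (m z)^-1 * m' z).
  apply/funext => z; rewrite /score derive1E.
  rewrite (_ : (fun z => _) = @ln R \o m); last first.
    by apply/funext => x /=; rewrite mixture_empirical.
  have h2 := is_derive1_ln (m0 z).
  have := @is_derive1_comp _ _ _ _ _ _ h2 (dm z).
  by move=> [_ ->].
rewrite E.
have ms i : measurable_fun setT (fun z : R => z - tnth theta i).
  by apply: measurable_funB => //; exact: measurable_cst.
have mphi i : measurable_fun setT (fun z : R => phi (z - tnth theta i)).
  exact: (measurableT_comp (@measurable_phi R)).
apply: measurable_funM.
  rewrite (_ : (fun _ => _) = (fun z => `|m z| `^ (- 1))); last first.
    by apply/funext => z; rewrite powR_inv1// gtr0_norm.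
  apply: measurable_powR2; last exact: measurable_cst.
  apply: measurableT_comp => //; apply: measurable_funM => //.
  by apply: measurable_sum => i; exact: mphi.
apply: measurable_funM => //; apply: measurable_sum => i.
apply: measurable_funM => //; exact: measurableT_comp.
Qed.

End empirical_score.

Section outer_probability.
Context disp (Omega : measurableType disp) (R : realType) (P : probability Omega R).
Local Open Scope ereal_scope.

Lemma outer_le (A B : set Omega) : A `<=` B -> (P^*)%mu A <= (P^*)%mu B.
Proof. exact: le_mu_ext. Qed.

Lemma outer_ge0 (A : set Omega) : 0 <= (P^*)%mu A.
Proof. by apply: mu_ext_ge0 => X; exact: measure_ge0. Qed.

Lemma outer_U2 (A B : set Omega) : (P^*)%mu (A `|` B) <= (P^*)%mu A + (P^*)%mu B.
Proof. exact: outer_measureU2. Qed.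

(** Events built from [nomad] or [lhat] need not be measurable, so all bounds are stated for the
    outer measure. Here the event lies in a measurable superlevel set. *)
Lemma outer_markov (f : Omega -> R) (a c : R) : (0 < a)%R ->
  measurable_fun setT f -> (forall w, (0 <= f w)%R) ->
  \int[P]_w (f w)%:E <= (a * c)%:E ->
  (P^*)%mu [set w | (a < f w)%R] <= c%:E.
Proof.
move=> a0 mf f0 hf.
have mf' : measurable_fun setT (EFin \o f) by exact/measurable_EFinP.
have h := @le_integral_abse _ _ _ P setT measurableT (EFin \o f) a mf' a0.
have mA : measurable [set w | a%:E <= `|(EFin \o f) w|].
  rewrite -[X in measurable X]setTI.
  apply: emeasurable_fun_c_infty => //.
  exact: measurableT_comp.
rewrite setTI -(measurable_mu_extE P mA) in h.
have {}h : a%:E * (P^*)%mu [set w | a%:E <= `|(EFin \o f) w|] <= (a * c)%:E.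
  apply: le_trans h (le_trans _ hf); rewrite le_eqVlt; apply/orP; left; apply/eqP.
  by apply: eq_integral => w _ /=; rewrite ger0_norm.
rewrite -(@lee_pmul2l _ a%:E)// -EFinM; apply: le_trans h.
rewrite lee_pmul2l//; apply: outer_le => w /= aw.
by rewrite lee_fin (le_trans (ltW aw))// ler_norm.
Qed.

Lemma cvge0_lt (x : nat -> \bar R) : x d @[d --> \oo] --> 0 ->
  forall k : R, (0 < k)%R -> exists D0, forall d, (D0 <= d)%N -> x d < k%:E.
Proof.
move=> hx k k0.
have nk : nbhs (0 : \bar R) [set y | y < k%:E].
  have [e e0 he] : nbhs (0 : R)%R [set r : R | (r < k)%R].
    by exists k => //= r /=; rewrite distrC subr0; apply: le_lt_trans; exact: ler_norm.
  by exists e => // r /he /=; rewrite lte_fin.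
by have [D0 _ h] := hx _ nk; exists D0 => d; exact: h.
Qed.

Lemma cvge0_intro (x : nat -> \bar R) : (forall d, 0 <= x d) ->
  (forall k : R, (0 < k)%R -> exists D0, forall d, (D0 <= d)%N -> x d <= k%:E) ->
  x d @[d --> \oo] --> 0.
Proof.
move=> x0 h A [e /= e0 he].
have [D0 hD] := h (e / 2)%R (divr_gt0 e0 (ltr0Sn _ 1)).
exists D0 => // d /= hd.
have := hD d hd; have := x0 d; case: (x d) => [r| |]//=.
rewrite !lee_fin => r0 re; apply: he => /=.
rewrite sub0r normrN ger0_norm// (le_lt_trans re)// ltr_pdivrMr//.
by rewrite ltr_pMr// ltr1n.
Qed.

End outer_probability.

Lemma ge0_integral_avg disp (Omega : measurableType disp) (R : realType)
  (P : probability Omega R) d (f : 'I_d -> Omega -> R) :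
  (forall i, measurable_fun setT (f i)) -> (forall i w, 0 <= f i w) ->
  (\int[P]_w (avg (fun i => f i w))%:E =
   (d%:R^-1)%:E * \sum_(i < d) \int[P]_w (f i w)%:E)%E.
Proof.
move=> mf f0.
have mf' i : measurable_fun setT (fun w => (f i w)%:E) by exact/measurable_EFinP.
rewrite -ge0_integral_sum//; last by move=> i w _; rewrite lee_fin.
rewrite -ge0_integralZl//; last 2 first.
- exact: emeasurable_sum.
- by move=> w _; apply: sume_ge0 => i _; rewrite lee_fin.
by apply: eq_integral => w _; rewrite /avg EFinM sumEFin.
Qed.

Section event.
Context {R : realType} disp (Omega : measurableType disp) (P : probability Omega R).
Variables (theta : forall d : nat, d.-tuple R) (eps : forall d : nat, 'I_d -> Omega -> R).
Arguments eps : clear implicits.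
Hypothesis hiid : forall d : nat, iid_std_normal P (eps d).

Notation obs d w := (observation (theta d) (eps d) w).

Section moments.
Hypothesis hexp : exists2 lambda0 : R, 0 < lambda0 & exists B : R,
  forall d, (0 < d)%N ->
    d%:R^-1 * \sum_(i < d) expR (lambda0 * `|tnth (theta d) i|) <= B.

(** The comparison [wt x <= (1 + l^-1) * wt (l * x)] rescales the argument, so that [wtX_le_exp]
    produces exponentials of exactly the rate averaged in the hypothesis. *)
Lemma theta_moment p : exists2 B : R, 0 <= B & forall d, (0 < d)%N ->
  avg (fun i => wt (tnth (theta d) i) ^+ p) <= B.
Proof.
have [l l0 [B hB]] := hexp; have [K K0 hK] := @wtX_le_exp R p.
pose k := (1 + l^-1) ^+ p * (K * 2).
have li : 0 <= l^-1 by rewrite invr_ge0 ltW.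
have k0 : 0 <= k by rewrite mulr_ge0 ?exprn_ge0 ?addr_ge0// mulr_ge0.
exists (k * `|B|) => [|d d0]; first by rewrite mulr_ge0.
apply: (@le_trans _ _ (avg (fun i => k * expR (l * `|tnth (theta d) i|)))).
  apply: ler_avg => i; set x := tnth _ _.
  apply: (@le_trans _ _ ((1 + l^-1) ^+ p * wt (l * x) ^+ p)).
    rewrite -exprMn lerXn2r ?nnegrE ?mulr_ge0 ?wt_ge0 ?addr_ge0//.
    rewrite /wt normrM (gtr0_norm l0).
    have -> : (1 + l^-1) * (1 + l * `|x|) = 1 + `|x| * (l^-1 * l) + (l^-1 + l * `|x|) by ring.
    by rewrite mulVf ?gt_eqF// mulr1 lerDl addr_ge0// mulr_ge0// ltW.
  rewrite /k -mulrA ler_wpM2l ?exprn_ge0 ?addr_ge0//.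
  apply: (le_trans (hK _)); rewrite -mulrA ler_wpM2l//.
  have e1 : expR (l * x) <= expR (l * `|x|).
    by rewrite ler_expR ler_wpM2l ?ler_norm// ltW.
  have e2 : expR (- (l * x)) <= expR (l * `|x|).
    by rewrite ler_expR -mulrN ler_wpM2l ?(ltW l0)// -normrN ler_norm.
  by lra.
by rewrite avgZ; apply: ler_wpM2l => //; apply: (le_trans (hB _ d0)); exact: ler_norm.
Qed.

Lemma weight_markov p kap : 0 < kap -> exists2 v : R, 0 < v & forall d, (0 < d)%N ->
  ((P^*)%mu [set w | (v < avg (fun i => (wt (tnth (theta d) i) * wt (eps d i w)) ^+ p))%R]
    <= kap%:E)%E.
Proof.
move=> kap0; have [B B0 hB] := theta_moment p.
have g0 : 0 <= gmom R p := le_trans ler01 (gmom_ge1 _ _).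
(* Markov's level: [kap] times it is at least the bound [B * gmom R p] on the mean. The 1 keeps it
   positive. *)
exists (gmom R p * B / kap + 1) => [|d d0].
  by rewrite ltr_wpDl// divr_ge0 ?mulr_ge0// ltW.
have [me _ _] := hiid d.
have mw i : measurable_fun setT (fun w => wt (eps d i w) ^+ p).
  by apply: measurable_funX; apply: (measurableT_comp (@mwt R)).
have mf i : measurable_fun setT (fun w => (wt (tnth (theta d) i) * wt (eps d i w)) ^+ p).
  by apply: measurable_funX; apply: measurable_funM => //; apply: (measurableT_comp (@mwt R)).
have f0 i w : 0 <= (wt (tnth (theta d) i) * wt (eps d i w)) ^+ p.
  by rewrite exprn_ge0// mulr_ge0 ?wt_ge0.
apply: outer_markov.
- by rewrite ltr_wpDl// divr_ge0 ?mulr_ge0// ltW.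
- by apply: measurable_funM => //; exact: measurable_sum.
- by move=> w; exact: avg_ge0.
rewrite ge0_integral_avg//.
have E i : (\int[P]_w ((wt (tnth (theta d) i) * wt (eps d i w)) ^+ p)%:E =
    (wt (tnth (theta d) i) ^+ p * gmom R p)%:E)%E.
  under eq_integral do rewrite exprMn EFinM.
  rewrite ge0_integralZl//; last 3 first.
  - exact/measurable_EFinP.
  - by move=> w _; rewrite lee_fin exprn_ge0// wt_ge0.
  - by rewrite lee_fin exprn_ge0// wt_ge0.
  rewrite (ge0_law (hiid d) i (h := fun e => (wt e ^+ p)%:E)); last 2 first.
  - by apply/measurable_EFinP; apply: measurable_funX; exact: mwt.
  - by move=> x; rewrite lee_fin exprn_ge0// wt_ge0.
  by rewrite gmomE EFinM.
under eq_bigr do rewrite E.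
rewrite sumEFin -EFinM lee_fin -mulr_suml mulrA.
have -> : (gmom R p * B / kap + 1) * kap = B * gmom R p + kap.
  by rewrite mulrDl divfK ?gt_eqF// mul1r mulrC.
apply: (@le_trans _ _ (B * gmom R p)); last by rewrite lerDl ltW.
by rewrite ler_wpM2r//; exact: hB.
Qed.

Section score_event.
Variables (G : probability (measurableTypeR R) R).
Variables (lhat : forall d : nat, d.-tuple R -> R -> R) (a : nat -> R).
Arguments lhat : clear implicits.
Hypothesis ha : a d @[d --> \oo] --> +oo.
Hypothesis hlhat : cvg0_in_prob P (fun d w => ereal_sup
  [set (`|lhat d (obs d w) z - score G z|)%:E | z in [set z : R | `|z| <= a d]]).
Hypothesis hl : ereal_sup [set (`|score (empirical (theta d)) z - score G z|)%:E
  | z in [set z : R | `|z| <= a d]] @[d --> \oo] --> 0%E.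
Hypothesis hM : exists M : nat -> R -> R, exists CM q : R,
  [/\ 2 <= q, forall d, measurable_fun setT (M d),
     forall d y z, (0 < d)%N ->
       `|lhat d y z| + `|score (empirical (theta d)) z| <= M d z &
     forall d z, (0 < d)%N -> M d z ^+ 2 <= CM * (1 + `|z| `^ q)].
Hypothesis hscore : ((d%:R^-1)%:E * \sum_(i < d)
  'E_P[fun w => (let zi := tnth (theta d) i + eps d i w in
    (tnth (theta d) i - zi - score (empirical (theta d)) zi) ^+ 2)%R])%E
  @[d --> \oo] --> 0%E.

(** Tweedie's formula with the estimated score. *)
Definition denoised d (w : Omega) : d.-tuple R :=
  [tuple tnth (obs d w) i + lhat d (obs d w) (tnth (obs d w) i) | i < d].

Arguments denoised : clear implicits.

(** [M d z <= 1 + M d z ^+ 2] turns the bound on the square into polynomial growth, uniformly in [d]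
    and [y]. *)
Lemma score_growth : exists C1 : R, exists n : nat, 0 <= C1 /\
  forall d (y : d.-tuple R) z, (0 < d)%N ->
    `|lhat d y z| + `|score (empirical (theta d)) z| <= C1 * wt z ^+ n.
Proof.
have [M [CM [q [q2 _ hM1 hM2]]]] := hM.
have q0 : 0 <= q by apply: le_trans q2.
exists (1 + 2 * `|CM|), (Num.truncn q).+1; split => [|d y z d0]; first by rewrite addr_ge0// mulr_ge0.
set n := (Num.truncn q).+1.
have qn : 0 <= q <= n%:R by rewrite q0 ltW// truncnS_gt.
apply: (le_trans (hM1 d y z d0)).
have h1 := hM2 d z d0; have h2 := powR_le_wt z qn; have h3 := wtX_ge1 z n.
have h4 : M d z <= 1 + M d z ^+ 2.
  by have := sqr_ge0 (M d z - 2^-1); rewrite !expr2; lra.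
apply: (le_trans h4); apply: (@le_trans _ _ (1 + `|CM| * (2 * wt z ^+ n))).
  rewrite lerD2l (le_trans h1)//.
  apply: (@le_trans _ _ (`|CM| * (1 + `|z| `^ q))).
    by rewrite ler_wpM2r ?ler_norm// addr_ge0// powR_ge0.
  by rewrite ler_wpM2l//; lra.
have -> : (1 + 2 * `|CM|) * wt z ^+ n = wt z ^+ n + `|CM| * (2 * wt z ^+ n) by ring.
by rewrite lerD2r.
Qed.

(** [K] comes before [delta] because the accuracy that the risk estimates demand depends on [K]. The
    error of [denoised] splits into that of the oracle score, small in mean square by hypothesis,
    and the gap between the two scores: uniformly small for [|y| <= a d], and otherwise with a
    square at most its growth bound times [|y| / a d]. *)
Lemma denoised_event m kap : 0 < kap -> exists2 K : R, 0 <= K &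
  forall delta : R, 0 < delta -> exists D0 : nat, forall d, (0 < d)%N -> (D0 <= d)%N ->
  ((P^*)%mu (~` [set w |
     (avg (fun i => (wt (tnth (theta d) i) * wt (tnth (denoised d w) i)) ^+ m) <= K)%R /\
     (avg (fun i => (tnth (theta d) i - tnth (denoised d w) i) ^+ 2) <= delta)%R])
    <= kap%:E)%E.
Proof.
move=> kap0; have [C1 [n [C10 hC]]] := score_growth.
have k3 : 0 < kap / 3 by rewrite divr_gt0.
(* The first exponent serves the weight of [denoised], at most [C2 * W ^+ n.+1]; the second serves
   the squared growth of the scores with one more power of [|y|], spent on the tail. *)
pose p := maxn (n.+2 * m) (n * 2).+1.
have [v v0 hv] := weight_markov p k3.
pose C2 := 1 + C1.
have C20 : 0 <= C2 by rewrite addr_ge0.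
exists (C2 ^+ m * v) => [|delta de0]; first by rewrite mulr_ge0 ?exprn_ge0// ltW.
(* The final bound contains [8 * rho ^+ 2], which is at most [delta / 4] since
   [rho ^+ 2 <= rho <= delta / 32]. *)
pose rho := Num.min 1 (delta / 32).
have r0 : 0 < rho by rewrite /rho lt_min ltr01 divr_gt0.
have r1 : rho <= 1 by rewrite /rho ge_min lexx.
have r2 : rho <= delta / 32 by rewrite /rho ge_min lexx orbT.
have d4 : 0 < delta / 4 by rewrite divr_gt0.
have [D1 hD1] := cvge0_lt hscore (mulr_gt0 d4 k3).
have [D2 hD2] := cvge0_lt (hlhat r0) k3.
have [D3 hD3] := cvge0_lt hl r0.
(* Makes the tail contribution [2 * C1 ^+ 2 / a d * v] at most [delta / 4]. *)
have [D4 _ hD4] : \forall d \near \oo, C1 ^+ 2 * v * (8 / delta) + 1 <= a d.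
  by move/cvgryPge : ha; apply.
exists (maxn (maxn D1 D2) (maxn D3 D4)) => d d0.
rewrite !geq_max => /andP[/andP[d1 d2] /andP[d3 d5]].
have {}hD1 := hD1 d d1; have {}hD2 := hD2 d d2; have {}hD3 := hD3 d d3.
have {}hD4 : C1 ^+ 2 * v * (8 / delta) + 1 <= a d := hD4 d d5.
pose s := score (empirical (theta d)).
pose V w := avg (fun i => (wt (tnth (theta d) i) * wt (eps d i w)) ^+ p).
pose Z i w := (tnth (theta d) i - (tnth (theta d) i + eps d i w) - s (tnth (theta d) i + eps d i w)) ^+ 2.
pose D w := ereal_sup [set (`|lhat d (obs d w) z - score G z|)%:E | z in [set z : R | `|z| <= a d]].
pose b1 := [set w | v < V w].
pose b2 := [set w | delta / 4 < avg (fun i => Z i w)].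
pose b3 := [set w | (rho%:E < `|D w|)%E].
have [me _ _] := hiid d.
have mZ i : measurable_fun setT (Z i).
  have mo : measurable_fun setT (fun w => tnth (theta d) i + eps d i w).
    by apply: measurable_funD => //; exact: measurable_cst.
  apply: measurable_funX; apply: measurable_funB; first exact: measurable_funB.
  exact: (measurableT_comp (measurable_score_empirical (theta d) d0)).
have hb2 : ((P^*)%mu b2 <= (kap / 3)%:E)%E.
  apply: outer_markov => //.
  - by apply: measurable_funM => //; exact: measurable_sum.
  - by move=> w; apply: avg_ge0 => i; exact: sqr_ge0.
  - rewrite ge0_integral_avg//; last by move=> i w; exact: sqr_ge0.
    apply: le_trans _ (ltW hD1).
    have -> : (\sum_(i < d) \int[P]_w (Z i w)%:E = \sum_(i < d) 'E_P[Z i])%E.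
      by apply: eq_bigr => i _; rewrite unlock.
    exact: lexx.
apply: (@le_trans _ _ ((P^*)%mu (b1 `|` (b2 `|` b3)))).
  apply: outer_le => w /= hw; apply: contrapT => hn; apply: hw.
  have h1 : V w <= v by rewrite leNgt; apply/negP => h; apply: hn; left.
  have h2 : avg (fun i => Z i w) <= delta / 4.
    by rewrite leNgt; apply/negP => h; apply: hn; right; left.
  have h3 : (`|D w| <= rho%:E)%E.
    by rewrite leNgt; apply/negP => h; apply: hn; right; right.
  have wy i : wt (tnth (obs d w) i) <= wt (tnth (theta d) i) * wt (eps d i w).
    by rewrite tnth_mktuple wtD.
  have W0 i : 0 <= wt (tnth (theta d) i) * wt (eps d i w) by rewrite mulr_ge0 ?wt_ge0.
  have W1 i : 1 <= wt (tnth (theta d) i) * wt (eps d i w).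
    by rewrite -[1]mul1r ler_pM ?wt_ge1.
  split.
    apply: (@le_trans _ _ (C2 ^+ m * V w)); last by rewrite ler_wpM2l ?exprn_ge0.
    rewrite -avgZ; apply: ler_avg => i; rewrite [tnth (denoised d w) i]tnth_mktuple.
    set W := wt (tnth (theta d) i) * wt (eps d i w).
    set y := tnth (obs d w) i.
    have hy : wt y <= W by exact: wy.
    have w1 : wt (y + lhat d (obs d w) y) <= C2 * W ^+ n.+1.
      apply: (le_trans (wtD _ _)).
      have q1 : wt (lhat d (obs d w) y) <= C2 * wt y ^+ n.
        rewrite /C2 mulrDl mul1r /wt -/(wt y) lerD ?wtX_ge1//.
        by apply: le_trans (hC d (obs d w) y d0); rewrite lerDl.
      apply: (le_trans (ler_wpM2l (wt_ge0 y) q1)).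
      rewrite mulrCA -exprS ler_wpM2l// lerXn2r ?nnegrE ?wt_ge0//; exact: W0.
    apply: (@le_trans _ _ (C2 ^+ m * W ^+ (n.+2 * m))); last first.
      by rewrite ler_wpM2l ?exprn_ge0// ler_weXn2l// ?W1// leq_maxl.
    have Wp : 0 <= C2 * W ^+ n.+2 by apply: mulr_ge0 => //; apply: exprn_ge0; exact: W0.
    have Lp : 0 <= wt (tnth (theta d) i) * wt (y + lhat d (obs d w) y) by rewrite mulr_ge0 ?wt_ge0.
    rewrite exprM -exprMn lerXn2r ?nnegrE//.
    rewrite [W ^+ n.+2]exprS mulrCA; apply: ler_pM; rewrite ?wt_ge0//.
    by rewrite /W ler_peMr ?wt_ge0 ?wt_ge1.
  have ap : 0 < a d.
    apply: lt_le_trans hD4; rewrite ltr_wpDl// mulr_ge0//; first by rewrite mulr_ge0 ?sqr_ge0// ltW.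
    by rewrite divr_ge0// ltW.
  have pw i : (tnth (theta d) i - tnth (denoised d w) i) ^+ 2 <=
      2 * Z i w + (8 * rho ^+ 2 + (2 * C1 ^+ 2 / a d) * (wt (tnth (theta d) i) * wt (eps d i w)) ^+ p).
    rewrite tnth_mktuple; set y := tnth (obs d w) i.
    have yE : tnth (theta d) i + eps d i w = y by rewrite /y tnth_mktuple.
    rewrite /Z yE.
    set lh := lhat d (obs d w) y.
    have q1 : (lh - s y) ^+ 2 <= 4 * rho ^+ 2 + (C1 ^+ 2 / a d) * (wt (tnth (theta d) i) * wt (eps d i w)) ^+ p.
      have t0 : 0 <= (C1 ^+ 2 / a d) * (wt (tnth (theta d) i) * wt (eps d i w)) ^+ p.
        by rewrite mulr_ge0 ?exprn_ge0// divr_ge0 ?sqr_ge0// ltW.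
      rewrite -(real_normK (num_real _)).
      have [ya|ya] := leP `|y| (a d).
        apply: (@le_trans _ _ (4 * rho ^+ 2)); last by rewrite lerDl.
        have g1 : `|lh - score G y| <= rho.
          rewrite -lee_fin; apply: le_trans (le_trans (lee_abs _) h3).
          by apply: ereal_sup_ubound; exists y.
        have g2 : `|s y - score G y| <= rho.
          rewrite -lee_fin; apply: le_trans (ltW hD3).
          by apply: ereal_sup_ubound; exists y.
        have g3 : `|lh - s y| <= 2 * rho.
          have -> : lh - s y = (lh - score G y) - (s y - score G y) by ring.
          by apply: (le_trans (ler_normB _ _)); lra.
        have -> : 4 * rho ^+ 2 = (2 * rho) ^+ 2 by ring.
        by rewrite lerXn2r ?nnegrE// (le_trans _ g3).
      apply: (@le_trans _ _ ((C1 ^+ 2 / a d) * (wt (tnth (theta d) i) * wt (eps d i w)) ^+ p)); last first.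
        by rewrite lerDr mulr_ge0// sqr_ge0.
      have g1 : `|lh - s y| <= C1 * wt y ^+ n.
        by apply: (le_trans (ler_normB _ _)); exact: hC.
      apply: (@le_trans _ _ ((C1 * wt y ^+ n) ^+ 2)).
        by rewrite lerXn2r ?nnegrE// (le_trans _ g1).
      rewrite exprMn -mulrA ler_wpM2l ?sqr_ge0//.
      rewrite mulrC ler_pdivlMr// -exprM.
      apply: (@le_trans _ _ (wt y ^+ (n * 2).+1)).
        rewrite exprSr ler_wpM2l ?exprn_ge0 ?wt_ge0//.
        by rewrite (le_trans (ltW ya))// norm_le_wt.
      apply: (@le_trans _ _ ((wt (tnth (theta d) i) * wt (eps d i w)) ^+ (n * 2).+1)).
        by rewrite lerXn2r ?nnegrE ?wt_ge0//; exact: wy.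
      by rewrite ler_weXn2l// leq_maxr.
    have -> : tnth (theta d) i - (y + lh) = (tnth (theta d) i - y - s y) - (lh - s y) by ring.
    have dbl (x z : R) : (x - z) ^+ 2 <= 2 * x ^+ 2 + 2 * z ^+ 2.
      by have := sqr_ge0 (x + z); rewrite sqrrD sqrrB; lra.
    apply: (le_trans (dbl _ _)); rewrite lerD2l.
    apply: (le_trans (ler_wpM2l (ler0n _ 2) q1)).
    by rewrite le_eqVlt; apply/orP; left; apply/eqP; ring.
  apply: (le_trans (ler_avg pw)); rewrite !avgD !avgZ avg_cst// -/(V w).
  have z1 : rho ^+ 2 <= delta / 32 by rewrite expr2 (le_trans _ r2)// ler_piMr// ltW.
  have z2 : 2 * C1 ^+ 2 / a d * V w <= delta / 4.
    apply: (@le_trans _ _ (2 * C1 ^+ 2 / a d * v)).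
      by rewrite ler_wpM2l// divr_ge0 ?mulr_ge0 ?sqr_ge0// ltW.
    rewrite mulrAC ler_pdivrMr//.
    apply: (@le_trans _ _ (delta / 4 * (C1 ^+ 2 * v * (8 / delta)))).
      rewrite le_eqVlt; apply/orP; left; apply/eqP; field.
      by rewrite gt_eqF.
    by apply: ler_wpM2l; [exact: ltW|apply: le_trans hD4; rewrite lerDl].
  by move: h2 z1 z2; clear; lra.
apply: (le_trans (outer_U2 _ _ _)).
apply: (@le_trans _ _ ((kap / 3)%:E + ((kap / 3)%:E + (kap / 3)%:E))%E).
  apply: leeD; first exact: hv.
  apply: (le_trans (outer_U2 _ _ _)); apply: leeD => //; exact: ltW.
by rewrite -!EFinD lee_fin; lra.
Qed.

End score_event.
End moments.

Section summary_event.
Context {q : nat} (psi : 'I_q -> R -> R) (C : R) (N : nat).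
Hypothesis C0 : 0 <= C.
Hypothesis hpsi : psi_tame psi C N.

(** Chebyshev's inequality from [summary_variance]. The centering uses [theta], the actual means of
    the data; [emean_mod] later moves it to the denoised vector. *)
Lemma summary_event K rho kap : 0 < rho -> 0 < kap -> exists D0 : nat,
  forall d, (0 < d)%N -> (D0 <= d)%N -> avg (fun i => wt (tnth (theta d) i) ^+ (N * 2)) <= K ->
  ((P^*)%mu (~` [set w | forall j,
      (`|summary psi (obs d w) 0 j - emean psi (theta d) 0 j| <= rho)%R]) <= kap%:E)%E.
Proof.
move=> r0 k0; pose k := q%:R * (2 * C * gmom R N) ^+ 2 * gmom R (N * 2).
have r2 : 0 < rho ^+ 2 by rewrite exprn_gt0.
have [D0 hD] := archi_le (k * K) (mulr_gt0 r2 k0).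
exists D0 => d d0 Dd hK.
have [v1 v2] := summary_variance C0 hpsi (theta d) (hiid d).
pose Y w := \sum_j (summary psi (obs d w) 0 j - emean psi (theta d) 0 j) ^+ 2.
have k00 : 0 <= k.
  have g0 : 0 <= gmom R (N * 2) := le_trans ler01 (gmom_ge1 _ _).
  by apply: mulr_ge0 => //; apply: mulr_ge0 => //; exact: sqr_ge0.
have dr : 0 < d%:R :> R by rewrite ltr0n.
have hm : \int[P]_w Y w <= rho ^+ 2 * kap.
  apply: (le_trans v2); rewrite -/k mulrAC ler_pdivrMr//.
  by apply: le_trans (hD _ Dd); rewrite ler_wpM2l.
apply: (@le_trans _ _ ((P^*)%mu [set w | rho ^+ 2 < Y w])).
  apply: outer_le => w /= h; rewrite ltNge; apply/negP => hY; apply: h => j.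
  rewrite -(@ler_pXn2r _ 2)// ?nnegrE ?(ltW r0)// real_normK ?num_real//.
  apply: le_trans hY; rewrite /Y (bigD1 j)//= lerDl.
  by apply: sumr_ge0 => i _; exact: sqr_ge0.
apply: outer_markov => //.
- by move/integrableP : v1 => [/measurable_EFinP + _].
- by move=> w; apply: sumr_ge0 => i _; exact: sqr_ge0.
- by rewrite EFin_Rint.
Qed.

End summary_event.
End event.

(** * Uniform approximation by the sieve *)

Section plug.
Context {R : realType} {qt qc : nat}.
Variables (psit : 'I_qt -> R -> R) (psic : 'I_qc -> R -> R) (B b : R).
Hypothesis hb : 0 <= b < 1.

(** With equal means the weight in [loss_mod] is [(wt u ^+ 2 * wt e) ^+ 12], whence the exponent
    24. *)
Lemma lrisk_mod eta : 0 < eta -> exists2 M : R, 0 <= M & forall u t t' c c',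
  `|t| <= B -> `|t'| <= B -> `|c| <= b -> `|c'| <= b ->
  `|lrisk u t c - lrisk u t' c'| <=
    eta * gmom R 12 * wt u ^+ 24 + M * ((t - t') ^+ 2 + (c - c') ^+ 2).
Proof.
move=> e0; have [M M0 hM] := loss_mod hb (normr_ge0 B) e0; exists M => // u t t' c c' tB tB' cb cb'.
have /andP[b0 b1] := hb.
have [i1 _ _] := lrisk_sure u t (le_lt_trans cb b1).
have [i2 _ _] := lrisk_sure u t' (le_lt_trans cb' b1).
have [p1 p2] := Rint_scale (eta * wt u ^+ 24) (integrable_wtX R 12).
have p3 : (N01 R).-integrable setT (EFin \o (fun=> M * ((t - t') ^+ 2 + (c - c') ^+ 2))).
  by apply: finite_measure_integrable_cst.
have [p4 p5] := Rint_add p1 p3.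
have := Rint_absB i1 i2 p4; rewrite p5 p2 (Rintegral_cst _ measurableT).
rewrite -[fine _]/(fine (N01 R setT)) probability_setT mulr1 mulrAC; apply => e.
have abs (x : R) : `|x| <= B -> `|x| <= `|B| by move=> h; rewrite (le_trans h)// ler_norm.
apply: (le_trans (hM u u e t t' c c' (abs _ tB) (abs _ tB') cb cb')).
rewrite subrr expr0n /= addr0 -expr2 exprMn -exprM mulrA.
exact: lexx.
Qed.

(** Only the values at the two mean summaries enter, so closeness is required at these points
    alone. *)
Lemma plug_close eta K : 0 < eta -> 0 <= K -> exists2 rho : R, 0 < rho &
  forall ft ft' fc fc' d (u : d.-tuple R), (0 < d)%N ->
    (forall s, `|ft s| <= B) -> (forall s, `|ft' s| <= B) ->
    (forall s, `|fc s| <= b) -> (forall s, `|fc' s| <= b) ->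
    avg (fun i => wt (tnth u i) ^+ 24) <= K ->
    `|ft (emean psit u) - ft' (emean psit u)| <= rho ->
    `|fc (emean psic u) - fc' (emean psic u)| <= rho ->
    `|plug psit psic ft fc u - plug psit psic ft' fc' u| <= eta.
Proof.
move=> e0 K0; pose g := gmom R 12; have g0 : 0 < g := lt_le_trans ltr01 (gmom_ge1 _ _).
have k0 : 0 < 2 * g * (K + 1) by rewrite !mulr_gt0// ltr_wpDl.
have [M M0 hM] := lrisk_mod (divr_gt0 e0 k0).
pose e1 := eta / (4 * (M + 1)).
have e10 : 0 < e1 by rewrite divr_gt0// mulr_gt0// ltr_wpDl.
exists (Num.min 1 e1) => [|ft ft' fc fc' d u d0 h1 h2 h3 h4 hK ht hc]; first by rewrite lt_min ltr01.
set t := ft _ in ht *; set t' := ft' _ in ht *; set c := fc _ in hc *; set c' := fc' _ in hc *.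
have sq x : `|x| <= Num.min 1 e1 -> x ^+ 2 <= e1.
  rewrite le_min => /andP[x1 xe]; rewrite -(real_normK (num_real x)) expr2.
  by rewrite (le_trans _ xe)// ler_piMl.
rewrite /plug -avgB; apply: le_trans (norm_avg_le _) _.
apply: (@le_trans _ _ (avg (fun i => eta / (2 * g * (K + 1)) * g * wt (tnth u i) ^+ 24 + M * (e1 + e1)))).
  apply: ler_avg => i; apply: le_trans (hM _ _ _ _ _ _ _ _ _) _ => //.
  by rewrite lerD2l ler_wpM2l// lerD// sq.
rewrite avgD avg_cst// avgZ [leRHS](splitr eta); apply: lerD.
  apply: (@le_trans _ _ (eta / (2 * g * (K + 1)) * g * (K + 1))).
    apply: ler_wpM2l; first by rewrite mulr_ge0// ?divr_ge0// ltW.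
    by rewrite (le_trans hK)// lerDl.
  rewrite le_eqVlt; apply/orP; left; apply/eqP; field.
  by rewrite !gt_eqF// ltr_wpDl.
have -> : eta / 2 = (M + 1) * (e1 + e1).
  rewrite /e1; field; by rewrite gt_eqF// ltr_wpDl.
by rewrite ler_wpM2r ?lerDl// addr_ge0// ltW.
Qed.

End plug.

Section growth.
Context {R : realType}.

Lemma smooth_psi_tame q (psi : 'I_q -> R -> R) C r : 0 <= C -> 0 <= r ->
  (forall j, smooth2 (psi j) /\ poly_growth2 (psi j) C r) ->
  psi_tame psi (2 * C) (Num.truncn r).+1.
Proof.
move=> C0 r0 h; split.
- by move=> j x; have [[+ _ _] _] := h j; apply.
- move=> j x; have [[_ + _] _] := h j => /(_ x).
  by move=> /derivable1_diffP; exact: differentiable_continuous.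
- move=> j x; have [_ /(_ x)] := h j.
  set n := (Num.truncn r).+1 => hx.
  have rn : 0 <= r <= n%:R by rewrite r0 ltW// truncnS_gt.
  have h1 := powR_le_wt x rn; have h2 := wtX_ge1 x n.
  have h3 : C * (1 + `|x| `^ r) <= 2 * C * wt x ^+ n.
    have -> : 2 * C * wt x ^+ n = C * (wt x ^+ n + wt x ^+ n) by ring.
    by rewrite ler_wpM2l// lerD.
  have a0 := normr_ge0 (psi j x); have a1 := normr_ge0 (derive1 (psi j) x).
  have a2 := normr_ge0 (derive1n 2 (psi j) x).
  by split; apply: le_trans h3; apply: le_trans hx; clear -a0 a1 a2; lra.
Qed.

Lemma extension_tame q (S : set 'rV[R]_q) ub L b ext : extension_rule S ub L b ext ->
  exists L', forall tau, smooth_class S ub L tau ->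
    (forall s, S s -> ext tau s = tau s) /\ tame L' b (ext tau).
Proof.
move=> [L' h]; exists L' => tau /h[h1 h2 h3 h4]; split => //; split => //.
Qed.

End growth.

Section net.
Context {R : realType} {q : nat} (S : set 'rV[R]_q).
Hypothesis hS : compact S.

Lemma finite_net eta : 0 < eta -> exists n (p : 'I_n -> 'rV[R]_q),
  (forall i, S (p i)) /\
  forall s, S s -> exists i, forall j, `|s 0 j - p i 0 j| <= eta.
Proof.
move=> e0; move: hS; rewrite compact_cover => h.
have [||D hD1 hD2] := h 'rV[R]_q S (fun s => (ball s eta)^°).
- by move=> s _; exact: open_interior.
- by move=> s Ss; exists s => //; apply: nbhsx_ballx.
pose D' := finmap.enum_fset D.
exists (size D'), (tnth (in_tuple D')); split.
  by move=> i; have := hD1 _ (mem_tnth i (in_tuple D')); rewrite inE.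
move=> s Ss; have [c /= cD /interior_subset sc] := hD2 _ Ss.
have ci : (index c D' < size D')%N by rewrite index_mem.
exists (Ordinal ci) => j; rewrite (tnth_nth c) /= nth_index//.
move: sc; rewrite mx_norm_ball /ball_ /= => sc; rewrite distrC; apply: le_trans (ltW sc).
rewrite [leRHS]/Num.Def.normr/= mx_normrE.
by apply: le_trans; last exact: (le_bigmax _ _ (0, j)); rewrite !mxE.
Qed.

(* The functions are uniformly Lipschitz on [S], so that up to [eta] they are
   determined by their discretized values on a finite net. *)
Lemma class_net L b ub (F : set ('rV[R]_q -> R)) (ext : ('rV[R]_q -> R) -> 'rV[R]_q -> R) eta :
  0 < eta ->
  (forall tau, F tau -> [/\ forall s, S s -> ext tau s = tau s, tame L b (ext tau) &
     forall s, S s -> 0 <= tau s <= ub]) ->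
  exists (T : finType) (key : ('rV[R]_q -> R) -> T), forall tau tau', F tau -> F tau' ->
    key tau = key tau' -> forall s, S s -> `|tau s - tau' s| <= eta.
Proof.
move=> e0 hF; pose k := `|L| * q%:R + 1.
have k0 : 0 < k by rewrite ltr_wpDl// mulr_ge0.
pose e1 := eta / 3 / k; have e10 : 0 < e1 by rewrite !divr_gt0.
have [n [p [pS hp]]] := finite_net e10.
(* Values at net points lie in [[0, ub]], so steps of [eta / 3] give indices at most [m], and
   [inord] below changes none of them. *)
pose m := Num.truncn (ub / (eta / 3)).
have e3 : 0 < eta / 3 by rewrite divr_gt0.
exists {ffun 'I_n -> 'I_m.+1}, (fun tau => [ffun i => inord (Num.truncn (tau (p i) / (eta / 3)))]).
move=> tau tau' Ft Ft' hk s Ss.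
have [x1 x2 x3] := hF _ Ft; have [y1 y2 y3] := hF _ Ft'.
have [i hi] := hp s Ss.
have lip f : tame L b f -> `|f s - f (p i)| <= eta / 3.
  move=> hf; apply: (le_trans (tame_lip_le hf hi)).
  rewrite /e1 mulrA ler_pdivrMr//.
  by rewrite mulrC; apply: ler_wpM2l; [exact: ltW|rewrite lerDl].
have trn x : 0 <= x <= ub -> (Num.truncn (x / (eta / 3)) <= m)%N.
  by move=> /andP[a0 a1]; apply: le_truncn; rewrite ler_pM2r// invr_gt0.
have keq : Num.truncn (tau (p i) / (eta / 3)) = Num.truncn (tau' (p i) / (eta / 3)).
  have := congr1 (fun f : {ffun 'I_n -> 'I_m.+1} => val (f i)) hk.
  by rewrite !ffunE /= !inordK// ltnS; apply: trn; [exact: y3|exact: x3].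
have pp : `|tau (p i) - tau' (p i)| <= eta / 3.
  have nn f : 0 <= f (p i) <= ub -> 0 <= f (p i) / (eta / 3).
    by move=> /andP[a0 _]; rewrite divr_ge0// ltW.
  have /andP[u1 u2] := truncn_itv (nn tau (x3 _ (pS i))).
  have /andP[v1 v2] := truncn_itv (nn tau' (y3 _ (pS i))).
  rewrite keq in u1 u2.
  have -> : tau (p i) - tau' (p i) = (tau (p i) / (eta / 3) - tau' (p i) / (eta / 3)) * (eta / 3).
    by rewrite -mulrBl divfK// gt_eqF.
  rewrite normrM (gtr0_norm e3) ler_piMl ?(ltW e3)//.
  have cell (x x' : R) n' : n'%:R <= x -> x < n'.+1%:R -> n'%:R <= x' -> x' < n'.+1%:R -> `|x - x'| <= 1.
    by rewrite -natr1 => *; rewrite ler_norml; apply/andP; split; lra.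
  exact: cell u1 u2 v1 v2.
have l1 := lip _ x2; have l2 := lip _ y2.
rewrite !(x1 _ Ss) !(x1 _ (pS i)) in l1; rewrite !(y1 _ Ss) !(y1 _ (pS i)) in l2.
have -> : tau s - tau' s = (tau s - tau (p i)) + (tau (p i) - tau' (p i)) - (tau' s - tau' (p i)) by ring.
apply: (le_trans (ler_normB _ _)); apply: (le_trans (lerD (ler_normD _ _) (lexx _))).
have -> : eta = eta / 3 + eta / 3 + eta / 3 by field.
by rewrite !lerD.
Qed.

End net.

Lemma sup_on_ge {R : realType} q (S : set 'rV[R]_q) g s : S s -> (g s <= sup_on S g)%E.
Proof. by move=> Ss; apply: ereal_sup_ubound; exists s. Qed.

Section sieve.
Context {R : realType} {qt qc : nat}.
Variables (St : set 'rV[R]_qt) (Sc : set 'rV[R]_qc).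
Variables (F : set (('rV[R]_qt -> R) * ('rV[R]_qc -> R))).
Variable (V : nat -> set (('rV[R]_qt -> R) * ('rV[R]_qc -> R))).
Hypothesis hdense : forall p, F p -> exists pd : nat -> ('rV[R]_qt -> R) * ('rV[R]_qc -> R),
  (forall d, (0 < d)%N -> V d (pd d)) /\
  (dist1 St (pd d).1 p.1 + dist1 Sc (pd d).2 p.2)%E @[d --> \oo] --> 0%E.

(** Density gives a threshold in [d] for each single function. One representative per pair of keys
    makes it uniform: there are finitely many pairs, and functions sharing both keys differ by at
    most [eta / 2] on the sets. *)
Lemma sieve_uniform eta (T1 T2 : finType) (k1 : ('rV[R]_qt -> R) -> T1)
    (k2 : ('rV[R]_qc -> R) -> T2) : 0 < eta ->
  (forall p p', F p -> F p' -> k1 p.1 = k1 p'.1 -> forall s, St s -> `|p.1 s - p'.1 s| <= eta / 2) ->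
  (forall p p', F p -> F p' -> k2 p.2 = k2 p'.2 -> forall s, Sc s -> `|p.2 s - p'.2 s| <= eta / 2) ->
  exists D0 : nat, forall d, (0 < d)%N -> (D0 <= d)%N -> forall p, F p ->
    exists2 p', V d p' & forall st sc, St st -> Sc sc ->
      `|p'.1 st - p.1 st| <= eta /\ `|p'.2 sc - p.2 sc| <= eta.
Proof.
move=> e0 h1 h2.
have e2 : 0 < eta / 2 by rewrite divr_gt0.
have cell (k : T1 * T2) : exists D : nat, forall d, (0 < d)%N -> (D <= d)%N -> forall p, F p ->
    (k1 p.1, k2 p.2) = k -> exists2 p', V d p' & forall st sc, St st -> Sc sc ->
      `|p'.1 st - p.1 st| <= eta /\ `|p'.2 sc - p.2 sc| <= eta.
  have [[p0 [Fp0 kp0]]|no] := pselect (exists p0, F p0 /\ (k1 p0.1, k2 p0.2) = k); last first.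
    by exists 0%N => d _ _ p Fp kp; exfalso; apply: no; exists p.
  have [pd [Vpd cpd]] := hdense Fp0.
  have [D hD] : exists D, forall d, (D <= d)%N ->
      (dist1 St (pd d).1 p0.1 + dist1 Sc (pd d).2 p0.2 < (eta / 2)%:E)%E.
    exact: cvge0_lt cpd _ e2.
  exists D => d d0 Dd p Fp kp; exists (pd d); first exact: Vpd.
  move=> st sc Sst Ssc.
  have [kk1 kk2] : k1 p0.1 = k1 p.1 /\ k2 p0.2 = k2 p.2 by move: kp0; rewrite -kp => -[-> ->].
  have := hD d Dd; rewrite /dist1.
  (* A supremum over the empty set is [-oo]; the given points of [St] and [Sc] make all four suprema
     nonnegative, so each is bounded by the sum. *)
  have nn q (S : set 'rV[R]_q) (f : 'rV[R]_q -> 'rV[R]_q) s : S s -> (0 <= sup_on S (fun s => (norm2 (f s))%:E))%E.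
    move=> Ss; apply: le_trans (sup_on_ge _ Ss).
    by rewrite lee_fin sqrtr_ge0.
  have a1 := sup_on_ge (fun s => `|(pd d).1 s - p0.1 s|%:E) Sst.
  have a2 := sup_on_ge (fun s => `|(pd d).2 s - p0.2 s|%:E) Ssc.
  have n1 := nn _ _ (fun s => grad (pd d).1 s - grad p0.1 s) _ Sst.
  have n2 := nn _ _ (fun s => grad (pd d).2 s - grad p0.2 s) _ Ssc.
  set A := sup_on _ _ in a1 *; set A' := sup_on _ _ in n1 *.
  set B := sup_on _ _ in a2 *; set B' := sup_on _ _ in n2 *.
  move=> hlt.
  have A0 : (0 <= A)%E by apply: le_trans a1; rewrite lee_fin.
  have B0 : (0 <= B)%E by apply: le_trans a2; rewrite lee_fin.
  have tA : `|(pd d).1 st - p0.1 st| <= eta / 2.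
    rewrite -lee_fin; apply: (le_trans a1); apply: le_trans (ltW hlt).
    by rewrite -addeA leeDl// !adde_ge0.
  have tB : `|(pd d).2 sc - p0.2 sc| <= eta / 2.
    rewrite -lee_fin; apply: (le_trans a2); apply: le_trans (ltW hlt).
    by rewrite addeCA leeDl// !adde_ge0.
  have s1 := h1 _ _ Fp0 Fp kk1 _ Sst; have s2 := h2 _ _ Fp0 Fp kk2 _ Ssc.
  have tri (x y z : R) : `|x - y| <= eta / 2 -> `|y - z| <= eta / 2 -> `|x - z| <= eta.
    move=> u1 u2; have -> : x - z = (x - y) + (y - z) by ring.
    by apply: (le_trans (ler_normD _ _)); rewrite (splitr eta) lerD.
  by split; [exact: tri tA s1|exact: tri tB s2].
have [D hD] := fin_all_exists cell.
exists (\max_k D k) => d d0 Dd p Fp.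
apply: (hD (k1 p.1, k2 p.2) d d0) => //; apply: leq_trans Dd.
exact: leq_bigmax.
Qed.

End sieve.

(** * Optimality *)

Theorem theorem6p1 (R : realType)
  (disp : measure_display) (Omega : measurableType disp)
  (P : probability Omega R)
  (theta : forall d : nat, d.-tuple R)
  (eps : forall d : nat, 'I_d -> Omega -> R)
  (hiid : forall d : nat, iid_std_normal P (eps d))
  (qt qc : nat) (hqt : (0 < qt)%N) (hqc : (0 < qc)%N)
  (psit : 'I_qt -> R -> R) (psic : 'I_qc -> R -> R)
  (Cpsi rpsi : R) (hCpsi : 0 < Cpsi) (hrpsi : 0 <= rpsi)
  (hpsit : forall m, smooth2 (psit m) /\ poly_growth2 (psit m) Cpsi rpsi)
  (hpsic : forall l, smooth2 (psic l) /\ poly_growth2 (psic l) Cpsi rpsi)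
  (St : set 'rV[R]_qt) (Sc : set 'rV[R]_qc)
  (hSt : compact St) (hSc : compact Sc)
  (hS : overwhelming P (fun d => [set w |
     let z := observation (theta d) (eps d) w in
     St (summary psit z) /\ Sc (summary psic z)]))
  (tmax cmax Lt Lc : R) (hcmax : 0 <= cmax < 1)
  (bt bc : R) (hbc : bc < 1)
  (extt : ('rV[R]_qt -> R) -> 'rV[R]_qt -> R)
  (extc : ('rV[R]_qc -> R) -> 'rV[R]_qc -> R)
  (hextt : extension_rule St tmax Lt bt extt)
  (hextc : extension_rule Sc cmax Lc bc extc)
  (order : nat) (horder : (3 <= order)%N)
  (Kt Kc : nat -> nat)
  (Tsieve : nat -> set ('rV[R]_qt -> R)) (Csieve : nat -> set ('rV[R]_qc -> R))
  (hT : forall d, (0 < d)%N -> spline_sieve St order (Kt d) (Tsieve d))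
  (hC : forall d, (0 < d)%N -> spline_sieve Sc order (Kc d) (Csieve d))
  (hKt : Kt d @[d --> \oo] --> \oo) (hKc : Kc d @[d --> \oo] --> \oo)
  (hm : (Kt d + Kc d)%:R / d%:R @[d --> \oo] --> (0 : R))
  (hsub : forall d, (0 < d)%N -> Tsieve d `*` Csieve d `<=`
     admissible St Sc tmax cmax Lt Lc)
  (hdense : forall p, admissible St Sc tmax cmax Lt Lc p ->
     exists pd : nat -> ('rV[R]_qt -> R) * ('rV[R]_qc -> R),
       (forall d, (0 < d)%N -> (Tsieve d `*` Csieve d) (pd d)) /\
       (dist1 St (pd d).1 p.1 + dist1 Sc (pd d).2 p.2)%E @[d --> \oo] --> 0%E)
  (G : probability (measurableTypeR R) R)
  (hG : weak_cvg (fun d => empirical (theta d)) G)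
  (hexp : exists2 lambda0 : R, 0 < lambda0 & exists B : R,
     forall d, (0 < d)%N ->
       d%:R^-1 * \sum_(i < d) expR (lambda0 * `|tnth (theta d) i|) <= B)
  (lhat : forall d : nat, d.-tuple R -> R -> R)
  (a : nat -> R) (ha : a d @[d --> \oo] --> +oo)
  (hlhat : cvg0_in_prob P (fun d w => ereal_sup
     [set (`|lhat d (observation (theta d) (eps d) w) z - score G z|)%:E
       | z in [set z : R | `|z| <= a d]]))
  (hl : ereal_sup [set (`|score (empirical (theta d)) z - score G z|)%:E
       | z in [set z : R | `|z| <= a d]] @[d --> \oo] --> 0%E)
  (hM : exists M : nat -> R -> R, exists CM q : R,
     [/\ 2 <= q, forall d, measurable_fun setT (M d),
        forall d y z, (0 < d)%N ->
          `|lhat d y z| + `|score (empirical (theta d)) z| <= M d z &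
        forall d z, (0 < d)%N -> M d z ^+ 2 <= CM * (1 + `|z| `^ q)])
  (hscore : ((d%:R^-1)%:E * \sum_(i < d)
     'E_P[fun w => (let zi := tnth (theta d) i + eps d i w in
       (tnth (theta d) i - zi - score (empirical (theta d)) zi) ^+ 2)%R])%E
     @[d --> \oo] --> 0%E)
  (nomad : forall d : nat, d.-tuple R ->
     ('rV[R]_qt -> R) * ('rV[R]_qc -> R))
  (hnomad : forall d (y : d.-tuple R), (0 < d)%N ->
     is_argmin (Tsieve d `*` Csieve d)
       (fun p => Rhat (lhat d y) y
          (functional psit extt p.1) (functional psic extc p.2))
       (nomad d y)) :
  let riskF d (p : ('rV[R]_qt -> R) * ('rV[R]_qc -> R)) :=
    risk P (theta d) (eps d)
      (functional psit extt p.1) (functional psic extc p.2) in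
  let Rstar d := ereal_inf [set riskF d p | p in admissible St Sc tmax cmax Lt Lc] in
  cvg0_in_prob P (fun d w =>
    ((d%:R^-1)%:E *
     (riskF d (nomad d (observation (theta d) (eps d) w)) - Rstar d))%E).
Proof.
set F := admissible St Sc tmax cmax Lt Lc.
move=> riskF Rstar.
pose N := (Num.truncn rpsi).+1; pose C := 2 * Cpsi.
have C0 : 0 <= C by rewrite mulr_ge0// ltW.
have tpsit : psi_tame psit C N := smooth_psi_tame (ltW hCpsi) hrpsi hpsit.
have tpsic : psi_tame psic C N := smooth_psi_tame (ltW hCpsi) hrpsi hpsic.
have [L1 hL1] := extension_tame hextt; have [L2 hL2] := extension_tame hextc.
have Fnomad d (y : d.-tuple R) : (0 < d)%N -> F (nomad d y).
  by move=> d0; apply: (hsub d d0); have [] := hnomad d y d0.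
have tame1 p : F p -> tame L1 bt (extt p.1) by move=> [/= /hL1[]].
have tame2 p : F p -> tame L2 bc (extc p.2) by move=> [_ /= /hL2[]].
have ext1 p s : F p -> St s -> extt p.1 s = p.1 s by move=> [/= /hL1[h _] _]; exact: h.
have ext2 p s : F p -> Sc s -> extc p.2 s = p.2 s by move=> [_ /= /hL2[h _]]; exact: h.
(* [bc] bounds an absolute value, hence is nonnegative; the minimizer at [d = 1] supplies an
   admissible function. *)
have hb : 0 <= bc < 1.
  have [_ /(_ 0) h _] := tame2 _ (Fnomad 1%N (nseq_tuple 1 0) isT).
  by rewrite hbc andbT (le_trans _ h).
move=> e e0; apply: cvge0_intro => [d|kap kap0]; first exact: outer_ge0.
have k4 : 0 < kap / 4 by rewrite divr_gt0.
(* Six errors of size [eta] add up at the end; the seventh is slack. *)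
pose eta := e / 7; have eta0 : 0 < eta by rewrite divr_gt0.
(* Covers the exponents [N * 2 + 12] of the two risk estimates and 24 of [plug_close]. *)
pose m := (N * 2 + 24)%N.
have [K K0 hK] := denoised_event hiid hexp ha hlhat hl hM hscore m k4.
have [Bth Bth0 hBth] := theta_moment hexp (N * 2).
have [rho rho0 hrho] := plug_close psit psic bt hb eta0 K0.
have [d1 d10 [D1 hD1]] := risk_estimate C0 tpsit tpsic L1 L2 bt hb eta0 K0.
have [D2 hD2] := rhat_estimate C0 tpsit tpsic L1 L2 bt hb eta0 K0.
(* With [r1 = rho / k], moving a summary by [2 * r1] in each coordinate changes an extended function
   by at most [rho / 4]. *)
pose k := 8 * (`|L1| * qt%:R + `|L2| * qc%:R + 1).
have LL0 : 0 <= `|L1| * qt%:R + `|L2| * qc%:R by rewrite addr_ge0 ?mulr_ge0.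
have k0 : 0 < k by rewrite mulr_gt0// ltr_wpDl.
pose r1 := rho / k; have r10 : 0 < r1 by rewrite divr_gt0.
have r2 : 0 < r1 / 2 / (K + 1) by rewrite !divr_gt0// ltr_wpDl.
have [M1 M10 hM1] := emean_mod C0 tpsit r2; have [M2 M20 hM2] := emean_mod C0 tpsic r2.
pose d2 := r1 / 2 / (M1 + M2 + 1).
have MM : 0 < M1 + M2 + 1 by rewrite ltr_wpDl// addr_ge0.
have d20 : 0 < d2 by rewrite !divr_gt0.
have dl0 : 0 < Num.min d1 d2 by rewrite lt_min d10 d20.
have [D3 hD3] := hK _ dl0.
have [D4 hD4] := summary_event theta hiid C0 tpsit Bth r10 k4.
have [D5 hD5] := summary_event theta hiid C0 tpsic Bth r10 k4.
(* At power 0, overwhelming probability says that the outer measure of the complement tends to 0. *)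
have [D6 hD6] := cvge0_lt (hS 0%N) k4.
have rho2 : 0 < rho / 2 by rewrite divr_gt0.
have rho4 : 0 < rho / 2 / 2 by rewrite !divr_gt0.
have [T1 [k1 hk1]] := @class_net R qt St hSt L1 bt tmax [set tau | smooth_class St tmax Lt tau]
  extt (rho / 2 / 2) rho4 (fun tau h => let: And3 _ h2 _ := h in
    let: conj h3 h4 := hL1 tau h in And3 h3 h4 h2).
have [T2 [k2 hk2]] := @class_net R qc Sc hSc L2 bc cmax [set tau | smooth_class Sc cmax Lc tau]
  extc (rho / 2 / 2) rho4 (fun tau h => let: And3 _ h2 _ := h in
    let: conj h3 h4 := hL2 tau h in And3 h3 h4 h2).
have [D7 hD7] := @sieve_uniform R qt qc St Sc F (fun d => Tsieve d `*` Csieve d) hdense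
  (rho / 2) T1 T2 k1 k2 rho2 (fun p p' Fp Fp' => hk1 p.1 p'.1 Fp.1 Fp'.1)
  (fun p p' Fp Fp' => hk2 p.2 p'.2 Fp.2 Fp'.2).
exists (maxn 1 (maxn (maxn D1 (maxn D2 D3)) (maxn (maxn D4 D5) (maxn D6 D7)))) => d.
rewrite !geq_max => /and3P[d0 /and3P[hd1 hd2 hd3] /andP[/andP[hd4 hd5] /andP[hd6 hd7]]].
have {}hD3 := hD3 d d0 hd3.
have {}hD4 := hD4 d d0 hd4 (hBth d d0); have {}hD5 := hD5 d d0 hd5 (hBth d d0).
have {}hD6 := hD6 d hd6; rewrite expr0 mul1e in hD6.
set g1 := (X in ~` X) in hD3; set g2 := (X in ~` X) in hD4.
set g3 := (X in ~` X) in hD5; set g4 := (X in ~` X) in hD6.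
have dr : 0 < d%:R :> R by rewrite ltr0n.
apply: (@le_trans _ _ ((P^*)%mu (~` g1 `|` (~` g2 `|` (~` g3 `|` ~` g4))))%E); last first.
  apply: (@le_trans _ _ ((kap / 4)%:E + ((kap / 4)%:E + ((kap / 4)%:E + (kap / 4)%:E)))%E).
    apply: (le_trans (outer_U2 _ _ _)); apply: leeD => //.
    apply: (le_trans (outer_U2 _ _ _)); apply: leeD => //.
    apply: (le_trans (outer_U2 _ _ _)); apply: leeD => //; exact: ltW.
  have sum4 : kap / 4 + (kap / 4 + (kap / 4 + kap / 4)) = kap by field.
  by rewrite -!EFinD sum4.
(* From here on the outcome is fixed and lies in all four good events; the rest is deterministic. *)
apply: outer_le => w /= hw; apply: contrapT => hn.
have [hg1 hg2 hg3 hg4] : [/\ g1 w, g2 w, g3 w & g4 w].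
  by split; apply: contrapT => h; apply: hn; [left|right; left|right; right; left|right; right; right].
move: hw; apply/negP; rewrite -leNgt.
set y := observation (theta d) (eps d) w in hg2 hg3 hg4 *.
pose u := @denoised R _ Omega theta eps lhat d w.
have [hK1 hdl] : avg (fun i => (wt (tnth (theta d) i) * wt (tnth u i)) ^+ m) <= K /\
  avg (fun i => (tnth (theta d) i - tnth u i) ^+ 2) <= Num.min d1 d2 := hg1.
move: hdl; rewrite le_min => /andP[hdl1 hdl2].
have [sSt sSc] : St (summary psit y) /\ Sc (summary psic y) := hg4.
have W1 i : 1 <= wt (tnth (theta d) i) * wt (tnth u i).
  by rewrite -[1]mul1r ler_pM ?wt_ge1.
have hKn n : (n <= m)%N -> avg (fun i => (wt (tnth (theta d) i) * wt (tnth u i)) ^+ n) <= K.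
  by move=> hn'; apply: le_trans hK1; apply: ler_avg => i; rewrite ler_weXn2l.
have hKu n : (n <= m)%N -> avg (fun i => wt (tnth u i) ^+ n) <= K.
  move=> hn'; apply: le_trans (hKn n hn'); apply: ler_avg => i.
  by rewrite lerXn2r ?nnegrE ?wt_ge0 ?mulr_ge0 ?wt_ge0// ler_peMl ?wt_ge0 ?wt_ge1.
have m1 : (N * 2 + 12 <= m)%N by rewrite leq_add2l.
have m2 : (N * 2 <= m)%N by rewrite leq_addr.
have m3 : (24 <= m)%N by rewrite leq_addl.
(* The observed summary is near its mean at [theta], which is near the mean at [u]; each step costs
   [r1]. *)
have close q (psi : 'I_q -> R -> R) M : 0 <= M -> M <= M1 + M2 + 1 ->
    (forall d (u v : d.-tuple R) j, `|emean psi u 0 j - emean psi v 0 j| <=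
       r1 / 2 / (K + 1) * avg (fun i => (wt (tnth u i) * wt (tnth v i)) ^+ (N * 2)) +
       M * avg (fun i => (tnth u i - tnth v i) ^+ 2)) ->
    (forall j, `|summary psi y 0 j - emean psi (theta d) 0 j| <= r1) ->
    forall j, `|summary psi y 0 j - emean psi u 0 j| <= 2 * r1.
  move=> M0 MM' hM' hs j.
  have -> : summary psi y 0 j - emean psi u 0 j = (summary psi y 0 j - emean psi (theta d) 0 j) +
     (emean psi (theta d) 0 j - emean psi u 0 j) by ring.
  apply: (le_trans (ler_normD _ _)); rewrite mulr_natl mulr2n lerD//.
  apply: (le_trans (hM' _ _ _ _)); rewrite [leRHS](splitr r1) lerD//.
    apply: (@le_trans _ _ (r1 / 2 / (K + 1) * (K + 1))); last by rewrite divfK// gt_eqF// ltr_wpDl.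
    by apply: ler_wpM2l; [exact: ltW|rewrite (le_trans (hKn _ m2))// lerDl].
  apply: (@le_trans _ _ ((M1 + M2 + 1) * d2)); last by rewrite mulrC divfK// gt_eqF.
  by apply: ler_pM => //; apply: avg_ge0 => i; exact: sqr_ge0.
have close1 := close _ psit M1 M10 _ hM1 hg2; have close2 := close _ psic M2 M20 _ hM2 hg3.
have {}close1 : forall j, `|summary psit y 0 j - emean psit u 0 j| <= 2 * r1.
  by apply: close1; rewrite -addrA lerDl addr_ge0.
have {}close2 : forall j, `|summary psic y 0 j - emean psic u 0 j| <= 2 * r1.
  by apply: close2; rewrite addrAC lerDr addr_ge0.
have R1 p : F p -> exists2 r, riskF d p = (d%:R * r)%:E & `|r - plug psit psic (extt p.1) (extc p.2) u| <= eta.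
  by move=> Fp; apply: (hD1 _ _ _ _ _ _ _ _ _ (tame1 p Fp) (tame2 p Fp) (hiid d) d0 hd1 (hKn _ m1) hdl1).
have hu i : tnth u i = tnth y i + lhat d y (tnth y i) by rewrite tnth_mktuple.
have R2 p : F p -> exists2 r, Rhat (lhat d y) y (functional psit extt p.1) (functional psic extc p.2) =
     (d%:R * r)%:E & `|r - plug psit psic (extt p.1) (extc p.2) u| <= eta.
  by move=> Fp; apply: (hD2 _ _ _ _ _ _ (tame1 p Fp) (tame2 p Fp) d0 hd2 hu (hKu _ m1)).
have FN := Fnomad d y d0.
have [rN rNE rNp] := R1 _ FN; have [hN hNE hNp] := R2 _ FN.
have Rs0 : (0 <= Rstar d)%E.
  apply: le_ereal_inf_tmp => _ [p _ <-]; rewrite /riskF /risk unlock; apply: integral_ge0 => w' _.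
  by rewrite lee_fin; apply: sumr_ge0 => i _; exact: sqr_ge0.
have RsN : (Rstar d <= (d%:R * rN)%:E)%E.
  by rewrite -rNE; apply: ereal_inf_lbound; exists (nomad d y).
have Rsfin : Rstar d \is a fin_num by rewrite ge0_fin_numE// (le_lt_trans RsN)// ltry.
(* The infimum need not be attained; being finite, it has a minimizer up to [eta * d], which depends
   on [d]. *)
have [x [p0 Fp0 <-] hp0] := lb_ereal_inf_adherent (mulr_gt0 eta0 dr) Rsfin.
have [p' Vp' hp'] := hD7 d d0 hd7 _ Fp0.
have Fp' : F p' by exact: (hsub d d0).
have [r0 r0E r0p] := R1 _ Fp0; have [h' h'E h'p] := R2 _ Fp'.
have hNh' : hN <= h'.
  have [_ /(_ _ Vp')] := hnomad d y d0.
  by rewrite hNE h'E lee_fin ler_pM2l.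
have [hp1 hp2] := hp' _ _ sSt sSc.
(* Closeness is known at the observed summary, where extensions agree with the original functions.
   The Lipschitz bound carries it to the mean summary, at a cost of [rho / 4] for each function. *)
have ktri q (psi : 'I_q -> R -> R) L b (f f' : 'rV[R]_q -> R) :
    tame L b f -> tame L b f' -> `|L| * q%:R <= `|L1| * qt%:R + `|L2| * qc%:R ->
    (forall j, `|summary psi y 0 j - emean psi u 0 j| <= 2 * r1) ->
    `|f (summary psi y) - f' (summary psi y)| <= rho / 2 ->
    `|f (emean psi u) - f' (emean psi u)| <= rho.
  move=> tf tf' Lq cl ff'; set s := summary psi y; set mu := emean psi u.
  have lip h : tame L b h -> `|h s - h mu| <= rho / 4.
    move=> th; apply: (le_trans (tame_lip_le th cl)).
    apply: (@le_trans _ _ ((`|L1| * qt%:R + `|L2| * qc%:R + 1) * (2 * r1))).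
      apply: ler_wpM2r; first by rewrite mulr_ge0// ltW.
      by rewrite (le_trans Lq)// lerDl.
    rewrite le_eqVlt; apply/orP; left; apply/eqP; rewrite /r1 /k; field.
    by rewrite gt_eqF// ltr_wpDl.
  have l1 := lip _ tf; have l2 := lip _ tf'.
  have -> : f mu - f' mu = (f s - f' s) - (f s - f mu) + (f' s - f' mu) by ring.
  apply: (le_trans (ler_normD _ _)); apply: (le_trans (lerD (ler_normB _ _) (lexx _))).
  have -> : rho = rho / 2 + rho / 4 + rho / 4 by field.
  by rewrite !lerD.
have q1 : `|extt p'.1 (emean psit u) - extt p0.1 (emean psit u)| <= rho.
  apply: (ktri _ psit _ _ _ _ (tame1 _ Fp') (tame1 _ Fp0)) => //; first by rewrite lerDl mulr_ge0.
  by rewrite !ext1.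
have q2 : `|extc p'.2 (emean psic u) - extc p0.2 (emean psic u)| <= rho.
  apply: (ktri _ psic _ _ _ _ (tame2 _ Fp') (tame2 _ Fp0)) => //; first by rewrite lerDr mulr_ge0.
  by rewrite !ext2.
have tb p s : F p -> `|extt p.1 s| <= bt by move=> /tame1[_ h _].
have cb p s : F p -> `|extc p.2 s| <= bc by move=> /tame2[_ h _].
have pl := hrho _ _ _ _ d u d0 (tb p' ^~ Fp') (tb p0 ^~ Fp0) (cb p' ^~ Fp') (cb p0 ^~ Fp0)
  (hKu _ m3) q1 q2.
have {}hp0 : (riskF d p0 < Rstar d + (eta * d%:R)%:E)%E := hp0.
move: RsN hp0; rewrite rNE r0E -(fineK Rsfin); set rs := fine (Rstar d) => RsN hp0.
rewrite -EFinD lte_fin in hp0; rewrite lee_fin in RsN.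
rewrite -EFinB -EFinM abse_EFin lee_fin.
have dE (v : R) : d%:R^-1 * (d%:R * v) = v by rewrite mulKf// gt_eqF.
have a1 : rs / d%:R <= rN by rewrite ler_pdivrMr// mulrC.
have a2 : r0 <= rs / d%:R + eta.
  rewrite -(ler_pM2l dr) mulrDr (mulrC d%:R (rs / _)) divfK ?gt_eqF// (mulrC d%:R eta).
  exact: ltW.
rewrite mulrBr dE mulrC.
have eE : e = 7 * eta by rewrite /eta; field.
rewrite eE.
(* The chain runs from the risk of [nomad] to its [plug] and its [Rhat], by minimality to [Rhat] of
   [p'], then to the [plug] of [p'], the [plug] of [p0], the risk of [p0] and the infimum. *)
move: rNp hNp r0p h'p pl hNh' a1 a2 eta0; clear.
set pN := plug _ _ _ _ _; set pp := plug _ _ _ _ _; set pq := plug _ _ _ _ _.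
move: pN pp pq => pN pp pq; rewrite !ler_norml.
move: (rs / _) => z.
move=> /andP[? ?] /andP[? ?] /andP[? ?] /andP[? ?] /andP[? ?] ? ? ? ?; apply/andP; split; lra.
Qed.
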